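(* Let $\rho_1,\rho_2,\kappa,\alpha,h,c,r,\mu>0$, $L>0$ and $d,\xi_1,\xi_2\in\mathbb{R}$ be such that $cr-d^2>0$, i.e. the symmetric matrix $\begin{pmatrix} c & d\\ d& r\end{pmatrix}$ is positive definite, so that $rP^2+c\theta^2+2dP\theta>0$ for all real $(\theta,P)\neq(0,0)$. Let $(\varphi,\psi,\theta,P)$ be a solution on $(0,L)\times(0,\infty)$ of $$\begin{cases}\rho_{1}\varphi_{tt}-\kappa(\varphi_{x}+\psi)_{x}=0\\ -\rho_{2}\varphi_{ttx}-\alpha\psi_{xx}+\kappa(\varphi_{x}+\psi)-\xi_{1}\theta_{x}-\xi_{2}P_{x}+\mu\psi_t=0\\ c\theta_{t}+dP_{t}-\kappa\theta_{xx}-\xi_{1}\psi_{tx}=0\\ d\theta_{t}+rP_{t}-hP_{xx}-\xi_{2}\psi_{tx}=0\end{cases}$$ with the initial conditions $\varphi(\cdot,0)=\varphi_0$, $\varphi_t(\cdot,0)=\varphi_1$, $\varphi_{tt}(\cdot,0)=\varphi_2$, $\psi(\cdot,0)=\psi_0$, $\psi_t(\cdot,0)=\psi_1$, $\theta(\cdot,0)=\theta_0$, $P(\cdot,0)=P_0$ and the boundary conditions $\varphi=\psi=\theta=P=0$ at $x=0,L$, $t>0$. Then there exist positive constants $\lambda_1$ and $\lambda_2$ such that the energy $$\mathcal{E}(t)=\frac12\Big[\rho_{1}\int_{0}^{L}\varphi_{t}^{2}dx+\frac{\rho_{1}\rho_{2}}{\kappa}\int_{0}^{L}\varphi_{tt}^{2}dx+\rho_{2}\int_{0}^{L}\varphi_{tx}^{2}dx+\kappa\int_{0}^{L}(\varphi_{x}+\psi)^{2}dx+\alpha\int_{0}^{L}\psi_{x}^{2}dx+\Big(c-\frac{d^2}{r}\Big)\int_{0}^{L}\theta^{2}dx+\int_{0}^{L}|r^{1/2}P+dr^{-1/2}\theta|^2dx\Big]$$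 satisfies $$\mathcal{E}(t)\leq\lambda_2 e^{-\lambda_1 t}\qquad\text{for all } t\geq0.$$
   Context: Solutions are understood in the class $\varphi,\varphi_t\in L^\infty(\mathbb{R}_+,H^1_0(0,L))$, $\psi\in L^\infty(\mathbb{R}_+,H^1(0,L))$, $\psi_t\in L^\infty(\mathbb{R}_+,L^2_*(0,L))$, $\varphi_{tt},\theta,P\in C(\mathbb{R}_+,L^2(0,L))$, where $L^2_*(0,L)=\{u\in L^2(0,L):\int_0^Lu\,dx=0\}$. *)

(* Defs.v *)
From HB Require Import structures.
From mathcomp Require Import all_boot all_order all_algebra.
From mathcomp Require Import all_classical all_reals all_analysis.

Set Implicit Arguments.
Unset Strict Implicit.
Unset Printing Implicit Defensive.

Import Order.TTheory GRing.Theory Num.Theory.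
Import numFieldNormedType.Exports.

Local Open Scope classical_set_scope.
Local Open Scope ring_scope.

(* A function of (x, t) is represented by [u : R -> R -> R] with the TIME
   variable first: [u t] is the function x |-> u(x, t).  Only its values for
   t >= 0 and x in ]0, L[ matter. *)

Notation leb := (@lebesgue_measure _).

(** ** Function spaces on (0, L) *)

Section Spaces.
Context {R : realType}.
Implicit Types (L : R) (u v w : R -> R).

Definition L2 L : set (R -> R) := [set u : R -> R |
  measurable_fun `]0, L[%classic u /\
  leb.-integrable `]0, L[%classic (EFin \o (fun x : R => u x ^+ 2))].

Definition ip L u v : R := \int[leb]_(x in `]0, L[%classic) (u x * v x).

Definition L2norm L u : R := Num.sqrt (ip L u u).

Definition eqL2 L u v : Prop :=
  {ae leb, forall x, `]0, L[%classic x -> u x = v x}.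

(* mean-zero square-integrable functions *)
Definition L2star L : set (R -> R) := [set u : R -> R |
  L2 L u /\ \int[leb]_(x in `]0, L[%classic) u x = 0].

Definition smooth w : Prop :=
  forall (n : nat) (x : R), derivable (w^`(n))%classic x 1.

(* C_c^oo(O), for an open subset O of the line *)
Definition test_fun (O : set R) : set (R -> R) := [set w : R -> R |
  smooth w /\
  exists K : set R, [/\ compact K, K `<=` O & forall x, ~ K x -> w x = 0]].

Definition weak_deriv L u v : Prop :=
  forall w, test_fun `]0, L[%classic w -> ip L u (w^`())%classic = - ip L v w.

Definition H1 L : set (R -> R) := [set u : R -> R |
  L2 L u /\ exists v, L2 L v /\ weak_deriv L u v].

(* The weak derivative in L^2(0, L): a representative of the (a.e. unique)
   weak derivative of u when u is in H^1(0, L), and 0 otherwise. *)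
Definition ddx L u : R -> R :=
  xget (fun=> 0) [set v : R -> R | L2 L v /\ weak_deriv L u v].

Definition H1norm L u : R :=
  Num.sqrt (L2norm L u ^+ 2 + L2norm L (ddx L u) ^+ 2).

(* closure of C_c^oo(0, L) in H^1(0, L) *)
Definition H10 L : set (R -> R) := [set u : R -> R |
  H1 L u /\
  forall e : R, 0 < e ->
    exists2 w, test_fun `]0, L[%classic w & H1norm L (u \- w) < e].

End Spaces.

(** ** Functions of time with values in a space X normed by N *)

Section Bochner.
Context {R : realType}.
Implicit Types (L : R) (u v : R -> R -> R) (X : set (R -> R)) (N : (R -> R) -> R).

Definition simple_in_time X (s : R -> R -> R) : Prop :=
  exists (n : nat) (A : 'I_n -> set R) (f : 'I_n -> R -> R),
    (forall i, measurable (A i) /\ X (f i)) /\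
    forall t x, s t x = \sum_(i < n) \1_(A i) t * f i x.

(* Bochner measurability on R_+ *)
Definition strongly_measurable X N u : Prop :=
  exists s : nat -> R -> R -> R,
    (forall n, simple_in_time X (s n)) /\
    {ae leb, forall t, 0 < t -> (fun n => N (u t \- s n t)) @ \oo --> (0 : R)}.

(* L^oo(R_+, X) *)
Definition Linfty X N u : Prop :=
  [/\ {ae leb, forall t, 0 < t -> X (u t)},
      strongly_measurable X N u &
      exists M : R, {ae leb, forall t, 0 < t -> N (u t) <= M}].

(* C(R_+, L^2(0, L)), with R_+ = [0, +oo[ *)
Definition contL2 L u : Prop :=
  (forall t, 0 <= t -> L2 L (u t)) /\
  forall t0 : R, 0 <= t0 ->
    L2norm L (u t \- u t0) @[t --> within [set t | 0 <= t] (nbhs t0)] --> (0 : R).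

(* u is in C^1(R_+, L^2(0, L)), with derivative v *)
Definition C1L2 L u v : Prop :=
  [/\ contL2 L u, contL2 L v &
      forall t0 : R, 0 <= t0 ->
        L2norm L (fun x => (u t x - u t0 x) / (t - t0) - v t0 x)
          @[t --> within [set t | 0 <= t] t0^'] --> (0 : R)].

(* int_0^oo F(t) a(t) dt *)
Definition pairing (F a : R -> R) : R :=
  \int[leb]_(t in `]0, +oo[%classic) (F t * a t).

(* u_t = v in the sense of distributions on (0, L) x (0, oo); by density it is
   enough to test against products a(t) w(x). *)
Definition weak_time_deriv L u v : Prop :=
  forall w a : R -> R,
    test_fun `]0, L[%classic w -> test_fun `]0, +oo[%classic a ->
    pairing (fun t => ip L (u t) w) (a^`())%classic =
    - pairing (fun t => ip L (v t) w) a.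

End Bochner.

(** ** The system *)

Section System.
Context {R : realType}.
Implicit Types (L : R) (u v phi phit phitt psi psit theta P : R -> R -> R).

(* The representatives in time are chosen so that phi is in C^2(R_+, L^2)
   (which phi_tt in C(R_+, L^2) means) and psi in C(R_+, L^2) (psi and psi_t in
   L^oo(R_+, L^2) make psi a.e. equal to a Lipschitz function of time with
   values in L^2); this gives a meaning to the values at each time t >= 0. *)
Definition solution_class L phi phit phitt psi psit theta P : Prop :=
  [/\ [/\ C1L2 L phi phit, C1L2 L phit phitt,
          Linfty (H10 L) (H1norm L) phi & Linfty (H10 L) (H1norm L) phit],
      [/\ contL2 L psi, weak_time_deriv L psi psit,
          Linfty (H1 L) (H1norm L) psi & Linfty (L2star L) (L2norm L) psit] &
      contL2 L theta /\ contL2 L P].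

(* rho1 phi_tt - kappa (phi_x + psi)_x = 0 in D'((0, L) x (0, oo)) *)
Definition eq_phi (L rho1 kappa : R) phi phitt psi : Prop :=
  forall w a : R -> R,
    test_fun `]0, L[%classic w -> test_fun `]0, +oo[%classic a ->
    pairing (fun t =>
      rho1 * ip L (phitt t) w
      + kappa * ip L (ddx L (phi t) \+ psi t) (w^`())%classic) a = 0.

(* - rho2 phi_ttx - alpha psi_xx + kappa (phi_x + psi) - xi1 theta_x - xi2 P_x
   + mu psi_t = 0 in D'((0, L) x (0, oo)) *)
Definition eq_psi (L rho2 kappa alpha xi1 xi2 mu : R)
    phi phitt psi psit theta P : Prop :=
  forall w a : R -> R,
    test_fun `]0, L[%classic w -> test_fun `]0, +oo[%classic a ->
    pairing (fun t =>
      rho2 * ip L (phitt t) (w^`())%classic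
      + alpha * ip L (ddx L (psi t)) (w^`())%classic
      + kappa * ip L (ddx L (phi t) \+ psi t) w
      + xi1 * ip L (theta t) (w^`())%classic
      + xi2 * ip L (P t) (w^`())%classic
      + mu * ip L (psit t) w) a = 0.

(* Weak form of
     (a1 theta + a2 P)_t - k q_xx - xi psi_tx = 0,  q = 0 at x = 0, L,
   where q is theta or P.  As q is only in C(R_+, L^2), it has no trace: the
   homogeneous Dirichlet condition is imposed by transposition, i.e. by
   integrating by parts twice against the w in C^oo([0, L]) which vanish at 0
   and L but whose derivatives are free there. *)
Definition eq_diffusion (L a1 a2 k xi : R) theta P q psit : Prop :=
  forall w a : R -> R,
    smooth w -> w 0 = 0 -> w L = 0 -> test_fun `]0, +oo[%classic a ->
    - pairing (fun t => ip L (fun x => a1 * theta t x + a2 * P t x) w)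
                (a^`())%classic
    + pairing (fun t => - k * ip L (q t) (w^`(2))%classic
                      + xi * ip L (psit t) (w^`())%classic) a
    = 0.

Definition system (L rho1 rho2 kappa alpha h c r d xi1 xi2 mu : R)
    phi phitt psi psit theta P : Prop :=
  [/\ eq_phi L rho1 kappa phi phitt psi,
      eq_psi L rho2 kappa alpha xi1 xi2 mu phi phitt psi psit theta P,
      eq_diffusion L c d kappa xi1 theta P theta psit &
      eq_diffusion L d r h xi2 theta P P psit].

(* phi = psi = 0 at x = 0, L for t > 0; for theta and P see [eq_diffusion] *)
Definition boundary_conditions L phi psi : Prop :=
  forall t : R, 0 < t -> H10 L (phi t) /\ H10 L (psi t).

(* psi_t is only defined for almost every t, so psi_t(., 0) = psi1 is read as:
   (psi(t) - psi(0)) / t tends to psi1 weakly in L^2(0, L) as t -> 0+. *)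
Definition initial_conditions L phi phit phitt psi theta P
    (phi0 phi1 phi2 psi0 psi1 theta0 P0 : R -> R) : Prop :=
  [/\ [/\ eqL2 L (phi 0) phi0, eqL2 L (phit 0) phi1 & eqL2 L (phitt 0) phi2],
      eqL2 L (psi 0) psi0,
      L2 L psi1 /\
        (forall w, L2 L w ->
          ip L (fun x => (psi t x - psi 0 x) / t) w @[t --> 0^'+] --> ip L psi1 w) &
      eqL2 L (theta 0) theta0 /\ eqL2 L (P 0) P0].

Definition energy (L rho1 rho2 kappa alpha c r d : R)
    phi phit phitt psi theta P (t : R) : R :=
  let I (f : R -> R) : R := \int[leb]_(x in `]0, L[%classic) f x in
  2^-1 * (rho1 * I (fun x => phit t x ^+ 2)
          + rho1 * rho2 / kappa * I (fun x => phitt t x ^+ 2)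
          + rho2 * I (fun x => ddx L (phit t) x ^+ 2)
          + kappa * I (fun x => (ddx L (phi t) x + psi t x) ^+ 2)
          + alpha * I (fun x => ddx L (psi t) x ^+ 2)
          + (c - d ^+ 2 / r) * I (fun x => theta t x ^+ 2)
          + I (fun x =>
              `|Num.sqrt r * P t x + d / Num.sqrt r * theta t x| ^+ 2)).

End System.

(* Main.v *)
(* Formally the energy E satisfies E' = - mu |psi_t|^2 - kappa |theta_x|^2 - h |P_x|^2.
   Three multipliers recover the terms of E that are not dissipated: the primitive of
   phi_tt - mean phi_tt in the second equation controls |phi_tt - mean phi_tt|^2, test
   functions concentrated near the boundary control the mean of phi_tt, and phi_t in the
   time derivative of the first equation controls |phi_tx|^2 by |phi_tt|^2; the potential
   terms are then bounded at each time through the equations themselves.  Subtracting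
   small multiples of these functionals from E gives an exponentially decaying Lyapunov
   functional.

   Weak solutions are not regular enough for this computation.  But the system is linear
   and autonomous, so averaging twice in time produces strong solutions of the same
   system, to which the argument applies with constants independent of the averaging
   length, which is then sent to 0.

   Everything takes place in L^2(0, L), where H^1, H^1_0 and the transposed form of the
   diffusion equations are expressed by duality with the operator J f(x) = int_0^x f. *)

Require Import Defs.
From HB Require Import structures.
From mathcomp Require Import all_boot all_order all_algebra.
From mathcomp Require Import all_classical all_reals all_analysis.
From mathcomp Require Import measurable_realfun.
From mathcomp Require Import ring lra.

Set Implicit Arguments.
Unset Strict Implicit.
Unset Printing Implicit Defensive.

Import Order.TTheory GRing.Theory Num.Theory.
Import numFieldNormedType.Exports.

Local Open Scope classical_set_scope.
Local Open Scope ring_scope.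

(** * Semi-inner products and weakly differentiable curves *)

(** The energy identity needs phi_ttx, theta_x, P_x and a psi_t defined at every time, none of which
    a weak solution provides. A forward average over a window of length k turns a time derivative
    into a difference quotient. After two averages phi_ttx becomes a second difference quotient of
    phi_x, psi_t an average of difference quotients of psi, and theta_x, P_x can be read off the
    averaged diffusion equations. No bound uniform in k is needed for these quantities, because none
    of them enters the energy: it only contains terms bounded on the weak solution, phi_tx being
    controlled by the Lipschitz continuity of phi_x in time. So the energies of the averaged
    solutions at small positive times are bounded uniformly in k, and the decay passes to the limit
    by weak lower semicontinuity.

    Functions equal almost everywhere are not identified, so the scalar product has nonzero null
    vectors. Identities between vectors are therefore stated by pairing with all vectors, and curves
    are differentiated weakly. *)

Record inner_product (R : realType) (H : lmodType R) := InnerProduct {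
  dot :> H -> H -> R;
  dotC : forall x y, dot x y = dot y x;
  dotDl : forall x y z, dot (x + y) z = dot x z + dot y z;
  dotZl : forall a x y, dot (a *: x) y = a * dot x y;
  dot_ge0 : forall x, 0 <= dot x x }.

Section InnerProductTheory.
Context {R : realType} {H : lmodType R} (S : inner_product H).
Implicit Types (x y z w : H) (a s M : R).

Lemma dotDr x y z : S x (y + z) = S x y + S x z.
Proof. by rewrite dotC dotDl !(dotC S x). Qed.

Lemma dotZr a x y : S x (a *: y) = a * S x y.
Proof. by rewrite dotC dotZl dotC. Qed.

Lemma dotNl x y : S (- x) y = - S x y.
Proof. by rewrite -scaleN1r dotZl mulN1r. Qed.

Lemma dotNr x y : S x (- y) = - S x y.
Proof. by rewrite dotC dotNl dotC. Qed.

Lemma dotBl x y z : S (x - y) z = S x z - S y z.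
Proof. by rewrite dotDl dotNl. Qed.

Lemma dotBr x y z : S x (y - z) = S x y - S x z.
Proof. by rewrite dotDr dotNr. Qed.

Lemma dot0l x : S 0 x = 0.
Proof. by rewrite -(scale0r 0) dotZl mul0r. Qed.

Lemma dot0r x : S x 0 = 0.
Proof. by rewrite dotC dot0l. Qed.

Definition dotE := (dotDl, dotDr, dotBl, dotBr, dotNl, dotNr, dotZl, dotZr, dot0l, dot0r).

Definition nrm x : R := Num.sqrt (S x x).

Lemma nrm_ge0 x : 0 <= nrm x.
Proof. exact: sqrtr_ge0. Qed.

Lemma nrmE x : S x x = nrm x ^+ 2.
Proof. by rewrite sqr_sqrtr ?dot_ge0. Qed.

Lemma young s x y : 0 < s -> S x y <= s * S x x + (4 * s)^-1 * S y y.
Proof.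
move=> s0; have := dot_ge0 S (2 * s *: x - y).
rewrite !dotE (dotC S y x) => h.
rewrite -subr_ge0; set r := (X in 0 <= X).
have -> : r = (4 * s)^-1 * (2 * s * (2 * s * S x x) - 2 * s * S x y - (2 * s * S x y - S y y)).
  by rewrite /r; field; rewrite gt_eqF.
by rewrite mulr_ge0 // invr_ge0 mulr_ge0 // ltW.
Qed.

Lemma youngN s x y : 0 < s -> - S x y <= s * S x x + (4 * s)^-1 * S y y.
Proof. by move=> s0; have := young (- x) y s0; rewrite !dotE opprK. Qed.

Lemma young_abs s x y : 0 < s -> `|S x y| <= s * S x x + (4 * s)^-1 * S y y.
Proof. by move=> s0; rewrite ler_norml lerNl youngN // young. Qed.

Lemma cauchy_schwarz_sq x y : S x y ^+ 2 <= S x x * S y y.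
Proof.
have := dot_ge0 S y; rewrite le_eqVlt => /orP[/eqP y0|y0].
  have [->|xy0] := eqVneq (S x y) 0; first by rewrite expr0n mulr_ge0 ?dot_ge0.
  (* For a null [y] with [S x y] nonzero, this multiple of [y] would make the square equal to -1. *)
  have := dot_ge0 S (x - ((S x x + 1) / (2 * S x y)) *: y).
  rewrite !dotE -y0 (dotC S y x).
  have -> : (S x x + 1) / (2 * S x y) * S x y = (S x x + 1) / 2 by field.
  by rewrite !mulr0; lra.
have := dot_ge0 S (S y y *: x - S x y *: y).
rewrite !dotE (dotC S y x) => h.
rewrite -subr_ge0 -(pmulr_rge0 _ y0).
by apply: le_trans h _; rewrite le_eqVlt; apply/orP; left; apply/eqP; ring.
Qed.

Lemma cauchy_schwarz x y : `|S x y| <= nrm x * nrm y.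
Proof.
rewrite -(@ler_pXn2r _ 2) ?nnegrE ?mulr_ge0 ?nrm_ge0 //.
by rewrite exprMn -!nrmE real_normK ?num_real// cauchy_schwarz_sq.
Qed.

Lemma nrm_le_of_dot x M : 0 <= M -> S x x <= M * nrm x -> nrm x <= M.
Proof.
move=> M0; rewrite nrmE expr2; have := nrm_ge0 x.
rewrite le_eqVlt => /orP[/eqP <- //|x0]; by rewrite ler_pM2r.
Qed.

Lemma nrmZ a x : nrm (a *: x) = `|a| * nrm x.
Proof.
by rewrite /nrm !dotE mulrA -expr2 sqrtrM ?sqr_ge0// sqrtr_sqr.
Qed.

Lemma nrmN x : nrm (- x) = nrm x.
Proof. by rewrite -scaleN1r nrmZ normrN1 mul1r. Qed.

Lemma nrmD x y : nrm (x + y) <= nrm x + nrm y.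
Proof.
rewrite -(@ler_pXn2r _ 2) ?nnegrE ?addr_ge0 ?nrm_ge0 //.
rewrite -nrmE !dotE (dotC S y x) sqrrD -!nrmE.
have := le_trans (ler_norm _) (cauchy_schwarz x y); lra.
Qed.

Lemma nrmBC x y : nrm (x - y) = nrm (y - x).
Proof. by rewrite -nrmN opprB. Qed.

Lemma dot_sqrD x y : S (x + y) (x + y) <= 2 * S x x + 2 * S y y.
Proof. have := dot_ge0 S (x - y); rewrite !dotE (dotC S y x); lra. Qed.

Lemma dot_null x y : S x x = 0 -> S x y = 0.
Proof.
move=> x0; have := cauchy_schwarz_sq x y; rewrite x0 mul0r => h.
by apply/eqP; rewrite -sqrf_eq0 eq_le h sqr_ge0.
Qed.

(** [z] is paired with an approximation of itself in [T], since [z] need not belong to [T]. *)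
Lemma nrm_le_dense (T : set H) z M :
  (forall x e, 0 < e -> exists2 w, T w & nrm (x - w) < e) ->
  0 <= M -> (forall w, T w -> S z w <= M * nrm w) -> nrm z <= M.
Proof.
move=> T_dense M0 h; apply: nrm_le_of_dot => //; apply/ler_addgt0Pr => e e0.
have c0 : 0 < nrm z + M + 1 by have := nrm_ge0 z; lra.
have [w Tw hw] := T_dense z _ (divr_gt0 e0 c0).
have zE : z = w + (z - w) by rewrite addrC subrK.
rewrite {2}zE; set r := z - w in zE hw *.
have h1 := h w Tw; have h2 := le_trans (ler_norm _) (cauchy_schwarz z r).
have h3 : nrm w <= nrm z + nrm r.
  by have := nrmD z (- r); rewrite nrmN {1}zE addrK.
move: hw; rewrite ltr_pdivlMr// => hw; have := ler_wpM2l M0 h3.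
rewrite dotDr; have := nrm_ge0 r; nra.
Qed.

End InnerProductTheory.

(** * Derivatives and monotonicity on positive times *)

Section PositiveTimes.
Context {R : realType}.
Implicit Types (f df : R -> R) (s t : R).

Lemma is_deriveP f t (l : R) : is_derive t (1 : R) f l <->
  forall e : R, 0 < e -> exists2 r : R, 0 < r &
    forall s, `|s - t| < r -> `|f s - f t - l * (s - t)| <= e * `|s - t|.
Proof.
split=> [[df <-] e e0|h].
  move/cvg_ex : df => [k hk]; have -> : 'D_1 f t = k by apply/cvg_lim.
  move/cvgrPdist_le : hk => /(_ e e0) [r /= r0 hr]; exists r => // s str.
  have [->|st] := eqVneq s t; first by rewrite !subrr mulr0 subr0 normr0 mulr0.
  have st0 : s - t != 0 by rewrite subr_eq0.
  have := hr (s - t); rewrite /ball_ /= sub0r normrN => /(_ str st0).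
  rewrite /GRing.scale/= mulr1 subrK => h.
  have -> : f s - f t - k * (s - t) = - ((k - (s - t)^-1 * (f s - f t)) * (s - t)).
    by field.
  by rewrite normrN normrM ler_wpM2r.
have : (fun k : R => k^-1 *: ((f \o shift t) (k *: (1 : R)) - f t)) @ 0^' --> l.
  apply/cvgrPdist_le => e e0; have [r r0 hr] := h e e0.
  exists r => //= k; rewrite /ball_/= sub0r normrN => kr k0.
  rewrite /GRing.scale/= mulr1; have := hr (k + t); rewrite addrK => /(_ kr) h1.
  have -> : l - k^-1 * (f (k + t) - f t) = - (k^-1 * (f (k + t) - f t - l * k)).
    by field.
  by rewrite normrN normrM normfV mulrC ler_pdivrMr ?normr_gt0.
by move=> hl; split; [apply/cvg_ex; exists l|exact/cvg_lim].
Qed.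

Lemma mvt_pos f df s t : (forall u : R, 0 < u -> is_derive u (1 : R) f (df u)) ->
  0 < s -> s <= t -> exists2 c, s <= c <= t & f t - f s = df c * (t - s).
Proof.
move=> fdf s0 st.
have [||c] := @MVT_segment R f df s t st.
- by move=> u; rewrite in_itv/= => /andP[su _]; apply: fdf; exact: lt_trans su.
- apply: derivable_within_continuous => u; rewrite in_itv/= => /andP[su _].
  by have [] := fdf u (lt_le_trans s0 su).
by rewrite in_itv/= => hc e; exists c.
Qed.

Lemma derive_le0_nincr f df s t : (forall u : R, 0 < u -> is_derive u (1 : R) f (df u)) ->
  (forall u, 0 < u -> df u <= 0) -> 0 < s -> s <= t -> f t <= f s.
Proof.
move=> fdf df0 s0 st; have [c /andP[sc ct] e] := mvt_pos fdf s0 st.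
rewrite -subr_le0 e mulr_le0_ge0 ?subr_ge0// df0//; exact: lt_le_trans sc.
Qed.

Lemma exp_decay f df (l : R) s t : (forall u : R, 0 < u -> is_derive u (1 : R) f (df u)) ->
  (forall u, 0 < u -> df u <= - l * f u) -> 0 < s -> s <= t ->
  f t <= f s * expR (- l * (t - s)).
Proof.
move=> fdf dfl s0 st.
pose g u := expR (l * u) * f u.
have : g t <= g s.
  apply: (@derive_le0_nincr g (fun u => expR (l * u) * (l * f u + df u))) => //.
  - move=> u u0; have ? := fdf u u0.
    apply: is_derive_eq; rewrite /GRing.scale/=; ring.
  - move=> u u0; rewrite pmulr_rle0 ?expR_gt0//; have := dfl u u0; lra.
rewrite /g => h.
have -> : - l * (t - s) = l * s + - (l * t) by ring.
rewrite expRD expRN mulrCA mulrA -ler_pdivrMr ?invr_gt0 ?expR_gt0// invrK.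
by rewrite (mulrC (f t)).
Qed.

End PositiveTimes.

(** * Weak time derivatives of curves *)

Section WeakDerivative.
Context {R : realType} {H : lmodType R} (S : inner_product H).
Implicit Types (x y dx dy : R -> H) (w : H) (s t T M : R).

Definition bounded_upto x := forall T : R, exists M : R,
  forall t : R, 0 < t <= T -> nrm S (x t) <= M.

Definition wcont x := forall w (t : R), 0 < t -> {for t, continuous (fun s : R => S (x s) w : R)}.

Definition wderiv x dx := forall w (t : R), 0 < t ->
  is_derive t (1 : R) (fun s => S (x s) w : R) (S (dx t) w).

(** The mean value theorem applies to the scalar function obtained by pairing with the increment
    [x t - x s] itself. *)
Lemma wderiv_lip x dx s t M : wderiv x dx -> 0 < s -> s <= t ->
  (forall u : R, s <= u <= t -> nrm S (dx u) <= M) ->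
  nrm S (x t - x s) <= M * (t - s).
Proof.
move=> xdx s0 st hM.
have M0 : 0 <= M by apply: le_trans (nrm_ge0 S (dx s)) _; apply: hM; rewrite lexx st.
apply: nrm_le_of_dot; first by rewrite mulr_ge0 ?subr_ge0.
set w := x t - x s.
have [c /andP[sc ct] e] := mvt_pos (xdx w) s0 st.
rewrite {1}/w dotBl e mulrAC.
apply: ler_wpM2r; first by rewrite subr_ge0.
apply: le_trans (ler_norm _) _; apply: le_trans (cauchy_schwarz _ _ _) _.
by apply: ler_wpM2r; [exact: nrm_ge0|apply: hM; rewrite sc].
Qed.

Lemma wderiv_wcont x dx : wderiv x dx -> wcont x.
Proof.
move=> xdx w t t0; apply: differentiable_continuous; apply/derivable1_diffP.
by have [] := xdx w t t0.
Qed.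

(* Weak differentiability of both factors suffices, since curves with a locally
   bounded weak derivative are locally Lipschitz. *)
Lemma is_derive_dot x dx y dy t : wderiv x dx -> wderiv y dy ->
  bounded_upto dx -> bounded_upto dy -> 0 < t ->
  is_derive t (1 : R) (fun s => S (x s) (y s) : R) (S (dx t) (y t) + S (x t) (dy t)).
Proof.
move=> xdx ydy bx by_ t0.
have [M0 hM0] := bx (2 * t); have [N0 hN0] := by_ (2 * t).
pose M := `|M0| + `|N0| + 1.
have M1 : 0 < M by rewrite /M; have := normr_ge0 M0; have := normr_ge0 N0; lra.
have hM u : 0 < u <= 2 * t -> nrm S (dx u) <= M.
  by move=> /hM0; rewrite /M; have := ler_norm M0; have := normr_ge0 N0; lra.
have hN u : 0 < u <= 2 * t -> nrm S (dy u) <= M.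
  by move=> /hN0; rewrite /M; have := ler_norm N0; have := normr_ge0 M0; lra.
have lip (z dz : R -> H) s : wderiv z dz -> (forall u, 0 < u <= 2 * t -> nrm S (dz u) <= M) ->
    `|s - t| < t -> nrm S (z s - z t) <= M * `|s - t|.
  move=> zdz hz; rewrite ltr_norml => /andP[s1 s2].
  have [st|/ltW st] := leP t s.
    rewrite ger0_norm ?subr_ge0//; apply: wderiv_lip zdz _ _ _ => // u /andP[u1 u2].
    by apply: hz; apply/andP; split; lra.
  rewrite nrmBC distrC ger0_norm ?subr_ge0//; apply: wderiv_lip zdz _ _ _ => //; first lra.
  by move=> u /andP[u1 u2]; apply: hz; apply/andP; split; lra.
apply/is_deriveP => e e0.
have /is_deriveP/(_ (e / 3)) [|r1 r10 hr1] := xdx (y t) t t0; first lra.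
have /is_deriveP/(_ (e / 3)) [|r2 r20 hr2] := ydy (x t) t t0; first lra.
(* The product of the two increments is at most M^2 |s - t|^2; the last radius turns this into a
   third of the allowed error. *)
exists (Num.min t (Num.min (Num.min r1 r2) (e / (3 * M * M)))).
  by rewrite !lt_min t0 r10 r20/= divr_gt0// !mulr_gt0.
move=> s; rewrite !lt_min => /and3P[st /andP[sr1 sr2]].
rewrite ltr_pdivlMr ?mulr_gt0// => sM.
have {}hr1 := hr1 _ sr1; have {}hr2 := hr2 _ sr2.
have lx := lip _ _ _ xdx hM st; have ly := lip _ _ _ ydy hN st.
have e1 : S (x s) (y s) - S (x t) (y t) - (S (dx t) (y t) + S (x t) (dy t)) * (s - t) =
  (S (x s) (y t) - S (x t) (y t) - S (dx t) (y t) * (s - t)) +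
  (S (y s) (x t) - S (y t) (x t) - S (dy t) (x t) * (s - t)) +
  S (x s - x t) (y s - y t).
  by rewrite !dotBl !dotBr (dotC S (y s)) (dotC S (y t)) (dotC S (dy t)); ring.
rewrite e1; apply: le_trans (ler_normD _ _) _.
apply: le_trans (lerD (ler_normD _ _) (cauchy_schwarz _ _ _)) _.
have : nrm S (x s - x t) * nrm S (y s - y t) <= e / 3 * `|s - t|.
  apply: le_trans (ler_pM (nrm_ge0 _ _) (nrm_ge0 _ _) lx ly) _.
  have := ler_wpM2r (normr_ge0 (s - t)) (ltW sM); lra.
lra.
Qed.

End WeakDerivative.

(** * Abstract antiderivatives *)

(* Models f |-> int_a^x f on L^2(a, b), with [one] the constant 1: by [ad_layer] the
   primitive of a function concentrated near a is close to 1, and by [ad_dense] the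
   primitives which vanish at both ends are dense. *)
Record antiderivative (R : realType) (H : lmodType R) (S : inner_product H) :=
  Antiderivative {
  ad :> H -> H;
  one : H;
  adD : forall f g, ad (f + g) = ad f + ad g;
  adZ : forall a f, ad (a *: f) = a *: ad f;
  ad_skew : forall f g, S (ad f) g + S f (ad g) = S f one * S g one;
  one_gt0 : 0 < S one one;
  ad_bounded : exists M, forall f, S (ad f) (ad f) <= M * S f f;
  ad_layer : forall e, 0 < e ->
    exists q, S one q = 1 /\ S (ad q - one) (ad q - one) <= e;
  ad_dense : forall x e, 0 < e ->
    exists w, S w one = 0 /\ S (x - ad w) (x - ad w) < e }.

Section Antiderivative.
Context {R : realType} {H : lmodType R} {S : inner_product H} (J : antiderivative S).
Implicit Types (f g u w x y : H).

Local Notation one := (one J).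

Definition mean x : R := S x one / S one one.
(** The orthogonal projection onto the vectors of mean zero; hence [adc x] is the primitive of a
    mean-zero vector and vanishes at both ends. It is locked so that expansion by bilinearity treats
    it as an atom. *)
Definition center x : H := locked (x - mean x *: one).
Definition adc x : H := J (center x).

(* [hvan u u1]: u is in H^1_0(0, L) and u1 = u_x.
   [hder f f1]: f is in H^1(0, L) and f1 = f_x. *)
Definition hvan u u1 := S u1 one = 0 /\ forall w, S u w = - S u1 (J w).
Definition hder f f1 := forall w, S w one = 0 -> S f w = - S f1 (J w).

Lemma dot_one_neq0 : S one one != 0.
Proof. by rewrite gt_eqF// one_gt0. Qed.

Lemma center_dot_one x : S (center x) one = 0.
Proof. by rewrite /center -!lock !dotE /mean divfK ?dot_one_neq0// subrr. Qed.

Lemma center_sym x y : S (center x) y = S x (center y).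
Proof.
by rewrite /center -!lock !dotE /mean (dotC S one y); field; exact: dot_one_neq0.
Qed.

Lemma center_center x y : S (center x) (center y) = S (center x) y.
Proof. by rewrite {2}/center -!lock !dotE center_dot_one mulr0 subr0. Qed.

Lemma dot_center_mean x y :
  S x y = S (center x) (center y) + S one one * (mean x * mean y).
Proof.
rewrite /center -!lock !dotE /mean (dotC S one y); field; exact: dot_one_neq0.
Qed.

Lemma center_le x : S (center x) (center x) <= S x x.
Proof.
by rewrite (dot_center_mean x) lerDl mulr_ge0 ?dot_ge0// -expr2 sqr_ge0.
Qed.

Lemma adc_dot x w : S (adc x) w = - S x (center (J w)).
Proof.
rewrite -center_sym; have := ad_skew J (center x) w.
by rewrite center_dot_one mul0r => /eqP; rewrite addr_eq0 => /eqP.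
Qed.

Lemma hvan_adc x : hvan (adc x) (center x).
Proof. by split; [exact: center_dot_one|move=> w; rewrite adc_dot center_sym]. Qed.

Lemma hvan_hder u u1 : hvan u u1 -> hder u u1.
Proof. by move=> [_ h] w _. Qed.

Lemma ad_hder f : hder (J f) f.
Proof.
move=> w w0; have := ad_skew J f w.
by rewrite w0 mulr0 => /eqP; rewrite addr_eq0 => /eqP.
Qed.

Lemma one_hder : hder one 0.
Proof. by move=> w; rewrite dotC => ->; rewrite dot0l oppr0. Qed.

Lemma hderD f f1 g g1 : hder f f1 -> hder g g1 -> hder (f + g) (f1 + g1).
Proof. by move=> hf hg w w0; rewrite !dotE hf// hg// opprD. Qed.

Lemma hderZ a f f1 : hder f f1 -> hder (a *: f) (a *: f1).
Proof. by move=> hf w w0; rewrite !dotE hf// mulrN. Qed.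

(** Since [u1] has mean zero, [f] may be tested with it; the skewness of [J] then moves [J] from
    [u1] to [f1] without boundary term. *)
Lemma hvan_by_parts u u1 f f1 : hvan u u1 -> hder f f1 -> S f u1 = - S f1 u.
Proof.
move=> [u10 hu] hf; rewrite hf// (dotC S f1 u) hu; congr (- _).
have := ad_skew J f1 u1; rewrite u10 mulr0 => /eqP.
by rewrite addr_eq0 (dotC S _ u1) => /eqP ->; rewrite opprK.
Qed.

Lemma adc_bounded M x : 0 <= M -> (forall f, S (J f) (J f) <= M * S f f) ->
  S (adc x) (adc x) <= M * S x x.
Proof. by move=> M0 hM; apply: le_trans (hM _) _; rewrite ler_wpM2l ?center_le. Qed.

(** Testing [hvan] with [u] itself gives |u|^2 = - S u1 (J u), so the constant that bounds [J]
    serves again. *)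
Lemma poincare M u u1 : (forall f, S (J f) (J f) <= M * S f f) ->
  hvan u u1 -> S u u <= M * S u1 u1.
Proof.
move=> hM [_ hu]; have := dot_ge0 S u; rewrite le_eqVlt => /orP[/eqP u0|u0].
  by rewrite -u0; apply: le_trans (hM u1); exact: dot_ge0.
rewrite -(ler_pM2r u0) -expr2 {1}hu sqrrN.
apply: le_trans (cauchy_schwarz_sq _ _ _) _.
rewrite (mulrC M) -mulrA; apply: ler_wpM2l; [exact: dot_ge0|exact: hM].
Qed.

(* adc q is close to 1 - x/L when J q is close to 1. *)
Lemma hvan_bump : exists g g1, hvan g g1 /\ S one g = 1.
Proof.
suff [x hx] : exists x, S one (adc x) != 0.
  exists ((S one (adc x))^-1 *: adc x), ((S one (adc x))^-1 *: center x).
  split; last by rewrite dotZr mulVf.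
  have [h1 h2] := hvan_adc x; split; first by rewrite dotZl h1 mulr0.
  by move=> w; rewrite !dotZl h2 mulrN.
set L := S one one; have L0 : 0 < L := one_gt0 J.
have [|q [q1 hq]] := @ad_layer _ _ _ J (L / 16); first by rewrite divr_gt0.
exists q; apply/eqP => h0.
have J1 : S one (J one) = L ^+ 2 / 2.
  have := ad_skew J one one; rewrite (dotC S (J one)) -/L => h1.
  have -> : L ^+ 2 = S one (J one) + S one (J one) by rewrite h1.
  by field.
have e : S one (adc q) = S one (J q - one) + L / 2.
  rewrite (dotC S one (adc q)) adc_dot; have := ad_skew J q one; rewrite (dotC S q one) q1 mul1r -/L => h1.
  rewrite dotBr (dotC S one (J q)) -/L -center_sym /center -!lock !dotE J1 /mean.
  rewrite (dotC S q one) q1 -/L.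
  have -> : S (J q) one = L - S q (J one) by lra.
  by field; rewrite gt_eqF.
(* If [adc q] had mean zero, the integral of [J q - one] would be -L/2, whereas Young's inequality
   with weight 1/4 bounds it below by -(L/4 + L/16). *)
have := youngN S one (J q - one) (s := 4^-1).
rewrite -/L invr_gt0 ltr0n => /(_ isT); have -> : S one (J q - one) = - (L / 2) by lra.
rewrite divff ?pnatr_eq0// invr1 mul1r => h; move: h hq; lra.
Qed.

End Antiderivative.

Lemma exists_small (R : realType) (A B a b : R) : 0 <= A -> 0 <= B -> 0 < a -> 0 < b ->
  exists s, [/\ 0 < s, s * A <= a & s * B <= b].
Proof.
move=> A0 B0 a0 b0; exists (Num.min (a / (A + 1)) (b / (B + 1))).
have A1 : 0 < A + 1 by lra.
have B1 : 0 < B + 1 by lra.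
split.
- by rewrite lt_min !divr_gt0.
- apply: (@le_trans _ _ (a / (A + 1) * A)); first by rewrite ler_wpM2r// ge_min lexx.
  by rewrite mulrAC ler_pdivrMr// ler_wpM2l ?(ltW a0)//; lra.
- apply: (@le_trans _ _ (b / (B + 1) * B)); first by rewrite ler_wpM2r// ge_min lexx orbT.
  by rewrite mulrAC ler_pdivrMr// ler_wpM2l ?(ltW b0)//; lra.
Qed.

Section YoungWeighted.
Context {R : realType} {H : lmodType R} (S : inner_product H).

(** The constant is produced before the vectors and [W], so that everything derived from it is
    uniform over all states. *)
Lemma young_weight (a b s : R) : 0 < s -> exists2 C, 0 <= C & forall x y W,
  S x x <= b * W -> 0 <= W -> `|a * S x y| <= s * S y y + C * W.
Proof.
move=> s0; exists ((4 * s)^-1 * a ^+ 2 * `|b|) => [|x y W hx W0].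
  apply: mulr_ge0 => //; apply: mulr_ge0; last exact: sqr_ge0.
  by rewrite invr_ge0 mulr_ge0// ltW.
rewrite -dotZl dotC; apply: le_trans (young_abs _ _ _ s0) _.
have -> : S (a *: x) (a *: x) = a ^+ 2 * S x x by rewrite dotZl dotZr mulrA.
have hb : S x x <= `|b| * W by apply: le_trans hx _; rewrite ler_wpM2r// ler_norm.
rewrite lerD2l -[leRHS]mulrA -[leRHS]mulrA.
apply: ler_wpM2l; first by rewrite invr_ge0 mulr_ge0// ltW.
by apply: ler_wpM2l hb; exact: sqr_ge0.
Qed.

Lemma dot_weight (a b b1 : R) : exists2 C, 0 <= C & forall x y W,
  S x x <= b * W -> S y y <= b1 * W -> 0 <= W -> `|a * S x y| <= C * W.
Proof.
have [C C0 hC] := young_weight a b ltr01.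
exists (`|b1| + C) => [|x y W hx hy W0]; first by rewrite addr_ge0.
apply: le_trans (hC _ _ _ hx W0) _; rewrite mul1r mulrDl lerD2r.
by apply: le_trans hy _; rewrite ler_wpM2r// ler_norm.
Qed.

End YoungWeighted.

(** * Decay of strong solutions *)

Section Lyapunov.
Context {R : realType} {H : lmodType R} (S : inner_product H) (J : antiderivative S).
Context (rho1 rho2 kappa alpha h c r mu d xi1 xi2 : R)
  (rho1_gt0 : 0 < rho1) (rho2_gt0 : 0 < rho2) (kappa_gt0 : 0 < kappa)
  (alpha_gt0 : 0 < alpha) (h_gt0 : 0 < h) (r_gt0 : 0 < r) (mu_gt0 : 0 < mu)
  (crd_gt0 : 0 < c * r - d ^+ 2).

Local Notation one := (one J).
Local Notation hvan := (hvan J).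
Local Notation hder := (hder J).

(* phi, phi_t = v, phi_tt = z, psi, theta and p with those of their derivatives
   which occur in the energy estimates; a final x or t denotes a derivative. *)
Record state := State {
  phi : H; phix : H; v : H; vx : H; z : H; zx : H; zt : H;
  psi : H; psix : H; psit : H; psitx : H;
  th : H; thx : H; tht : H; p : H; px : H; pt : H }.

Record solves (u : state) : Prop := Solves {
  hvan_phi : hvan (phi u) (phix u);
  hvan_v : hvan (v u) (vx u);
  hvan_z : hvan (z u) (zx u);
  hvan_psi : hvan (psi u) (psix u);
  hvan_psit : hvan (psit u) (psitx u);
  hvan_th : hvan (th u) (thx u);
  hvan_p : hvan (p u) (px u);
  eqn_phi : hder (kappa *: (phix u + psi u)) (rho1 *: z u);
  eqn_phit : hder (kappa *: (vx u + psit u)) (rho1 *: zt u);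
  eqn_psi : hder (rho2 *: z u + alpha *: psix u + xi1 *: th u + xi2 *: p u)
                 (kappa *: (phix u + psi u) + mu *: psit u);
  eqn_th : hder (kappa *: thx u + xi1 *: psit u) (c *: tht u + d *: pt u);
  eqn_p : hder (h *: px u + xi2 *: psit u) (d *: tht u + r *: pt u) }.

Implicit Types u : state.

Definition sq (x : H) : R := S x x.

Definition thermal u := c * sq (th u) + 2 * d * S (th u) (p u) + r * sq (p u).

Definition nrj u : R := 2^-1 * (rho1 * sq (v u) + rho1 * rho2 / kappa * sq (z u)
  + rho2 * sq (vx u) + kappa * sq (phix u + psi u) + alpha * sq (psix u) + thermal u).

Definition diss u : R := sq (psit u) + sq (thx u) + sq (px u).

(** What the multipliers have to recover: [nrj_static] bounds the whole energy by this and
    [diss]. *)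
Definition osc u : R := sq (z u) + sq (vx u).

(** The derivative of [nrj] along a strong solution, written as a function of a single state. The
    estimates thus concern one state at a time; [strong_decay] identifies this expression, and
    likewise each [dG], with a time derivative. *)
Definition dnrj u : R := rho1 * S (z u) (v u) + rho1 * rho2 / kappa * S (zt u) (z u)
  + rho2 * S (zx u) (vx u) + kappa * S (vx u + psit u) (phix u + psi u)
  + alpha * S (psitx u) (psix u) + c * S (tht u) (th u)
  + d * (S (tht u) (p u) + S (th u) (pt u)) + r * S (pt u) (p u).

Lemma sq_ge0 x : 0 <= sq x. Proof. exact: dot_ge0. Qed.

Lemma diss_ge0 u : 0 <= diss u. Proof. by rewrite !addr_ge0 ?sq_ge0. Qed.

Lemma le_diss u :
  [/\ sq (psit u) <= diss u, sq (thx u) <= diss u & sq (px u) <= diss u].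
Proof.
rewrite /diss; move: (sq_ge0 (psit u)) (sq_ge0 (thx u)) (sq_ge0 (px u)).
by split; lra.
Qed.

Lemma osc_ge0 u : 0 <= osc u. Proof. by rewrite !addr_ge0 ?sq_ge0. Qed.

Lemma le_osc u : sq (z u) <= osc u /\ sq (vx u) <= osc u.
Proof. by rewrite /osc lerDl lerDr !sq_ge0. Qed.

Lemma thermalE u : thermal u =
  (c - d ^+ 2 / r) * sq (th u) + sq (Num.sqrt r *: p u + (d / Num.sqrt r) *: th u).
Proof.
have r2 : Num.sqrt r * Num.sqrt r = r by rewrite -expr2 sqr_sqrtr// ltW.
have r0 : Num.sqrt r != 0 by rewrite gt_eqF// sqrtr_gt0.
rewrite /thermal /sq !dotE (dotC S (p u) (th u)).
by move: r2 r0; move: (Num.sqrt r) => q r2 q0; rewrite -r2; field.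
Qed.

Lemma thermal_ge0 u : 0 <= thermal u.
Proof.
rewrite thermalE addr_ge0 ?sq_ge0// mulr_ge0 ?sq_ge0//.
by rewrite subr_ge0 ler_pdivrMr// ltW// -subr_gt0.
Qed.

Lemma dnrjE u : solves u ->
  dnrj u = - (mu * sq (psit u) + kappa * sq (thx u) + h * sq (px u)).
Proof.
case=> h1 h2 h3 h4 h5 h6 h7 h8 h9 h10 h11 h12.
have a1 := hvan_by_parts h2 h8.
have a2 := hvan_by_parts h3 h9.
have a3 := hvan_by_parts h5 h10.
have a4 := hvan_by_parts h6 h11.
have a5 := hvan_by_parts h7 h12.
have a6 := hvan_by_parts h5 (hvan_hder h3).
have a7 := hvan_by_parts h5 (hvan_hder h6).
have a8 := hvan_by_parts h5 (hvan_hder h7).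
move: a1 a2 a3 a4 a5; rewrite /dnrj /sq !dotE.
rewrite (dotC S (zx u) (vx u)) (dotC S (vx u) (phix u)) (dotC S (vx u) (psi u)).
rewrite (dotC S (psit u) (phix u)) (dotC S (psit u) (psi u)) (dotC S (psitx u) (psix u)).
rewrite (dotC S (th u) (pt u)) (dotC S (psit u) (thx u)) (dotC S (psit u) (px u)).
rewrite (dotC S (psit u) (zx u)) in a6 *.
rewrite a6 a7 a8 => a1 a2 a3 a4 a5.
(* The first equation, differentiated in time and tested with phi_tt, expresses this product through
   phi_ttx. With the weight rho1 rho2 / kappa it cancels both the derivative of |phi_tx|^2 and the
   phi_ttx term of the second equation. *)
have {}a2 : rho1 * rho2 / kappa * S (zt u) (z u) =
  - (rho2 * (S (vx u) (zx u) + S (zx u) (psit u))).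
  have -> : rho1 * rho2 / kappa * S (zt u) (z u) = rho2 / kappa * (rho1 * S (zt u) (z u)) by ring.
  have -> : rho1 * S (zt u) (z u) = - (kappa * (S (vx u) (zx u) + S (zx u) (psit u))) by lra.
  by field; rewrite gt_eqF.
rewrite a2; lra.
Qed.

Lemma dnrj_le : exists2 m, 0 < m & forall u, solves u -> dnrj u <= - m * diss u.
Proof.
exists (Num.min mu (Num.min kappa h)); first by rewrite !lt_min mu_gt0 kappa_gt0.
move=> u /dnrjE ->; set m := Num.min _ _.
have m1 : m <= mu by rewrite ge_min lexx.
have m2 : m <= kappa by rewrite ge_min ge_min lexx orbT.
have m3 : m <= h by rewrite ge_min ge_min lexx !orbT.
have := ler_wpM2r (sq_ge0 (psit u)) m1; have := ler_wpM2r (sq_ge0 (thx u)) m2.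
have := ler_wpM2r (sq_ge0 (px u)) m3; rewrite /diss; lra.
Qed.

Lemma ad_bounded_pos : exists2 M, 0 < M & forall f, S (J f) (J f) <= M * S f f.
Proof.
have [M hM] := ad_bounded J; exists (`|M| + 1) => [|f]; first by rewrite ltr_wpDl.
apply: le_trans (hM f) _; rewrite ler_wpM2r ?dot_ge0//.
by have := ler_norm M; lra.
Qed.

(** Testing the first two equations with phi and psi, without differentiating in time, expresses
    alpha |psix|^2 + kappa |phix + psi|^2 through products each of which has a factor among z, th, p
    and psit. *)
Lemma nrj_static : exists2 K, 0 < K & forall u, solves u -> nrj u <= K * (osc u + diss u).
Proof.
have [M M0 hM] := ad_bounded_pos.
(* After Poincare's inequality the weight [s] on |psi|^2 and |phi|^2 costs at most alpha/4 of
   |psix|^2 and kappa/2 of |phix + psi|^2. The three weights alpha/12 cost another alpha/4, so half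
   of the left side remains. *)
have [s [s0 s1 s2]] := exists_small (A := 2 * M) (B := M + 2 * M ^+ 2)
  (ltW (mulr_gt0 (ltr0n R 2) M0)) ltac:(by rewrite addr_ge0 ?(ltW M0)// mulr_ge0// exprn_ge0 ?ltW)
  (divr_gt0 kappa_gt0 (ltr0n R 2)) (divr_gt0 alpha_gt0 (ltr0n R 4)).
have a12 : 0 < alpha / 12 by rewrite divr_gt0.
have [C1 C10 hC1] := young_weight S rho2 1 a12.
have [C2 C20 hC2] := young_weight S xi1 M a12.
have [C3 C30 hC3] := young_weight S xi2 M a12.
have [C4 C40 hC4] := young_weight S mu 1 s0.
have [C5 C50 hC5] := young_weight S rho1 1 s0.
have [C6 C60 hC6] := dot_weight S c M M.
have [C7 C70 hC7] := dot_weight S (2 * d) M M.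
have [C8 C80 hC8] := dot_weight S r M M.
exists (rho1 * M + rho1 * rho2 / kappa + rho2 + 2 * (C1 + C2 + C3 + C4 + C5) + C6 + C7 + C8).
  have : 0 < rho1 * M by rewrite mulr_gt0.
  have : 0 < rho1 * rho2 / kappa by rewrite !mulr_gt0// invr_gt0.
  by move=> ? ?; have := rho2_gt0; lra.
move=> u hu; case: (hu) => h1 h2 h3 h4 h5 h6 h7 h8 h9 h10 h11 h12.
set W := osc u + diss u.
have W0 : 0 <= W by rewrite addr_ge0 ?osc_ge0 ?diss_ge0.
have ge0 := sq_ge0.
have [wz wvx wpsit wthx wpx] : [/\ sq (z u) <= W, sq (vx u) <= W, sq (psit u) <= W,
    sq (thx u) <= W & sq (px u) <= W].
  have [? ? ?] := le_diss u; have [? ?] := le_osc u.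
  by split; [apply: ler_wpDr|apply: ler_wpDr|apply: ler_wpDl|apply: ler_wpDl|apply: ler_wpDl];
    rewrite ?osc_ge0 ?diss_ge0.
have wv : sq (v u) <= M * W by apply: le_trans (poincare hM h2) _; rewrite ler_pM2l.
have wth : sq (th u) <= M * W by apply: le_trans (poincare hM h6) _; rewrite ler_pM2l.
have wp : sq (p u) <= M * W by apply: le_trans (poincare hM h7) _; rewrite ler_pM2l.
have wpsi : sq (psi u) <= M * sq (psix u) := poincare hM h4.
have wphi : sq (phi u) <= 2 * M * sq (phix u + psi u) + 2 * M ^+ 2 * sq (psix u).
  apply: le_trans (poincare hM h1) _.
  have : S (phix u) (phix u) <= 2 * sq (phix u + psi u) + 2 * sq (psi u).
    have := dot_sqrD S (phix u + psi u) (- psi u); rewrite addrK dotNl dotNr opprK; exact.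
  have := ler_wpM2l (ltW M0) wpsi.
  move=> e1 e2; have := ler_wpM2l (ltW M0) e2; rewrite !mulrDr; lra.
have {}hC1 := hC1 (z u) (psix u) W _ W0; have {}hC2 := hC2 (th u) (psix u) W wth W0.
have {}hC3 := hC3 (p u) (psix u) W wp W0; have {}hC4 := hC4 (psit u) (psi u) W _ W0.
have {}hC5 := hC5 (z u) (phi u) W _ W0; have {}hC6 := hC6 (th u) (th u) W wth wth W0.
have {}hC7 := hC7 (th u) (p u) W wth wp W0; have {}hC8 := hC8 (p u) (p u) W wp wp W0.
have := hvan_by_parts h1 h8; have := hvan_by_parts h4 h10.
move: hC1 hC2 hC3 hC4 hC5; rewrite mul1r => /(_ wz) + + + /(_ wpsit) + /(_ wz).
rewrite !ler_norml => /andP[b1 _] /andP[b2 _] /andP[b3 _] /andP[b4 _] /andP[b5 _].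
move: hC6 hC7 hC8; rewrite !ler_norml => /andP[_ b6] /andP[_ b7] /andP[_ b8].
rewrite !dotE => e1 e2.
have key : alpha * sq (psix u) + kappa * sq (phix u + psi u) =
    - (rho2 * S (z u) (psix u)) - xi1 * S (th u) (psix u) - xi2 * S (p u) (psix u)
    - mu * S (psit u) (psi u) - rho1 * S (z u) (phi u).
  rewrite /sq !dotE; rewrite (dotC S (psi u) (phix u)) in e1 e2 *; lra.
have f1 : s * sq (psi u) <= s * M * sq (psix u) by rewrite -mulrA ler_pM2l.
have f2 : s * sq (phi u) <= kappa / 2 * sq (phix u + psi u) + 2 * M ^+ 2 * s * sq (psix u).
  apply: le_trans (ler_wpM2l (ltW s0) wphi) _; rewrite mulrDr.
  have := ler_wpM2r (ge0 (phix u + psi u)) s1; lra.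
have f3 := ler_wpM2r (ge0 (psix u)) s2.
have static : alpha * sq (psix u) + kappa * sq (phix u + psi u) <=
    2 * (C1 + C2 + C3 + C4 + C5) * W.
  move: f1 f2 f3 b1 b2 b3 b4 b5; rewrite -/(sq _) -/(sq (phi u)) -/(sq (psi u)).
  rewrite key; lra.
have g1 := ler_wpM2l (ltW rho1_gt0) wv; have g2 := ler_wpM2l (ltW rho2_gt0) wvx.
have g3 : rho1 * rho2 / kappa * sq (z u) <= rho1 * rho2 / kappa * W.
  by apply: ler_wpM2l wz; rewrite !mulr_ge0 ?invr_ge0// ltW.
have g4 : 0 <= rho1 * M * W by rewrite !mulr_ge0// ltW.
have g5 : 0 <= rho1 * rho2 / kappa * W by rewrite !mulr_ge0 ?invr_ge0// ltW.
have g6 : 0 <= rho2 * W by rewrite !mulr_ge0// ltW.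
have g7 : 0 <= (C1 + C2 + C3 + C4 + C5) * W by rewrite mulr_ge0// !addr_ge0.
have g8 := mulr_ge0 C60 W0; have g9 := mulr_ge0 C70 W0; have g10 := mulr_ge0 C80 W0.
rewrite /nrj /thermal /sq; rewrite /sq in static g1 g2 g3; lra.
Qed.

(* Equipartition: multiplies the time derivative of the first equation by phi_t. *)
Definition G2 u := rho1 * S (z u) (v u).
Definition dG2 u := rho1 * (S (zt u) (v u) + S (z u) (z u)).

(* Multiplies the second equation by the primitive of phi_tt - mean phi_tt. *)
Definition G3 u := alpha * S (psix u) (v u) - kappa * S (phi u) (center J (v u))
  + kappa * S (psi u) (adc J (v u)).
Definition dG3 u := alpha * (S (psitx u) (v u) + S (psix u) (z u))
  - kappa * (S (v u) (center J (v u)) + S (phi u) (center J (z u)))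
  + kappa * (S (psit u) (adc J (v u)) + S (psi u) (adc J (z u))).

Definition G4 (q g : H) u := S (v u) q * S (z u) g.
Definition dG4 q g u := S (z u) q * S (z u) g + S (v u) q * S (zt u) g.

Lemma dG2_bound : exists2 C, 0 <= C & forall u, solves u ->
  kappa / 2 * sq (vx u) <= rho1 * sq (z u) - dG2 u + C * diss u.
Proof.
have [C C0 hC] := young_weight S kappa 1 (divr_gt0 kappa_gt0 (ltr0n R 2)).
exists C => // u hu; case: (hu) => h1 h2 h3 h4 h5 h6 h7 h8 h9 h10 h11 h12.
have := hC (psit u) (vx u) (diss u) _ (diss_ge0 u).
rewrite mul1r; have [-> _ _] := le_diss u.
move=> /(_ isT); rewrite ler_norml => /andP[b1 _].
have := hvan_by_parts h2 h9; rewrite /dG2 /sq !dotE; lra.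
Qed.

Lemma dG3_bound e : 0 < e -> exists2 C, 0 <= C & forall u, solves u ->
  dG3 u <= - rho2 * sq (center J (z u)) + e * osc u + C * diss u.
Proof.
move=> e0; have [M M0 hM] := ad_bounded_pos.
have [s [s0 s1 _]] := exists_small (A := 2 + M + M ^+ 2) (B := 1)
  ltac:(by rewrite !addr_ge0// ?exprn_ge0// ltW) ler01 e0 ltr01.
have [C1 C10 hC1] := young_weight S alpha 1 s0.
have [C2 C20 hC2] := young_weight S kappa 1 s0.
have [C3 C30 hC3] := young_weight S xi1 M s0.
have [C4 C40 hC4] := young_weight S xi2 M s0.
have [C5 C50 hC5] := young_weight S mu 1 s0.
exists (C1 + C2 + C3 + C4 + C5); first by rewrite !addr_ge0.
move=> u hu; case: (hu) => h1 h2 h3 h4 h5 h6 h7 h8 h9 h10 h11 h12.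
have D0 := diss_ge0 u; have ge0 := sq_ge0.
have [wpsit wthx wpx] := le_diss u.
have wth : sq (th u) <= M * diss u by apply: le_trans (poincare hM h6) _; rewrite ler_pM2l.
have wp : sq (p u) <= M * diss u by apply: le_trans (poincare hM h7) _; rewrite ler_pM2l.
have wpsit1 : sq (psit u) <= 1 * diss u by rewrite mul1r.
have := hC1 (psit u) (vx u) _ wpsit1 D0; have := hC2 (psit u) (adc J (v u)) _ wpsit1 D0.
have := hC3 (th u) (center J (z u)) _ wth D0; have := hC4 (p u) (center J (z u)) _ wp D0.
have := hC5 (psit u) (adc J (z u)) _ wpsit1 D0.
rewrite !ler_norml => /andP[b5 b5'] /andP[b4 b4'] /andP[b3 b3'] /andP[b2 b2'] /andP[b1 b1'].
have k1 : sq (adc J (v u)) <= M ^+ 2 * sq (vx u).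
  apply: le_trans (adc_bounded _ (ltW M0) hM) _.
  by rewrite expr2 -mulrA ler_pM2l//; exact: poincare hM h2.
have k2 : sq (adc J (z u)) <= M * sq (z u) := adc_bounded _ (ltW M0) hM.
have k3 : sq (center J (z u)) <= sq (z u) := center_le J (z u).
have hK := hvan_adc J (z u).
have e1 := hvan_by_parts hK h10.
have e2 := hvan_by_parts hK (hvan_hder h1).
have e3 := hvan_by_parts h5 (hvan_hder h2).
have e4 : S (psix u) (center J (z u)) = S (psix u) (z u).
  rewrite -center_sym; case: h4 => h40 _.
  by rewrite center_sym (dotC S _ (center _ _)) center_sym /center -lock /mean h40 mul0r scale0r subr0 dotC.
(* This term enters [dG3] with a favourable sign and is dropped. *)
have e5 : 0 <= kappa * S (v u) (center J (v u)).
  by rewrite -center_sym -center_center mulr_ge0 ?(ltW kappa_gt0)// ge0.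
have f1 := ler_wpM2l (ltW s0) k1; have f2 := ler_wpM2l (ltW s0) k2.
have f3 := ler_wpM2l (ltW s0) k3; have f4 := ler_wpM2r (osc_ge0 u) s1.
have f5 : 0 <= s * M * sq (z u) by rewrite !mulr_ge0// ltW.
have f6 : 0 <= s * M ^+ 2 * sq (z u) by rewrite !mulr_ge0 ?exprn_ge0// ltW.
have f7 : 0 <= s * M * sq (vx u) by rewrite !mulr_ge0// ltW.
have f8 : 0 <= s * sq (vx u) by rewrite !mulr_ge0// ltW.
have e6 : S (center J (z u)) (z u) = sq (center J (z u)) by rewrite -center_center.
(* The second equation tested with [adc J (z u)] leaves products of z with psix, phi and psi, which
   are neither small nor dissipated. They are exactly the parts of [dG3] containing z, and cancel;
   the remaining products contain psit, th or p, apart from the one with a sign. *)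
have key : dG3 u = - rho2 * sq (center J (z u)) - alpha * S (psit u) (vx u)
    - kappa * S (v u) (center J (v u)) + kappa * S (psit u) (adc J (v u))
    - xi1 * S (th u) (center J (z u)) - xi2 * S (p u) (center J (z u))
    - mu * S (psit u) (adc J (z u)).
  rewrite /dG3 (dotC S (psitx u)) e3 (dotC S (vx u)) e2.
  by move: e1; rewrite !dotE e4 (dotC S (z u)) e6; lra.
rewrite key; move: f1 f2 f3 f4 f5 f6 f7 f8 b1 b1' b2 b2' b3 b3' b4 b4' b5 b5' e5.
by rewrite /osc /sq; lra.
Qed.

(* With [S one q = S one g = 1] the mean value of z is S z q = d/dt (S v q) and
   also S z g, up to terms in z - mean z; and S v q is small compared to vx, as
   q is concentrated near the boundary. *)
Lemma dG4_bound e : 0 < e -> exists q g, exists2 C, 0 <= C & forall u, solves u ->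
  mean J (z u) ^+ 2 <= 2 * dG4 q g u + C * sq (center J (z u)) + e * (sq (vx u) + diss u).
Proof.
move=> e0; have [g [g1 [hg og]]] := hvan_bump J.
have k0 : 0 < kappa / rho1 by rewrite divr_gt0.
(* The order of choices matters: the pairing of z_t with [g] costs [g1], the Young weight [s]
   compensates that cost, and only then is the width of the layer [q] fixed through [s']. A single
   function could not play both parts, since concentrating [g] near the boundary makes [g1]
   large. *)
have [s [s0 s1 _]] := exists_small (A := kappa / rho1 * 4 * sq g1) (B := 1) (b := 1)
  (mulr_ge0 (mulr_ge0 (ltW k0) (ler0n R 4)) (sq_ge0 g1)) ler01 e0 ltr01.
have i0 : 0 <= (2 * s)^-1 by rewrite invr_ge0 mulr_ge0// ltW.
have [s' [s'0 s1' _]] := exists_small (A := kappa / rho1 * (2 * s)^-1) (B := 1) (b := 1)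
  (mulr_ge0 (ltW k0) i0) ler01
  (divr_gt0 e0 (ltr0n R 4)) ltr01.
have [q [oq hq]] := ad_layer J s'0.
exists q, g, (4 * (sq q + sq g)); first by rewrite mulr_ge0// addr_ge0 ?sq_ge0.
move=> u hu; case: (hu) => h1 h2 h3 h4 h5 h6 h7 h8 h9 h10 h11 h12.
set m := mean J (z u); set X := sq (center J (z u)); set B := sq (vx u).
have zq : S (z u) q = m + S (center J (z u)) q.
  have mq : mean J q = (S one one)^-1 by rewrite /mean (dotC S q) oq mul1r.
  by rewrite (dot_center_mean J) center_center mq mulrCA divff ?dot_one_neq0// mulr1 addrC.
have zg : S (z u) g = m + S (center J (z u)) g.
  have mg : mean J g = (S one one)^-1 by rewrite /mean (dotC S g) og mul1r.
  by rewrite (dot_center_mean J) center_center mg mulrCA divff ?dot_one_neq0// mulr1 addrC.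
have vq : S (v u) q = - S (vx u) (J q - one).
  have hq1 : hder (J q - one) q.
    have := hderD (@ad_hder _ _ _ J q) (hderZ (-1) (@one_hder _ _ _ J)); rewrite !scaleN1r oppr0 addr0; exact.
  by have := hvan_by_parts h2 hq1; rewrite (dotC S q) (dotC S (vx u)) => ->; rewrite opprK.
have ztg : S (zt u) g = - (kappa / rho1 * S (vx u + psit u) g1).
  have := hvan_by_parts hg h9; rewrite !dotZl => e1.
  have -> : kappa / rho1 * S (vx u + psit u) g1 = (kappa * S (vx u + psit u) g1) / rho1 by ring.
  by rewrite e1; field; rewrite gt_eqF.
have X0 : 0 <= X := sq_ge0 _; have B0 : 0 <= B := sq_ge0 _.
have xq : S (center J (z u)) q ^+ 2 <= X * sq q := cauchy_schwarz_sq _ _ _.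
have xg : S (center J (z u)) g ^+ 2 <= X * sq g := cauchy_schwarz_sq _ _ _.
have bd : S (vx u) (J q - one) ^+ 2 <= B * s'.
  by apply: le_trans (cauchy_schwarz_sq _ _ _) _; rewrite ler_wpM2l.
have bd1 : S (vx u + psit u) g1 ^+ 2 <= (2 * B + 2 * diss u) * sq g1.
  apply: le_trans (cauchy_schwarz_sq _ _ _) _; rewrite ler_wpM2r ?sq_ge0//.
  apply: le_trans (dot_sqrD _ _ _) _; rewrite lerD2l ler_pM2l//; by have [] := le_diss u.
set a := S (vx u) (J q - one) in vq bd *; set b := S (vx u + psit u) g1 in ztg bd1 *.
have ab : 2 * (kappa / rho1 * (a * b)) >= - (e * (B + diss u)).
  have ab1 : - (a * b) <= (2 * s)^-1 * a ^+ 2 + s / 2 * b ^+ 2.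
    have : 0 <= (2 * s)^-1 * (a + s * b) ^+ 2.
      by rewrite mulr_ge0 ?sqr_ge0// invr_ge0 mulr_ge0// ltW.
    have -> : (2 * s)^-1 * (a + s * b) ^+ 2 = (2 * s)^-1 * a ^+ 2 + s / 2 * b ^+ 2 + a * b.
      by field; rewrite gt_eqF.
    by rewrite -lerBlDr sub0r.
  have t1 : kappa / rho1 * ((2 * s)^-1 * a ^+ 2) <= e / 4 * B.
    apply: le_trans (ler_wpM2l (ltW k0) (ler_wpM2l _ bd)) _.
      by rewrite invr_ge0 mulr_ge0// ltW.
    by have := ler_wpM2l B0 s1'; rewrite !mulrA; lra.
  have t2 : kappa / rho1 * (s / 2 * b ^+ 2) <= e / 4 * (B + diss u).
    apply: le_trans (ler_wpM2l (ltW k0) (ler_wpM2l _ bd1)) _.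
      by rewrite divr_ge0// ltW.
    have BD : 0 <= B + diss u by rewrite addr_ge0 ?diss_ge0.
    have := ler_wpM2l BD s1; lra.
  have t3 := ler_wpM2l (ltW k0) ab1; have t4 := mulr_ge0 (ltW e0) (diss_ge0 u).
  have t5 := mulr_ge0 (ltW e0) B0.
  move: t1 t2 t3 t4 t5; lra.
rewrite /dG4 zq zg vq ztg.
have m1 := sqr_ge0 (m + (S (center J (z u)) q + S (center J (z u)) g)).
set xq' := S _ q in xq m1 *; set xg' := S _ g in xg m1 *.
have m2 := sqr_ge0 xq'; have m3 := sqr_ge0 xg'.
move: ab xq xg m1 m2 m3; rewrite -/X; lra.
Qed.

(** A triangular elimination: |vx|^2 is bounded by |z|^2, the mean of z by its centred part plus a
    little of |vx|^2, and the centred part by [dG3] plus a little of [osc]. Each small share is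
    absorbed on the left. *)
Lemma osc_bound : exists q g g2 g3 g4, exists2 C, 0 <= C & forall u, solves u ->
  osc u <= g2 * dG2 u + g3 * dG3 u + g4 * dG4 q g u + C * diss u.
Proof.
set L := S one one; have L0 : 0 < L := one_gt0 J.
have ki : 0 < 2 / kappa by rewrite divr_gt0.
have [t [t0 t1 _]] := exists_small (A := 2 / kappa * rho1 * L) (B := 1) (b := 1)
  (ltW (mulr_gt0 (mulr_gt0 ki rho1_gt0) L0)) ler01 (divr_gt0 ltr01 (ltr0n R 2)) ltr01.
have [C2 C20 hC2] := dG2_bound.
have [q [g [CQ CQ0 hCQ]]] := dG4_bound t0.
(* [c1] and [c2] are the coefficients of [X] and [diss] in the estimate of the squared mean once
   |vx|^2 is substituted; [t] makes the squared mean itself reappear with factor at most 1/2. [c5]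
   is the final coefficient of [X] in [osc], and the weight rho2 / (2 c5) below returns half of
   [osc]. *)
pose c1 := CQ + t * (2 / kappa * rho1); pose c2 := t * (2 / kappa * C2) + t.
pose k1 := 1 + 2 / kappa * rho1; pose c5 := k1 + 2 * k1 * L * c1.
have r0 : 0 < 2 / kappa * rho1 by rewrite mulr_gt0.
have c10 : 0 <= c1 by rewrite addr_ge0// mulr_ge0// ltW.
have c20 : 0 <= c2 by rewrite addr_ge0 ?(ltW t0)// (mulr_ge0 (ltW t0) (mulr_ge0 (ltW ki) C20)).
have k10 : 0 < k1 by rewrite addr_gt0.
have c50 : 0 < c5 by rewrite ltr_wpDr// !mulr_ge0// ltW.
have e0 : 0 < rho2 / (2 * c5) by rewrite divr_gt0// mulr_gt0.
have [C3 C30 hC3] := dG3_bound e0.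
have cr0 : 0 < c5 / rho2 by rewrite divr_gt0.
exists q, g, (- (8 * k1 * L * t * (2 / kappa) / 2) - 2 * (2 / kappa)), (- 2 * (c5 / rho2)), (8 * k1 * L),
  (2 * (2 * k1 * L * c2 + 2 / kappa * C2) + 2 * (c5 / rho2) * C3).
  have ? := mulr_ge0 (mulr_ge0 (ltW k10) (ltW L0)) c20; have ? := mulr_ge0 (ltW ki) C20.
  by have ? := mulr_ge0 (ltW cr0) C30; lra.
move=> u hu; have {}hC2 := ler_wpM2l (ltW ki) (hC2 u hu).
have {}hCQ := hCQ u hu; have {}hC3 := ler_wpM2l (ltW cr0) (hC3 u hu).
set X := sq (center J (z u)) in hCQ hC3 *; set m2 := mean J (z u) ^+ 2 in hCQ.
have zE : sq (z u) = X + L * m2 by rewrite /sq (dot_center_mean J) -expr2.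
have m20 : 0 <= m2 := sqr_ge0 _.
have {}hC2 : sq (vx u) <= 2 / kappa * (rho1 * (X + L * m2) - dG2 u + C2 * diss u).
  rewrite -zE; apply: le_trans hC2; rewrite mulrA le_eqVlt; apply/orP; left; apply/eqP.
  by field; rewrite gt_eqF.
have {}t1 := ler_wpM2r m20 t1.
have {}hCQ : m2 <= 4 * dG4 q g u - 2 * t * (2 / kappa) * dG2 u + 2 * c1 * X + 2 * c2 * diss u.
  have := ler_wpM2l (ltW t0) hC2; rewrite /c1 /c2; lra.
have {}hCQ := ler_wpM2l (ltW (mulr_gt0 k10 L0)) hCQ.
have {hC3} : c5 * X <= - (c5 / rho2) * dG3 u + osc u / 2 + c5 / rho2 * C3 * diss u.
  move: hC3; have -> : c5 / rho2 * (- rho2 * X + rho2 / (2 * c5) * osc u + C3 * diss u) =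
    - (c5 * X) + osc u / 2 + c5 / rho2 * C3 * diss u.
    by field; rewrite !gt_eqF.
  lra.
have oE : osc u <= k1 * X + k1 * L * m2 + 2 / kappa * (- dG2 u + C2 * diss u).
  rewrite /osc zE /k1; lra.
rewrite /c5; lra.
Qed.

Lemma nrj_ge0 u : 0 <= nrj u.
Proof.
rewrite /nrj mulr_ge0 ?invr_ge0// addr_ge0 ?thermal_ge0//.
by rewrite !addr_ge0// !mulr_ge0 ?sq_ge0 ?invr_ge0// ltW.
Qed.

Lemma nrj_dominates : exists2 b, 0 < b & forall u, solves u ->
  [/\ sq (v u) <= b * nrj u, sq (z u) <= b * nrj u, sq (psix u) <= b * nrj u,
      sq (psi u) <= b * nrj u & sq (phi u) <= b * nrj u].
Proof.
have [M M0 hM] := ad_bounded_pos.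
pose b1 := 2 / rho1; pose b2 := 2 / (rho1 * rho2 / kappa).
pose b3 := 2 / kappa; pose b4 := 2 / alpha.
have p1 : 0 < b1 by rewrite divr_gt0.
have p2 : 0 < b2 by rewrite !divr_gt0// mulr_gt0.
have p3 : 0 < b3 by rewrite divr_gt0.
have p4 : 0 < b4 by rewrite divr_gt0.
have p5 : 0 < M * b4 by rewrite mulr_gt0.
have p6 : 0 < M * (2 * b3 + 2 * (M * b4)) by rewrite mulr_gt0// addr_gt0// mulr_gt0.
exists (b1 + b2 + b4 + M * b4 + M * (2 * b3 + 2 * (M * b4))).
  by rewrite !addr_gt0.
move=> u; case=> h1 h2 h3 h4 h5 h6 h7 h8 h9 h10 h11 h12.
have N0 := nrj_ge0 u.
have T0 := thermal_ge0 u.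
have q1 : 0 <= rho1 * sq (v u) by rewrite mulr_ge0 ?sq_ge0 ?ltW.
have q2 : 0 <= rho1 * rho2 / kappa * sq (z u).
  by rewrite mulr_ge0 ?sq_ge0// mulr_ge0 ?invr_ge0 ?mulr_ge0// ltW.
have q3 : 0 <= rho2 * sq (vx u) by rewrite mulr_ge0 ?sq_ge0 ?ltW.
have q4 : 0 <= kappa * sq (phix u + psi u) by rewrite mulr_ge0 ?sq_ge0 ?ltW.
have q5 : 0 <= alpha * sq (psix u) by rewrite mulr_ge0 ?sq_ge0 ?ltW.
have w a (x : H) : 0 < a -> a * sq x <= 2 * nrj u -> sq x <= 2 / a * nrj u.
  by move=> a0; rewrite mulrAC ler_pdivlMr// mulrC.
have w1 : sq (v u) <= b1 * nrj u by apply: w => //; rewrite /nrj; lra.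
have w2 : sq (z u) <= b2 * nrj u.
  by apply: w; rewrite ?divr_gt0 ?mulr_gt0//; rewrite /nrj; lra.
have w3 : sq (phix u + psi u) <= b3 * nrj u by apply: w => //; rewrite /nrj; lra.
have w4 : sq (psix u) <= b4 * nrj u by apply: w => //; rewrite /nrj; lra.
have w5 : sq (psi u) <= M * b4 * nrj u.
  by apply: le_trans (poincare hM h4) _; rewrite -mulrA ler_pM2l.
have w6 : sq (phi u) <= M * (2 * b3 + 2 * (M * b4)) * nrj u.
  apply: le_trans (poincare hM h1) _; rewrite -mulrA ler_pM2l//.
  have := dot_sqrD S (phix u + psi u) (- psi u); rewrite addrK dotNl dotNr opprK.
  by move=> /le_trans; apply; move: w3 w5; rewrite /sq; lra.
have n1 := mulr_ge0 (ltW p1) N0; have n2 := mulr_ge0 (ltW p2) N0.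
have n4 := mulr_ge0 (ltW p4) N0; have n5 := mulr_ge0 (ltW p5) N0.
have n6 := mulr_ge0 (ltW p6) N0.
by split; lra.
Qed.

Lemma multipliers_le_nrj q g g2 g3 g4 : exists2 C, 0 < C & forall u, solves u ->
  `|g2 * G2 u + g3 * G3 u + g4 * G4 q g u| <= C * nrj u.
Proof.
have [M M0 hM] := ad_bounded_pos; have [b b0 hb] := nrj_dominates.
have [C1 C10 hC1] := dot_weight S (g2 * rho1) b b.
have [C2 C20 hC2] := dot_weight S (g3 * alpha) b b.
have [C3 C30 hC3] := dot_weight S (g3 * kappa) b b.
have [C4 C40 hC4] := dot_weight S (g3 * kappa) b (M * b).
pose C5 := `|g4| * ((sq q + sq g) * b).
have C50 : 0 <= C5 by rewrite !mulr_ge0 ?addr_ge0 ?sq_ge0// ltW.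
exists (1 + C1 + C2 + C3 + C4 + C5); first by rewrite -!addrA ltr_wpDr// !addr_ge0.
move=> u hu; have [w1 w2 w3 w4 w5] := hb u hu; have N0 := nrj_ge0 u.
have k1 : S (center J (v u)) (center J (v u)) <= b * nrj u by apply: le_trans (center_le _ _) w1.
have k2 : S (adc J (v u)) (adc J (v u)) <= M * b * nrj u.
  by apply: le_trans (adc_bounded _ (ltW M0) hM) _; rewrite -mulrA ler_pM2l.
have a1 := hC1 _ _ _ w2 w1 N0; have a2 := hC2 _ _ _ w3 w1 N0.
have a3 := hC3 _ _ _ w5 k1 N0; have a4 := hC4 _ _ _ w4 k2 N0.
have a5 : `|g4 * G4 q g u| <= C5 * nrj u.
  rewrite normrM /C5 -mulrA; apply: ler_wpM2l => //; rewrite /G4.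
  have c1 : S (v u) q ^+ 2 <= b * nrj u * sq q.
    by apply: le_trans (cauchy_schwarz_sq _ _ _) _; rewrite ler_wpM2r ?sq_ge0.
  have c2 : S (z u) g ^+ 2 <= b * nrj u * sq g.
    by apply: le_trans (cauchy_schwarz_sq _ _ _) _; rewrite ler_wpM2r ?sq_ge0.
  have c3 := sqr_ge0 (S (v u) q - S (z u) g); have c4 := sqr_ge0 (S (v u) q + S (z u) g).
  have c5 := sqr_ge0 (S (v u) q); have c6 := sqr_ge0 (S (z u) g).
  by rewrite ler_norml; apply/andP; split; lra.
have -> : g2 * G2 u + g3 * G3 u + g4 * G4 q g u = g2 * rho1 * S (z u) (v u)
  + g3 * alpha * S (psix u) (v u) - g3 * kappa * S (phi u) (center J (v u))
  + g3 * kappa * S (psi u) (adc J (v u)) + g4 * G4 q g u by rewrite /G2 /G3; ring.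
move: a1 a2 a3 a4 a5; rewrite !ler_norml.
move=> /andP[? ?] /andP[? ?] /andP[? ?] /andP[? ?] /andP[? ?].
by apply/andP; split; lra.
Qed.

Definition C1curve (x dx : R -> H) := wderiv S x dx /\ bounded_upto S dx.

Record strong_solution (U : R -> state) : Prop := StrongSolution {
  sol_solves : forall t : R, 0 < t -> solves (U t);
  sol_phi : C1curve (phi \o U) (v \o U);
  sol_phix : C1curve (phix \o U) (vx \o U);
  sol_v : C1curve (v \o U) (z \o U);
  sol_vx : C1curve (vx \o U) (zx \o U);
  sol_z : C1curve (z \o U) (zt \o U);
  sol_psi : C1curve (psi \o U) (psit \o U);
  sol_psix : C1curve (psix \o U) (psitx \o U);
  sol_th : C1curve (th \o U) (tht \o U);
  sol_p : C1curve (p \o U) (pt \o U) }.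

Lemma C1curveD x dx y dy : C1curve x dx -> C1curve y dy ->
  C1curve (fun t => x t + y t) (fun t => dx t + dy t).
Proof.
move=> [hx bx] [hy bY]; split.
  move=> w t t0; have ? := hx w t t0; have ? := hy w t t0.
  have -> : (fun s => S (x s + y s) w) = (fun s => S (x s) w) \+ (fun s => S (y s) w).
    by apply/funext => s /=; rewrite dotDl.
  by rewrite dotDl; exact: is_deriveD.
move=> T; have [M hM] := bx T; have [N hN] := bY T; exists (M + N) => t tT.
by apply: le_trans (nrmD _ _ _) _; rewrite lerD ?hM ?hN.
Qed.

Lemma C1curve_bounded_op (A B : H -> H) (M : R) x dx :
  (forall x y, S (A x) y = S x (B y)) -> (forall x, S (A x) (A x) <= M * S x x) ->
  C1curve x dx -> C1curve (A \o x) (A \o dx).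
Proof.
move=> AB AM [hx bx]; split.
  move=> w t t0; have := hx (B w) t t0; rewrite -AB; congr is_derive.
  by apply/funext => s /=; rewrite AB.
move=> T; have [N hN] := bx T; exists (Num.sqrt `|M| * N) => t tT.
apply: (@le_trans _ _ (Num.sqrt `|M| * nrm S (dx t))); last by rewrite ler_wpM2l// hN.
rewrite /nrm -sqrtrM//; rewrite ler_wsqrtr//; apply: le_trans (AM _) _.
by rewrite ler_wpM2r ?dot_ge0// ler_norm.
Qed.

Lemma C1curve_dot x dx y dy (t : R) : C1curve x dx -> C1curve y dy -> 0 < t ->
  is_derive t (1 : R) (fun s => S (x s) (y s) : R) (S (dx t) (y t) + S (x t) (dy t)).
Proof. by move=> [? ?] [? ?]; exact: is_derive_dot. Qed.

Lemma C1curve_dotw x dx w (t : R) : C1curve x dx -> 0 < t ->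
  is_derive t (1 : R) (fun s => S (x s) w : R) (S (dx t) w).
Proof. by move=> [hx _] t0; exact: hx. Qed.

(** The two constants precede the solution: they depend only on the coefficients and on [J], hence
    are common to all averaged solutions. *)
Lemma strong_decay : exists C l : R, [/\ 0 < C, 0 < l & forall U (s t : R),
  strong_solution U -> 0 < s -> s <= t ->
  nrj (U t) <= C * expR (- l * (t - s)) * nrj (U s)].
Proof.
have [q [g [g2 [g3 [g4 [C C0 hC]]]]]] := osc_bound.
have [K K0 hK] := nrj_static; have [m m0 hm] := dnrj_le.
have [B B0 hB] := multipliers_le_nrj q g g2 g3 g4.
(* The first summand lets the dissipation pay for [C * diss] with one [diss] to spare; the summand
   [B + 1] keeps the Lyapunov functional above the energy. *)
pose N := (C + 1) / m + B + 1.
have N0 : 0 < N by rewrite /N addr_gt0// addr_gt0// divr_gt0// ltr_wpDl.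
pose Lf u := N * nrj u - (g2 * G2 u + g3 * G3 u + g4 * G4 q g u).
pose dLf u := N * dnrj u - (g2 * dG2 u + g3 * dG3 u + g4 * dG4 q g u).
pose l := (K * (N + B))^-1.
have l0 : 0 < l by rewrite invr_gt0 mulr_gt0// addr_gt0.
exists (N + B), l; split => //; first by rewrite addr_gt0.
move=> U s t hU s0 st.
have Lf1 u : solves u -> nrj u <= Lf u.
  move=> hu; have := hB u hu; rewrite ler_norml => /andP[_ h1].
  have : 0 <= (C + 1) / m * nrj u.
    by rewrite mulr_ge0 ?nrj_ge0// divr_ge0// ?addr_ge0// ltW.
  rewrite /Lf /N; have := nrj_ge0 u; lra.
have Lf2 u : solves u -> Lf u <= (N + B) * nrj u.
  by move=> hu; have := hB u hu; rewrite ler_norml /Lf => /andP[h1 _]; lra.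
have dLf1 u : solves u -> dLf u <= - l * Lf u.
  move=> hu; have h1 := hC u hu; have h2 := ler_wpM2l (ltW N0) (hm u hu).
  have h3 : (C + 1) * diss u <= N * m * diss u.
    have -> : N * m = C + 1 + (B + 1) * m by rewrite /N; field; rewrite gt_eqF.
    rewrite ler_wpM2r ?diss_ge0// lerDl; apply: mulr_ge0; last exact: ltW.
    by rewrite addr_ge0// ltW.
  have h4 : l * Lf u <= osc u + diss u.
    have KN : 0 < K * (N + B) by apply: mulr_gt0 => //; exact: addr_gt0.
    rewrite /l ler_pdivrMl//; apply: le_trans (Lf2 u hu) _.
    have := ler_wpM2l (ltW (addr_gt0 N0 B0)) (hK u hu); lra.
  rewrite /dLf; lra.
case: hU => U0 U1 U2 U3 U4 U5 U6 U7 U8 U9.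
have [M M0 hM] := ad_bounded_pos.
have Uc : C1curve (center J \o (v \o U)) (center J \o (z \o U)).
  by apply: (@C1curve_bounded_op _ (center J) 1) U3 => [x y|x]; [exact: center_sym|rewrite mul1r; exact: center_le].
have Ua : C1curve (adc J \o (v \o U)) (adc J \o (z \o U)).
  apply: (@C1curve_bounded_op _ (fun y => - center J (J y)) M) U3 => [x y|x].
    by rewrite adc_dot dotNr.
  exact: adc_bounded (ltW M0) hM.
have Us := C1curveD U2 U6.
have dL (y : R) : 0 < y -> is_derive y (1 : R) (Lf \o U) (dLf (U y)).
  move=> y0.
  have ? := C1curve_dot U3 U3 y0; have ? := C1curve_dot U5 U5 y0.
  have ? := C1curve_dot U4 U4 y0; have ? := C1curve_dot Us Us y0.
  have ? := C1curve_dot U7 U7 y0; have ? := C1curve_dot U8 U8 y0.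
  have ? := C1curve_dot U8 U9 y0; have ? := C1curve_dot U9 U9 y0.
  have ? := C1curve_dot U5 U3 y0; have ? := C1curve_dot U7 U3 y0.
  have ? := C1curve_dot U1 Uc y0; have ? := C1curve_dot U6 Ua y0.
  have ? := C1curve_dotw q U3 y0; have ? := C1curve_dotw g U5 y0.
  rewrite /comp /Lf /nrj /thermal /sq /G2 /G3 /G4.
  apply: is_derive_eq; rewrite /GRing.scale/= /dLf /dnrj /dG2 /dG3 /dG4.
  rewrite /= (dotC S (v (U y)) (z (U y))) (dotC S (z (U y)) (zt (U y))).
  rewrite (dotC S (vx (U y)) (zx (U y))) (dotC S (th (U y)) (tht (U y))).
  rewrite (dotC S (psix (U y)) (psitx (U y))) (dotC S (p (U y)) (pt (U y))).
  rewrite (dotC S (phix (U y) + psi (U y))).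
  field.
  by rewrite gt_eqF.
have := exp_decay (l := l) dL (fun r r0 => dLf1 _ (U0 r r0)) s0 st.
have t0 := lt_le_trans s0 st.
move=> /(le_trans (Lf1 _ (U0 t t0))) /le_trans; apply.
rewrite [leRHS]mulrAC; apply: ler_wpM2r; first exact: ltW (expR_gt0 _).
exact: Lf2 (U0 s s0).
Qed.

End Lyapunov.

(** * Time averages *)

Section ScalarAverage.
Context {R : realType}.
Implicit Types (f g F G : R -> R) (h t : R).

Definition cont_pos f := forall t : R, 0 < t -> {for t, continuous f}.
Definition antideriv F f := forall u : R, 0 < u -> is_derive u (1 : R) F (f u).

(** To the left of [a] the function is frozen at its value at [a], which makes it continuous on the
    whole line. *)
Lemma antideriv_above f (a : R) : 0 < a -> cont_pos f ->
  exists F, forall u, a < u -> is_derive u (1 : R) F (f u).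
Proof.
move=> a0 cf; pose g (u : R) := f (Num.max u a).
have cg : continuous g.
  move=> u; apply: (@continuous_comp _ _ _ (fun u => Num.max u a) f).
    by apply: continuous_max => //; exact: cvg_cst.
  by apply: cf; rewrite lt_max a0 orbT.
exists (fun x => \int[lebesgue_measure]_(t in `[a - 1, x]) g t)%R => u au.
have [| | | |d1 d2] := @continuous_FTC1 R g (BLeft (a - 1)) u (u + 1).
- by rewrite ltrDl.
- apply: continuous_compact_integrable; first exact: segment_compact.
  by apply: continuous_subspaceT.
- by rewrite /= lte_fin; lra.
- exact: cg.
by split => //; rewrite -derive1E d2 /g max_l// ltW.
Qed.

Lemma antideriv_unique F G f (a x y : R) : (forall u, a < u -> is_derive u (1 : R) F (f u)) ->
  (forall u, a < u -> is_derive u (1 : R) G (f u)) -> a < x -> a < y ->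
  F x - G x = F y - G y.
Proof.
move=> hF hG; wlog xy : x y / x <= y => [hw ax ay|ax ay].
  have [xy|/ltW yx] := leP x y; first exact: hw.
  by apply/esym; exact: hw.
have [||c] := @MVT_segment R (F \- G) (fun=> 0) x y xy.
- move=> u; rewrite in_itv/= => /andP[xu _]; have au := lt_trans ax xu.
  have ? := hF u au; have ? := hG u au.
  by have := is_deriveB (hF u au) (hG u au); rewrite subrr.
- apply: derivable_within_continuous => u; rewrite in_itv/= => /andP[xu _].
  have au := lt_le_trans ax xu.
  by have [] := is_deriveB (hF u au) (hG u au).
by move=> _; rewrite mul0r => /eqP; rewrite subr_eq0 => /eqP.
Qed.

Lemma antideriv_exists f : cont_pos f -> exists F, antideriv F f.
Proof.
move=> cf.
have /choice[Fa hFa] (a : R) : exists F, 0 < a -> forall u, a < u -> is_derive u (1 : R) F (f u).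
  have [a0|a0] := ltP 0 a; first by have [F hF] := antideriv_above a0 cf; exists F.
  by exists (fun=> 0).
(* [f] need not be integrable near 0, so no single lower limit serves all x. The antiderivatives
   beyond [lo x] are glued after normalisation at 1, which requires [lo x] to be less than both x
   and 1. *)
pose lo (x : R) := Num.min x 1 / 2.
have lo0 (x : R) : 0 < x -> 0 < lo x by move=> x0; rewrite /lo divr_gt0// lt_min x0/=.
have lox (x : R) : 0 < x -> lo x < x.
  move=> x0; rewrite /lo ltr_pdivrMr//; have : Num.min x 1 <= x by rewrite ge_min lexx.
  lra.
have lo1 (x : R) : lo x < 1.
  rewrite /lo ltr_pdivrMr//; have : Num.min x 1 <= 1 by rewrite ge_min lexx orbT.
  lra.
exists (fun x => Fa (lo x) x - Fa (lo x) 1) => x x0.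
pose a := lo x / 2; have a0 : 0 < a by rewrite divr_gt0// lo0.
have ax : a < lo x by rewrite /a; have := lo0 x x0; lra.
have := hFa a a0 x (lt_trans ax (lox x x0)).
move=> /is_deriveP hd; apply/is_deriveP => e e0; have [r r0 hr] := hd e e0.
exists (Num.min r (x / 2)); first by rewrite lt_min r0 divr_gt0.
move=> s; rewrite lt_min => /andP[sr sx].
have s0 : x / 2 < s by move: sx; rewrite ltr_norml => /andP[? ?]; lra.
have s00 : 0 < s by apply: lt_trans s0; rewrite divr_gt0.
have eqF y : 0 < y -> a < lo y \/ a <= lo y -> Fa (lo y) y - Fa (lo y) 1 = Fa a y - Fa a 1.
  move=> y0 hy; have {}hy : a <= lo y by case: hy => // /ltW.
  have h1 u : lo y < u -> is_derive u (1 : R) (Fa a) (f u).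
    by move=> yu; apply: hFa => //; exact: le_lt_trans yu.
  have := antideriv_unique (hFa (lo y) (lo0 y y0)) h1 (lox y y0) (lo1 y); lra.
rewrite !eqF//; [|by left|right].
  have -> : Fa a s - Fa a 1 - (Fa a x - Fa a 1) = Fa a s - Fa a x by ring.
  exact: hr.
rewrite /a /lo ler_pM2r// le_min; apply/andP; split.
  have : Num.min x 1 <= x by rewrite ge_min lexx. lra.
have : Num.min x 1 <= 1 by rewrite ge_min lexx orbT. lra.
Qed.

(** The mean of [f] over the window from t to t + h, through an antiderivative on the positive
    half-line. Looking forward keeps the window within positive times. *)
Definition avgs h f t : R :=
  (xget (fun=> 0) [set F | antideriv F f] (t + h) - xget (fun=> 0) [set F | antideriv F f] t) / h.

Lemma avgsE h f F t : 0 < h -> 0 < t -> antideriv F f -> avgs h f t = (F (t + h) - F t) / h.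
Proof.
move=> h0 t0 hF; rewrite /avgs; case: xgetP => [G _ hG|/(_ F)//].
by have := antideriv_unique hF hG t0 (addr_gt0 t0 h0) => e; congr (_ / _); lra.
Qed.

Lemma eq_avgs h f g t : 0 < h -> 0 < t -> cont_pos f -> (forall u, 0 < u -> f u = g u) ->
  avgs h f t = avgs h g t.
Proof.
move=> h0 t0 cf fg; have [F hF] := antideriv_exists cf.
by rewrite !(@avgsE h _ F t)// => u u0; rewrite -fg//; exact: hF.
Qed.

Lemma avgsD h f g t : 0 < h -> 0 < t -> cont_pos f -> cont_pos g ->
  avgs h (fun u => f u + g u) t = avgs h f t + avgs h g t.
Proof.
move=> h0 t0 /antideriv_exists[F hF] /antideriv_exists[G hG].
rewrite (avgsE h0 t0 hF) (avgsE h0 t0 hG) (@avgsE h _ (F \+ G) t)//=.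
  by rewrite -mulrDl; congr (_ / _); ring.
by move=> u u0; exact: (is_deriveD (hF u u0) (hG u u0)).
Qed.

Lemma avgsZ h (a : R) f t : 0 < h -> 0 < t -> cont_pos f ->
  avgs h (fun u => a * f u) t = a * avgs h f t.
Proof.
move=> h0 t0 /antideriv_exists[F hF].
rewrite (avgsE h0 t0 hF) (@avgsE h _ (a *: F) t)//=.
  by rewrite /GRing.scale/= /GRing.scale/= mulrA mulrBr.
by move=> u u0; exact: (is_deriveZ a (hF u u0)).
Qed.

Lemma avgs_dist h f t (c e : R) : 0 < h -> 0 < t -> cont_pos f ->
  (forall u, t <= u <= t + h -> `|f u - c| <= e) -> `|avgs h f t - c| <= e.
Proof.
move=> h0 t0 cf hf; have [F hF] := antideriv_exists cf.
have th : t <= t + h by rewrite lerDl ltW.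
have [x hx e1] := mvt_pos hF t0 th.
by rewrite (avgsE h0 t0 hF) e1 addrAC subrr add0r mulfK ?gt_eqF// hf.
Qed.

Lemma avgs_is_derive h f t : 0 < h -> 0 < t -> cont_pos f ->
  is_derive t (1 : R) (avgs h f) (h^-1 * (f (t + h) - f t)).
Proof.
move=> h0 t0 cf; have [F hF] := antideriv_exists cf.
have : is_derive t (1 : R) (fun s => h^-1 * (F (s + h) - F s)) (h^-1 * (f (t + h) - f t)).
  have ? := hF t t0.
  have h1 : is_derive (t + h) (1 : R) F (f (t + h)) by apply: hF; exact: addr_gt0.
  have h2 : is_derive t (1 : R) (F \o (fun s : R => s + h)) (f (t + h)).
    by apply: is_derive_eq; rewrite /GRing.scale/= addr0 mulr1.
  rewrite -[fun s => _]/(fun s => h^-1 * ((F \o (fun s : R => s + h)) s - F s)).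
  by apply: is_derive_eq.
move=> /is_deriveP h1; apply/is_deriveP => e e0; have [r r0 hr] := h1 e e0.
exists (Num.min r t); first by rewrite lt_min r0.
move=> s; rewrite lt_min => /andP[sr]; rewrite ltr_norml => /andP[s1 _].
have s0 : 0 < s by lra.
by rewrite (avgsE h0 t0 hF) (avgsE h0 s0 hF) 2!(mulrC _ h^-1); exact: hr.
Qed.

End ScalarAverage.

(** * Weak averages of vector-valued curves *)

Definition riesz_complete (R : realType) (H : lmodType R) (S : inner_product H) :=
  forall l : H -> R, (forall x y, l (x + y) = l x + l y) ->
    (forall a x, l (a *: x) = a * l x) ->
    (exists M, forall x, `|l x| <= M * nrm S x) -> exists y, forall x, l x = S y x.

Section VectorAverage.
Context {R : realType} {H : lmodType R} (S : inner_product H) (HR : riesz_complete S).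
Implicit Types (x y dx dy : R -> H) (w : H).

Local Notation wcont := (wcont S).
Local Notation bounded_upto := (bounded_upto S).
Local Notation wderiv := (wderiv S).

Definition good x := wcont x /\ bounded_upto x.
(** Equality up to a null vector, the only one that weak averages can satisfy. *)
Definition deq (a b : H) := forall w, S a w = S b w.

Lemma good_dot x w : good x -> cont_pos (fun u => S (x u) w).
Proof. by move=> [h _] t t0; exact: h. Qed.

(** The weak (Pettis) mean of the curve over the window: a vector representing the functional given
    by the scalar means. *)
Definition avg (h : R) x (t : R) : H :=
  xget 0 [set a | forall w, S a w = avgs h (fun u => S (x u) w) t].

Definition dq (h : R) x (t : R) : H := h^-1 *: (x (t + h) - x t).

Lemma avg_dot h x t w : 0 < h -> 0 < t -> good x ->
  S (avg h x t) w = avgs h (fun u => S (x u) w) t.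
Proof.
move=> h0 t0 gx; have [_ /(_ (t + h)) [M hM]] := gx.
have [|||y hy] := HR (l := fun w => avgs h (fun u => S (x u) w) t).
- move=> a b; rewrite -avgsD//; try exact: good_dot.
  apply: eq_avgs => //; last by move=> u _; rewrite dotDr.
  exact: good_dot.
- move=> a b; rewrite -avgsZ//; try exact: good_dot.
  apply: eq_avgs => //; last by move=> u _; rewrite dotZr.
  exact: good_dot.
- exists M => a; have := avgs_dist (c := 0) h0 t0 (good_dot (w := a) gx).
  move=> /(_ (M * nrm S a)); rewrite subr0; apply => u /andP[tu uth].
  rewrite subr0; apply: le_trans (cauchy_schwarz _ _ _) _.
  by rewrite ler_wpM2r ?nrm_ge0// hM// uth andbT (lt_le_trans t0).
by rewrite /avg; case: xgetP => [a _ ->//|/(_ y)]; case => a; rewrite hy.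
Qed.

Lemma avg_wderiv h x : 0 < h -> good x -> wderiv (avg h x) (dq h x).
Proof.
move=> h0 gx w t t0.
have := avgs_is_derive h0 t0 (good_dot (w := w) gx); rewrite /dq dotZl dotBl.
move=> /is_deriveP hd; apply/is_deriveP => e e0; have [r r0 hr] := hd e e0.
exists (Num.min r t); first by rewrite lt_min r0.
move=> s; rewrite lt_min => /andP[sr]; rewrite ltr_norml => /andP[s1 _].
have s0 : 0 < s by lra.
by rewrite !avg_dot//; exact: hr.
Qed.

Lemma avg_le h x t M : 0 < h -> 0 < t -> good x ->
  (forall u, t <= u <= t + h -> nrm S (x u) <= M) -> nrm S (avg h x t) <= M.
Proof.
move=> h0 t0 gx hM.
have M0 : 0 <= M.
  by apply: le_trans (nrm_ge0 S (x t)) _; apply: hM; rewrite lexx lerDl ltW.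
apply: nrm_le_of_dot => //; rewrite avg_dot//; apply: le_trans (ler_norm _) _.
have := avgs_dist (c := 0) h0 t0 (good_dot (w := avg h x t) gx).
move=> /(_ (M * nrm S (avg h x t))); rewrite subr0; apply => u tu.
rewrite subr0; apply: le_trans (cauchy_schwarz _ _ _) _.
by rewrite ler_wpM2r ?nrm_ge0// hM.
Qed.

Lemma avg_bounded h x : 0 < h -> good x -> bounded_upto (avg h x).
Proof.
move=> h0 gx T; have [_ /(_ (T + h)) [M hM]] := gx; exists M => t /andP[t0 tT].
apply: avg_le => // u /andP[tu uth]; apply: hM; rewrite (lt_le_trans t0)//=.
by apply: le_trans uth _; rewrite lerD2r.
Qed.

Lemma good_avg h x : 0 < h -> good x -> good (avg h x).
Proof.
by move=> h0 gx; split; [exact: wderiv_wcont (avg_wderiv h0 gx)|exact: avg_bounded].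
Qed.

Lemma goodD x y : good x -> good y -> good (fun t => x t + y t).
Proof.
move=> [cx bx] [cy by0]; split.
  move=> w t t0; rewrite (_ : (fun s => _) = (fun s => S (x s) w) \+ (fun s => S (y s) w)).
    by apply: continuousD; [exact: cx|exact: cy].
  by apply/funext => s /=; rewrite dotDl.
move=> T; have [M hM] := bx T; have [N hN] := by0 T; exists (M + N) => t tT.
by apply: le_trans (nrmD _ _ _) _; rewrite lerD ?hM ?hN.
Qed.

Lemma goodZ (a : R) x : good x -> good (fun t => a *: x t).
Proof.
move=> [cx bx]; split.
  move=> w t t0; rewrite (_ : (fun s => _) = (fun s => a * S (x s) w)).
    by apply: continuousM; [exact: cvg_cst|exact: cx].
  by apply/funext => s /=; rewrite dotZl.
move=> T; have [M hM] := bx T; exists (`|a| * M) => t tT.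
by rewrite nrmZ ler_wpM2l// hM.
Qed.

Lemma good_shift (h : R) x : 0 < h -> good x -> good (fun t => x (t + h)).
Proof.
move=> h0 [cx bx]; split.
  move=> w t t0.
  apply: (@continuous_comp _ _ _ (fun s : R => s + h) (fun s => S (x s) w)).
    by apply: continuousD; [exact: cvg_id|exact: cvg_cst].
  exact: cx (addr_gt0 t0 h0).
move=> T; have [M hM] := bx (T + h); exists M => t /andP[t0 tT].
by apply: hM; rewrite lerD2r tT addr_gt0.
Qed.

Lemma good_dq h x : 0 < h -> good x -> good (dq h x).
Proof.
move=> h0 gx; have -> : dq h x = fun t => h^-1 *: (x (t + h) + (-1) *: x t).
  by apply/funext => t; rewrite /dq scaleN1r.
by apply: goodZ; apply: goodD (goodZ _ gx); exact: good_shift.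
Qed.

Lemma eq_avg h x y t : 0 < h -> 0 < t -> good x -> good y ->
  (forall u, 0 < u -> deq (x u) (y u)) -> deq (avg h x t) (avg h y t).
Proof.
move=> h0 t0 gx gy xy w; rewrite !avg_dot//; apply: eq_avgs => //.
  exact: good_dot.
by move=> u u0; exact: xy.
Qed.

Lemma avgD h x y t : 0 < h -> 0 < t -> good x -> good y ->
  deq (avg h (fun u => x u + y u) t) (avg h x t + avg h y t).
Proof.
move=> h0 t0 gx gy w; rewrite dotDl !avg_dot//; last exact: goodD.
rewrite -avgsD//; try exact: good_dot.
apply: eq_avgs => //; last by move=> u _; rewrite dotDl.
exact/good_dot/goodD.
Qed.

Lemma avgZ h a x t : 0 < h -> 0 < t -> good x ->
  deq (avg h (fun u => a *: x u) t) (a *: avg h x t).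
Proof.
move=> h0 t0 gx w; rewrite dotZl !avg_dot//; last exact: goodZ.
rewrite -avgsZ//; try exact: good_dot.
apply: eq_avgs => //; last by move=> u _; rewrite dotZl.
exact/good_dot/goodZ.
Qed.

Lemma avg_deriv h x dx t : 0 < h -> 0 < t -> good dx -> wderiv x dx ->
  deq (avg h dx t) (dq h x t).
Proof.
move=> h0 t0 gx xdx w; rewrite avg_dot// (avgsE h0 t0 (xdx w)) /dq dotZl dotBl.
by rewrite mulrC.
Qed.

Lemma wderiv_dq h x dx : 0 < h -> wderiv x dx -> wderiv (dq h x) (dq h dx).
Proof.
move=> h0 xdx w t t0; rewrite /dq.
have -> : (fun s => S (h^-1 *: (x (s + h) - x s)) w) =
    (fun s => h^-1 * ((fun s => S (x s) w) \o (fun s : R => s + h)) s - h^-1 * S (x s) w).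
  by apply/funext => s /=; rewrite dotZl dotBl mulrBr.
have ? := xdx w t t0.
have h1 : is_derive (t + h) (1 : R) (fun s => S (x s) w) (S (dx (t + h)) w).
  by apply: xdx; exact: addr_gt0.
have h2 : is_derive t (1 : R) ((fun s => S (x s) w) \o (fun s : R => s + h)) (S (dx (t + h)) w).
  by apply: is_derive_eq; rewrite /GRing.scale/= addr0 mulr1.
apply: is_derive_eq; rewrite /GRing.scale/= dotZl dotBl mulrBr//.
Qed.

Lemma wderiv_deq x dx dy : wderiv x dx -> (forall t, 0 < t -> deq (dx t) (dy t)) -> wderiv x dy.
Proof. by move=> xdx e w t t0; rewrite -e//; exact: xdx. Qed.

Lemma dq_le h x t M : 0 < h -> (forall s t, 0 < s -> s <= t -> nrm S (x t - x s) <= M * (t - s)) ->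
  0 < t -> nrm S (dq h x t) <= M.
Proof.
move=> h0 lx t0; rewrite /dq nrmZ ger0_norm ?invr_ge0 ?(ltW h0)//.
rewrite ler_pdivrMl// mulrC.
by have := lx t (t + h) t0; rewrite lerDl (ltW h0) addrAC subrr add0r; apply.
Qed.

Lemma avg2_near x t w (e : R) : good x -> 0 < t -> 0 < e ->
  exists2 r, 0 < r & forall h, 0 < h < r -> `|S (avg h (avg h x) t) w - S (x t) w| <= e.
Proof.
move=> gx t0 e0; have [cx _] := gx.
move/cvgrPdist_le : (cx w t t0) => /(_ e e0) [r /= r0 hr].
exists (r / 2) => [|h /andP[h0 hr2]]; first by rewrite divr_gt0.
rewrite avg_dot//; last exact: good_avg.
apply: avgs_dist => //; first exact/good_dot/good_avg.
move=> u /andP[tu uth]; have u0 := lt_le_trans t0 tu; rewrite avg_dot//.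
apply: avgs_dist => //; first exact/good_dot.
move=> u1 /andP[uu1 u1h]; rewrite distrC; apply: hr.
by rewrite /ball_/= distrC ger0_norm ?subr_ge0; lra.
Qed.

End VectorAverage.

(** * Relations between curves preserved by averages and difference quotients *)

Section Relations.
Context {R : realType} {H : lmodType R} {S : inner_product H} (HR : riesz_complete S)
  (J : antiderivative S).
Implicit Types (x y : R -> H) (f g u w : H).

Local Notation one := (one J).
Local Notation hvan := (hvan J).
Local Notation hder := (hder J).
Local Notation good := (good S).
Local Notation deq := (deq S).
Local Notation avg := (avg S).

Lemma deq_refl f : deq f f. Proof. by []. Qed.

Lemma deq_sym f g : deq f g -> deq g f. Proof. by move=> h w; rewrite h. Qed.

Lemma deq_trans f g u : deq f g -> deq g u -> deq f u.
Proof. by move=> h1 h2 w; rewrite h1 h2. Qed.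

Lemma deqD f g u w : deq f g -> deq u w -> deq (f + u) (g + w).
Proof. by move=> h1 h2 y; rewrite !dotDl h1 h2. Qed.

Lemma deqZ a f g : deq f g -> deq (a *: f) (a *: g).
Proof. by move=> h1 y; rewrite !dotZl h1. Qed.

Lemma hder_deq u f u1 f1 : deq u f -> deq u1 f1 -> hder u u1 -> hder f f1.
Proof. by move=> e e1 h w w0; rewrite -e -e1 h. Qed.

Lemma hvan_avg h x y t : 0 < h -> 0 < t -> good x -> good y ->
  (forall s, 0 < s -> hvan (x s) (y s)) -> hvan (avg h x t) (avg h y t).
Proof.
move=> h0 t0 gx gy hxy; split.
  rewrite (avg_dot HR)// (avgsE (F := fun=> 0))//; first by rewrite subrr mul0r.
  by move=> s s0; have [-> _] := hxy s s0; exact: is_derive_cst.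
move=> w; rewrite !(avg_dot HR)// -mulN1r -avgsZ//; last exact: good_dot.
apply: eq_avgs => //; first exact: good_dot.
by move=> s s0; rewrite mulN1r; have [_ ->] := hxy s s0.
Qed.

Lemma hder_avg h x y t : 0 < h -> 0 < t -> good x -> good y ->
  (forall s, 0 < s -> hder (x s) (y s)) -> hder (avg h x t) (avg h y t).
Proof.
move=> h0 t0 gx gy hxy w w0.
rewrite !(avg_dot HR)// -mulN1r -avgsZ//; last exact: good_dot.
apply: eq_avgs => //; first exact: good_dot.
by move=> s s0; rewrite mulN1r; rewrite hxy.
Qed.

Lemma hvan_dq h x y t : 0 < h -> 0 < t ->
  (forall s, 0 < s -> hvan (x s) (y s)) -> hvan (dq h x t) (dq h y t).
Proof.
move=> h0 t0 hxy; have [a1 a2] := hxy t t0; have [b1 b2] := hxy _ (addr_gt0 t0 h0).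
split; first by rewrite /dq dotZl dotBl a1 b1 subrr mulr0.
by move=> w; rewrite /dq !dotZl !dotBl a2 b2; ring.
Qed.

Lemma hder_dq h x y t : 0 < h -> 0 < t ->
  (forall s, 0 < s -> hder (x s) (y s)) -> hder (dq h x t) (dq h y t).
Proof.
move=> h0 t0 hxy w w0; have a2 := hxy t t0 w w0.
have b2 := hxy _ (addr_gt0 t0 h0) w w0.
by rewrite /dq !dotZl !dotBl a2 b2; ring.
Qed.

Lemma dq_comb h (a b : R) x y t :
  dq h (fun s => a *: x s + b *: y s) t = a *: dq h x t + b *: dq h y t.
Proof.
rewrite /dq !scalerA (mulrC a) (mulrC b) -!scalerA -scalerDr !scalerBr.
by rewrite -scalerBr opprD addrACA.
Qed.

Lemma avg_comb h (a b : R) x y t : 0 < h -> 0 < t -> good x -> good y ->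
  deq (avg h (fun s => a *: x s + b *: y s) t) (a *: avg h x t + b *: avg h y t).
Proof.
move=> h0 t0 gx gy; apply: deq_trans (avgD HR h0 t0 (goodZ a gx) (goodZ b gy)) _.
by apply: deqD; exact: avgZ.
Qed.

(* The weak form of k q_xx + xi psi_tx = g with Dirichlet conditions, tested
   with the solution w = adc (J om) of w_xx = om. *)
Lemma hvan_heat (k xi : R) q g psit : k != 0 ->
  (forall om, S g (adc J (J om)) + xi * S psit (center J (J om)) = k * S q om) ->
  let qx := k^-1 *: center J (J g - xi *: psit) in
  hvan q qx /\ hder (k *: qx + xi *: psit) g.
Proof.
move=> k0 hq qx.
have e om : S qx om = k^-1 * (- S g (adc J om) - xi * S psit (center J om)).
  rewrite /qx dotZl center_sym dotBl dotZl; congr (_ * (_ - _)).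
  have := ad_skew J g (center J om); rewrite center_dot_one mulr0 => /eqP.
  by rewrite addr_eq0 => /eqP ->.
split; first split.
- by rewrite /qx dotZl center_dot_one mulr0.
- by move=> om; rewrite e -[LHS](mulKf k0) -hq; ring.
move=> om om0; rewrite dotDl dotZl e dotZl mulVKf//.
have -> : adc J om = J om.
  by rewrite /adc /center -lock /mean om0 mul0r scale0r subr0.
by rewrite /center -lock /mean om0 mul0r scale0r subr0; ring.
Qed.

Lemma dense_bound (y : H) (B : R) : 0 <= B ->
  (forall om, S om one = 0 -> S y (J om) <= B * nrm S (J om)) -> nrm S y <= B.
Proof.
move=> B0 hB; apply: (nrm_le_dense (T := [set z | exists2 w, S w one = 0 & z = J w])) => //.
  move=> x e e0; have [w [w0 hw]] := ad_dense J x (exprn_gt0 2 e0).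
  by exists (J w); [exists w|rewrite -ltr_sqr ?nnegrE ?nrm_ge0 ?(ltW e0)// -nrmE].
by move=> _ [w w0 ->]; exact: hB.
Qed.

End Relations.

(** The comparison is with small positive times s only, never with time 0; taking s = min(t, 1) / 2
    costs at most the factor [expR l]. *)
Lemma expR_decay_limit (R : realType) (C l t x : R) : 0 <= C -> 0 < l -> 0 < t ->
  (forall s, 0 < s -> s < t -> s <= 1 / 2 -> x <= C * expR (- l * (t - s))) ->
  x <= C * expR l * expR (- l * t).
Proof.
move=> C0 l0 t0 h.
have t10 : 0 < Num.min t 1 / 2 by rewrite divr_gt0// lt_min t0/=.
have m1 : Num.min t 1 <= t by rewrite ge_min lexx.
have m2 : Num.min t 1 <= 1 by rewrite ge_min lexx orbT.
apply: le_trans (h (Num.min t 1 / 2) t10 _ _) _; try lra.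
rewrite -mulrA -expRD ler_wpM2l// ler_expR.
have : l * (Num.min t 1 / 2) <= l * 1 by rewrite ler_pM2l//; lra.
lra.
Qed.

Lemma summands_le (R : realType) (a1 a2 a3 a4 a5 a6 a7 : R) :
  0 <= a1 -> 0 <= a2 -> 0 <= a3 -> 0 <= a4 -> 0 <= a5 -> 0 <= a6 -> 0 <= a7 ->
  let s := a1 + a2 + a3 + a4 + a5 + (a6 + a7) in
  [/\ a1 <= s, a2 <= s, a3 <= s, a4 <= s & [/\ a5 <= s, a6 <= s & a7 <= s]].
Proof.
by move=> ? ? ? ? ? ? ? s; split; [| | | |split]; rewrite /s; lra.
Qed.

(** * Decay of weak solutions *)

Section WeakSolutions.
Context {R : realType} {H : lmodType R} (S : inner_product H) (HR : riesz_complete S)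
  (J : antiderivative S).
Context (rho1 rho2 kappa alpha h c r mu d xi1 xi2 : R)
  (rho1_gt0 : 0 < rho1) (rho2_gt0 : 0 < rho2) (kappa_gt0 : 0 < kappa)
  (alpha_gt0 : 0 < alpha) (h_gt0 : 0 < h) (r_gt0 : 0 < r) (mu_gt0 : 0 < mu)
  (crd_gt0 : 0 < c * r - d ^+ 2).
Context (dense_zero dense_all : set H)
  (dense_zero_mean : forall w, dense_zero w -> S w (one J) = 0)
  (dense_zeroP : forall x e, S x (one J) = 0 -> 0 < e ->
    exists2 w, dense_zero w & nrm S (x - w) < e)
  (dense_allP : forall x e, 0 < e -> exists2 w, dense_all w & nrm S (x - w) < e).

Local Notation one := (one J).
Local Notation hvan := (hvan J).
Local Notation hder := (hder J).
Local Notation good := (good S).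
Local Notation deq := (deq S).
Local Notation avg := (avg S).
Local Notation wderiv := (wderiv S).

Lemma eq_on_dense (D : set H) (f g : H -> R) (x : H) :
  (forall e : R, 0 < e -> exists2 w, D w & nrm S (x - w) < e) ->
  (exists M, forall y w, `|f y - f w| <= M * nrm S (y - w)) ->
  (exists M, forall y w, `|g y - g w| <= M * nrm S (y - w)) ->
  (forall w, D w -> f w = g w) -> f x = g x.
Proof.
move=> hD [M hM] [N hN] fg; apply/eqP; rewrite -subr_eq0 -normr_le0.
apply/ler_addgt0Pr => e e0; rewrite add0r.
have c0 : 0 < `|M| + `|N| + 1 by rewrite ltr_wpDl// addr_ge0.
have [w Dw hw] := hD (e / (`|M| + `|N| + 1)) (divr_gt0 e0 c0).
have -> : f x - g x = (f x - f w) - (g x - g w) by rewrite (fg w Dw); ring.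
apply: le_trans (ler_normB _ _) _; apply: le_trans (lerD (hM _ _) (hN _ _)) _.
move: hw; rewrite ltr_pdivlMr// => hw.
have n0 := nrm_ge0 S (x - w).
have := ler_wpM2r n0 (ler_norm M); have := ler_wpM2r n0 (ler_norm N); lra.
Qed.

Lemma dot_lip a : exists M, forall y w, `|S a y - S a w| <= M * nrm S (y - w).
Proof. by exists (nrm S a) => y w; rewrite -dotBr cauchy_schwarz. Qed.

Lemma lipD (f g : H -> R) (a b : R) :
  (exists M, forall y w, `|f y - f w| <= M * nrm S (y - w)) ->
  (exists M, forall y w, `|g y - g w| <= M * nrm S (y - w)) ->
  exists M, forall y w, `|(a * f y + b * g y) - (a * f w + b * g w)| <= M * nrm S (y - w).
Proof.
move=> [M hM] [N hN]; exists (`|a| * M + `|b| * N) => y w.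
have -> : a * f y + b * g y - (a * f w + b * g w) = a * (f y - f w) + b * (g y - g w) by ring.
apply: le_trans (ler_normD _ _) _; rewrite !normrM mulrDl -!mulrA.
by apply: lerD; rewrite ler_wpM2l.
Qed.

Lemma dot_ad_lip a : exists M, forall y w, `|S a (J y) - S a (J w)| <= M * nrm S (y - w).
Proof.
have [M hM] := ad_bounded J; exists (nrm S a * Num.sqrt `|M|) => y w.
have adB x z : J (x - z) = J x - J z by rewrite adD -scaleN1r adZ scaleN1r.
rewrite -dotBr -adB; apply: le_trans (cauchy_schwarz _ _ _) _.
rewrite -mulrA ler_wpM2l ?nrm_ge0// /nrm -sqrtrM//.
rewrite ler_wsqrtr//; apply: le_trans (hM _) _.
by rewrite ler_wpM2r ?dot_ge0// ler_norm.
Qed.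

(* psi_t, known only for almost every t, is eliminated by keeping it under a time
   derivative; [ws_eq_th] and [ws_eq_p] test with the solution adc J (J w) of W'' = w,
   W(0) = W(L) = 0. *)
Record weak_solution (phi phix phit phitt psi psix th p : R -> H) : Prop :=
  WeakSolution {
  good_phi : good phi; good_phix : good phix; good_phit : good phit;
  good_phitt : good phitt; good_psi : good psi; good_psix : good psix;
  good_th : good th; good_p : good p;
  ws_phi : forall t, 0 < t -> hvan (phi t) (phix t);
  ws_psi : forall t, 0 < t -> hvan (psi t) (psix t);
  ws_phit : wderiv phi phit;
  ws_phitt : wderiv phit phitt;
  ws_lip : exists M, forall s t : R, 0 < s -> s <= t ->
    nrm S (phix t - phix s) <= M * (t - s);
  ws_eq_phi : forall t, 0 < t -> hder (kappa *: (phix t + psi t)) (rho1 *: phitt t);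
  ws_eq_psi : forall (t : R) w, 0 < t -> dense_zero w ->
    is_derive t (1 : R) (fun s => mu * S (psi s) (J w))
      (- (S (rho2 *: phitt t + alpha *: psix t + (xi1 *: th t + xi2 *: p t)) w
          + S (kappa *: (phix t + psi t)) (J w)));
  ws_eq_th : forall (t : R) w, 0 < t -> dense_all w ->
    is_derive t (1 : R)
      (fun s => S (c *: th s + d *: p s) (adc J (J w)) + xi1 * S (psi s) (center J (J w)))
      (kappa * S (th t) w);
  ws_eq_p : forall (t : R) w, 0 < t -> dense_all w ->
    is_derive t (1 : R)
      (fun s => S (d *: th s + r *: p s) (adc J (J w)) + xi2 * S (psi s) (center J (J w)))
      (h * S (p t) w) }.

(** * The averaged solution is a strong solution *)

Section Regularized.
Context (phi phix phit phitt psi psix th p : R -> H)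
  (HW : weak_solution phi phix phit phitt psi psix th p) (k : R) (k0 : 0 < k).

Local Notation A := (avg k).
Local Notation D := (dq k).

Let gphi := good_phi HW. Let gphix := good_phix HW. Let gphit := good_phit HW.
Let gphitt := good_phitt HW. Let gpsi := good_psi HW. Let gpsix := good_psix HW.
Let gth := good_th HW. Let gp := good_p HW.

Let gA x (gx : good x) : good (A x) := good_avg HR k0 gx.
Let gD x (gx : good x) : good (D x) := good_dq k0 gx.
Let ADw x (gx : good x) : wderiv (A x) (D x) := avg_wderiv HR k0 gx.

Definition rth_t t := c *: A (D th) t + d *: A (D p) t.
Definition rp_t t := d *: A (D th) t + r *: A (D p) t.

(** Time derivatives are difference quotients of phi and psi rather than averages of phit, phitt or
    psit, because only phi and psi are known to be in H^1_0 at every positive time. The derivatives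
    of theta and P are the vectors produced by [hvan_heat] from the averaged diffusion equations. *)
Definition regularized (t : R) : state := State
  (A (A phi) t) (A (A phix) t) (A (D phi) t) (A (D phix) t)
  (D (D phi) t) (D (D phix) t) (D (D phit) t)
  (A (A psi) t) (A (A psix) t) (A (D psi) t) (A (D psix) t)
  (A (A th) t) (kappa^-1 *: center J (J (rth_t t) - xi1 *: A (D psi) t)) (A (D th) t)
  (A (A p) t) (h^-1 *: center J (J (rp_t t) - xi2 *: A (D psi) t)) (A (D p) t).

(** The second difference quotient has an x-derivative, the double average of phitt satisfies the
    equations and is bounded uniformly in k; this identification gives z both properties. *)
Lemma AA_DD t : 0 < t -> deq (A (A phitt) t) (D (D phi) t).
Proof.
move=> t0; apply: deq_trans (avg_deriv HR k0 t0 (gD gphit) (wderiv_dq k0 (ws_phit HW))).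
apply: eq_avg => //; [exact: gA|exact: gD|] => u u0.
exact: avg_deriv (ws_phitt HW).
Qed.

Lemma AA_AD t : 0 < t -> deq (A (A phit) t) (A (D phi) t).
Proof.
move=> t0; apply: eq_avg => //; [exact: gA|exact: gD|] => u u0.
exact: avg_deriv (ws_phit HW).
Qed.

Lemma reg_eq_phi t : 0 < t ->
  hder (kappa *: (A (A phix) t + A (A psi) t)) (rho1 *: D (D phi) t).
Proof.
move=> t0.
have e1 u : 0 < u -> hder (kappa *: (A phix u + A psi u)) (rho1 *: A phitt u).
  move=> u0; have := hder_avg HR k0 u0 (goodZ kappa (goodD gphix gpsi))
    (goodZ rho1 gphitt) (ws_eq_phi HW).
  apply: hder_deq; last exact: avgZ.
  apply: deq_trans (avgZ HR _ k0 u0 (goodD gphix gpsi)) _.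
  by apply: deqZ; exact: avgD.
have := hder_avg HR k0 t0 (goodZ kappa (goodD (gA gphix) (gA gpsi)))
  (goodZ rho1 (gA gphitt)) e1.
apply: hder_deq.
  apply: deq_trans (avgZ HR _ k0 t0 (goodD (gA gphix) (gA gpsi))) _.
  by apply: deqZ; apply: avgD => //; exact: gA.
apply: deq_trans (avgZ HR _ k0 t0 (gA gphitt)) _.
by apply: deqZ; exact: AA_DD.
Qed.

Lemma reg_eq_phit t : 0 < t ->
  hder (kappa *: (A (D phix) t + A (D psi) t)) (rho1 *: D (D phit) t).
Proof.
move=> t0.
have e1 u : 0 < u -> hder (kappa *: D phix u + kappa *: D psi u) (rho1 *: D phitt u + 0 *: D phitt u).
  move=> u0; rewrite -!dq_comb; apply: hder_dq => // s s0.
  by rewrite scale0r addr0 -scalerDr; exact: (ws_eq_phi HW).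
have := hder_avg HR k0 t0 (goodD (goodZ kappa (gD gphix)) (goodZ kappa (gD gpsi)))
  (goodD (goodZ rho1 (gD gphitt)) (goodZ 0 (gD gphitt))) e1.
apply: hder_deq.
  apply: deq_trans (avg_comb HR kappa kappa k0 t0 (gD gphix) (gD gpsi)) _.
  by rewrite scalerDr; exact: deq_refl.
apply: deq_trans (avg_comb HR rho1 0 k0 t0 (gD gphitt) (gD gphitt)) _.
rewrite scale0r addr0; apply: deqZ.
exact: avg_deriv (gD gphitt) (wderiv_dq k0 (ws_phitt HW)).
Qed.

Let Sig t := rho2 *: phitt t + alpha *: psix t + (xi1 *: th t + xi2 *: p t).
Let gSig : good Sig.
Proof.
apply: goodD; apply: goodD; exact: goodZ.
Qed.

Let Gam t := kappa *: (phix t + psi t).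
Let gGam : good Gam. Proof. by apply: goodZ; exact: goodD. Qed.

(** Integrating the time derivative in [ws_eq_psi] over the window leaves a difference quotient of
    psi. Both sides are then continuous in the test vector, so the equation extends from
    [dense_zero] to all vectors of mean zero. *)
Lemma avg_eq_psi t : 0 < t -> hder (A Sig t) (A Gam t + mu *: D psi t).
Proof.
move=> t0 w w0; rewrite dotDl dotZl opprD.
rewrite -[RHS]/(- (S (A Gam t) (J w)) - mu * S (D psi t) (J w)).
apply: (@eq_on_dense dense_zero (fun w => S (A Sig t) w)
  (fun w => - S (A Gam t) (J w) - mu * S (D psi t) (J w))).
- by move=> e e0; exact: dense_zeroP.
- exact: dot_lip.
- have [M hM] := lipD (-1) (- mu) (dot_ad_lip (A Gam t)) (dot_ad_lip (D psi t)).
  by exists M => y z; have := hM y z; rewrite !mulN1r !mulNr.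
move=> {w0} {}w Dw.
have h1 : antideriv (fun s => mu * S (psi s) (J w))
   (fun s => (-1) * S (Sig s) w + (-1) * S (Gam s) (J w)).
  by move=> u u0; have := ws_eq_psi HW u0 Dw; rewrite opprD !mulN1r.
have := avgsE k0 t0 h1; rewrite avgsD//; last 2 first.
- by move=> u u0; apply: continuousM; [exact: cvg_cst|exact: (good_dot gSig)].
- by move=> u u0; apply: continuousM; [exact: cvg_cst|exact: (good_dot gGam)].
rewrite !avgsZ//; try exact: good_dot.
rewrite -!(avg_dot HR)// /dq dotZl dotBl => e1.
have -> : mu * (k^-1 * (S (psi (t + k)) (J w) - S (psi t) (J w))) =
   (mu * S (psi (t + k)) (J w) - mu * S (psi t) (J w)) / k by ring.
lra.
Qed.

Lemma reg_eq_psi t : 0 < t -> hder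
  (rho2 *: D (D phi) t + alpha *: A (A psix) t + xi1 *: A (A th) t + xi2 *: A (A p) t)
  (kappa *: (A (A phix) t + A (A psi) t) + mu *: A (D psi) t).
Proof.
move=> t0.
have := hder_avg HR k0 t0 (gA gSig) (goodD (gA gGam) (goodZ mu (gD gpsi))) avg_eq_psi.
apply: hder_deq.
  have e1 u : 0 < u -> deq (A Sig u)
      ((rho2 *: A phitt u + alpha *: A psix u) + (xi1 *: A th u + xi2 *: A p u)).
    move=> u0; apply: deq_trans (avgD HR k0 u0 _ _) _.
    - by apply: goodD; exact: goodZ.
    - by apply: goodD; exact: goodZ.
    by apply: deqD; exact: avg_comb.
  have g1 : good (fun u => rho2 *: A phitt u + alpha *: A psix u).
    by apply: goodD; apply: goodZ; exact: gA.
  have g2 : good (fun u => xi1 *: A th u + xi2 *: A p u).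
    by apply: goodD; apply: goodZ; exact: gA.
  apply: deq_trans (eq_avg HR k0 t0 (gA gSig) (goodD g1 g2) e1) _.
  apply: deq_trans (avgD HR k0 t0 g1 g2) _; rewrite -[X in deq _ X]addrA.
  apply: deqD; last by apply: avg_comb => //; exact: gA.
  apply: deq_trans (avg_comb HR _ _ k0 t0 (gA gphitt) (gA gpsix)) _.
  by apply: deqD; [apply: deqZ; exact: AA_DD|exact: deq_refl].
apply: deq_trans (avgD HR k0 t0 (gA gGam) (goodZ mu (gD gpsi))) _.
apply: deqD; last exact: avgZ (gD gpsi).
have e1 u : 0 < u -> deq (A Gam u) (kappa *: (A phix u + A psi u)).
  move=> u0; apply: deq_trans (avgZ HR _ k0 u0 (goodD gphix gpsi)) _.
  by apply: deqZ; exact: avgD.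
have g1 : good (fun u => A phix u + A psi u) by apply: goodD; exact: gA.
apply: deq_trans (eq_avg HR k0 t0 (gA gGam) (goodZ kappa g1) e1) _.
apply: deq_trans (avgZ HR _ k0 t0 g1) _.
by apply: deqZ; apply: avgD => //; exact: gA.
Qed.

(** After one average the equation is continuous in the test vector and extends from [dense_all] to
    every [om]; a second average makes it the hypothesis of [hvan_heat], which yields q_x and the
    Dirichlet condition. *)
Lemma reg_eq_heat (a b m xi : R) (q : R -> H) : good q -> m != 0 ->
  (forall (t : R) w, 0 < t -> dense_all w -> is_derive t (1 : R)
      (fun s => S (a *: th s + b *: p s) (adc J (J w)) + xi * S (psi s) (center J (J w)))
      (m * S (q t) w)) ->
  forall t, 0 < t ->
  let g := a *: A (D th) t + b *: A (D p) t in
  let qx := m^-1 *: center J (J g - xi *: A (D psi) t) in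
  hvan (A (A q) t) qx /\ hder (m *: qx + xi *: A (D psi) t) g.
Proof.
move=> gq m0 hq t t0 g qx; apply: hvan_heat => // om.
have e1 u : 0 < u -> S (a *: D th u + b *: D p u) (adc J (J om))
    + xi * S (D psi u) (center J (J om)) = m * S (A q u) om.
  move=> u0.
  (* [J] and the centring are moved off [om], and the right side is padded with a zero term, so that
     both sides have the form for which [lipD] gives Lipschitz dependence on [om]. *)
  have ca x y : S x (adc J (J y)) = - S (center J (J x)) (J y).
    by rewrite dotC adc_dot dotC.
  have -> : S (a *: D th u + b *: D p u) (adc J (J om)) + xi * S (D psi u) (center J (J om)) =
     (-1) * S (center J (J (a *: D th u + b *: D p u))) (J om) + xi * S (center J (D psi u)) (J om).
    by rewrite mulN1r ca (center_sym J (D psi u)).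
  have -> : m * S (A q u) om = m * S (A q u) om + 0 * S (A q u) om by rewrite mul0r addr0.
  apply: (@eq_on_dense dense_all
    (fun om => (-1) * S (center J (J (a *: D th u + b *: D p u))) (J om) + xi * S (center J (D psi u)) (J om))
    (fun om => m * S (A q u) om + 0 * S (A q u) om)).
  - by move=> e e0; exact: dense_allP.
  - by apply: lipD; exact: dot_ad_lip.
  - by apply: lipD; exact: dot_lip.
  move=> {}om Dom.
  have := avgsE k0 u0 (fun u u0 => hq u om u0 Dom).
  rewrite avgsZ//; last exact: good_dot.
  rewrite -(avg_dot HR)// => ->.
  rewrite mul0r addr0 mulN1r -ca (center_sym J (D psi u)) /dq !dotDl !dotZl !dotBl.
  by field; rewrite gt_eqF.
have gg : good (fun u => a *: D th u + b *: D p u) by apply: goodD; apply: goodZ; exact: gD.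
have := @eq_avgs _ k (fun u => S (a *: D th u + b *: D p u) (adc J (J om))
    + xi * S (D psi u) (center J (J om))) _ t k0 t0 _ e1.
rewrite avgsZ//; last exact/good_dot/gA.
rewrite -(avg_dot HR)//; last exact: gA.
move=> <-; last first.
  move=> u u0; apply: continuousD; first exact: (good_dot gg).
  by apply: continuousM; [exact: cvg_cst|exact: (good_dot (gD gpsi))].
rewrite avgsD//; last 2 first.
- exact: good_dot.
- by move=> u u0; apply: continuousM; [exact: cvg_cst|exact: (good_dot (gD gpsi))].
rewrite avgsZ//; last exact/good_dot/gD.
rewrite -!(avg_dot HR)//; last exact: gD.
by congr (_ + _); rewrite (avg_comb HR a b k0 t0 (gD gth) (gD gp)).
Qed.

Lemma strong_regularized :
  strong_solution J rho1 rho2 kappa alpha h c r mu d xi1 xi2 regularized.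
Proof.
have kn0 : kappa != 0 by rewrite gt_eqF.
have hn0 : h != 0 by rewrite gt_eqF.
have hth := reg_eq_heat gth kn0 (ws_eq_th HW).
have hp := reg_eq_heat gp hn0 (ws_eq_p HW).
have C1 x : good x -> C1curve S (A (A x)) (A (D x)).
  move=> gx; split; last by have [] := gA (gD gx).
  apply: wderiv_deq (ADw (gA gx)) _ => t t0; apply: deq_sym.
  exact: avg_deriv (gD gx) (ADw gx).
have C2 x : good x -> C1curve S (A (D x)) (D (D x)).
  by move=> gx; split; [exact: ADw (gD gx)|have [] := gD (gD gx)].
split => /=.
- move=> t t0; split => /=.
  + by apply: hvan_avg => //; try exact: gA; move=> s s0; apply: hvan_avg => //; exact: ws_phi HW.
  + apply: hvan_avg => //; try exact: gD; move=> s s0; apply: hvan_dq => //; exact: ws_phi HW.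
  + apply: hvan_dq => // s s0; apply: hvan_dq => //; exact: ws_phi HW.
  + by apply: hvan_avg => //; try exact: gA; move=> s s0; apply: hvan_avg => //; exact: ws_psi HW.
  + apply: hvan_avg => //; try exact: gD; move=> s s0; apply: hvan_dq => //; exact: ws_psi HW.
  + by have [] := hth t t0.
  + by have [] := hp t t0.
  + exact: reg_eq_phi.
  + exact: reg_eq_phit.
  + exact: reg_eq_psi.
  + by have [] := hth t t0.
  + by have [] := hp t t0.
- exact: C1.
- exact: C1.
- exact: C2.
- exact: C2.
- split; first exact: wderiv_dq k0 (wderiv_dq k0 (ws_phit HW)).
  by have [] := gD (gD gphit).
- exact: C1.
- exact: C1.
- exact: C1.
- exact: C1.
Qed.

End Regularized.

(** * Passage to the limit in the averaging length *)

Section Limit.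
Context (phi phix phit phitt psi psix th p : R -> H)
  (HW : weak_solution phi phix phit phitt psi psix th p).

Local Notation reg k := (regularized phi phix phit psi psix th p k).
Local Notation En := (nrj S rho1 rho2 kappa alpha c r d).

Lemma AA_le x (M k s : R) : good x -> (forall t, 0 < t <= 1 -> nrm S (x t) <= M) ->
  0 < k <= 1 / 4 -> 0 < s <= 1 / 2 -> nrm S (avg k (avg k x) s) <= M.
Proof.
move=> gx hM /andP[k0 k1] /andP[s0 s1].
apply: (avg_le HR) => //; first exact: good_avg.
move=> u /andP[u1 u2]; have u0 := lt_le_trans s0 u1; apply: (avg_le HR) => //.
move=> y /andP[y1 y2]; apply: hM; apply/andP; split; lra.
Qed.

Lemma sq_le_of_nrm (x : H) (M : R) : nrm S x <= M -> sq S x <= M ^+ 2.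
Proof.
move=> h1; have M0 := le_trans (nrm_ge0 S x) h1.
by rewrite /sq nrmE ler_pXn2r ?nnegrE ?nrm_ge0.
Qed.

(** The energy contains neither psi_t nor theta_x nor P_x; its term in phi_tx is an average of
    difference quotients of phix, bounded by the Lipschitz constant [ws_lip]. The ranges of k and s
    keep the double window, of length 2k, within ]0, 1]. *)
Lemma reg_energy_bounded : exists2 K : R, 0 <= K & forall k s : R,
  0 < k <= 1 / 4 -> 0 < s <= 1 / 2 -> En (reg k s) <= K.
Proof.
case: (HW) => gphi gphix gphit gphitt gpsi gpsix gth gp h1 h2 h3 h4 [L hL] h6 h7 h8 h9.
have [_ /(_ 1) [M1 m1]] := gphix; have [_ /(_ 1) [M2 m2]] := gphit.
have [_ /(_ 1) [M3 m3]] := gphitt; have [_ /(_ 1) [M4 m4]] := gpsi.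
have [_ /(_ 1) [M5 m5]] := gpsix; have [_ /(_ 1) [M6 m6]] := gth.
have [_ /(_ 1) [M7 m7]] := gp.
exists `|2^-1 * (rho1 * M2 ^+ 2 + rho1 * rho2 / kappa * M3 ^+ 2 + rho2 * L ^+ 2
  + kappa * (2 * M1 ^+ 2 + 2 * M4 ^+ 2) + alpha * M5 ^+ 2
  + (`|c| * M6 ^+ 2 + `|2 * d| * (M6 ^+ 2 + M7 ^+ 2) + `|r| * M7 ^+ 2))| => //.
move=> k s k1 s1; case/andP: (k1) => k0 _; case/andP: (s1) => s0 _.
have b2 : sq S (avg k (dq k phi) s) <= M2 ^+ 2.
  have e := AA_AD HW k0 s0; rewrite /sq -e dotC -e; apply: sq_le_of_nrm.
  exact: AA_le.
have b3 : sq S (dq k (dq k phi) s) <= M3 ^+ 2.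
  have e := AA_DD HW k0 s0; rewrite /sq -e dotC -e; apply: sq_le_of_nrm.
  exact: AA_le.
have bL : sq S (avg k (dq k phix) s) <= L ^+ 2.
  apply: sq_le_of_nrm; apply: (avg_le HR) => //; first exact: good_dq.
  by move=> u /andP[u1 _]; apply: dq_le => //; exact: lt_le_trans u1.
have b1 := sq_le_of_nrm (AA_le gphix m1 k1 s1); have b4 := sq_le_of_nrm (AA_le gpsi m4 k1 s1).
have b5 := sq_le_of_nrm (AA_le gpsix m5 k1 s1); have b6 := sq_le_of_nrm (AA_le gth m6 k1 s1).
have b7 := sq_le_of_nrm (AA_le gp m7 k1 s1).
apply: le_trans (ler_norm _).
rewrite /nrj ler_pM2l ?invr_gt0//= /thermal /=.
have q1 (a a' x y : R) : 0 <= x -> a <= a' -> x <= y -> 0 <= a' -> a * x <= a' * y.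
  by move=> x0 aa xy a0; apply: le_trans (ler_wpM2r x0 aa) _; rewrite ler_wpM2l.
have cs : 2 * d * S (avg k (avg k th) s) (avg k (avg k p) s) <= `|2 * d| * (M6 ^+ 2 + M7 ^+ 2).
  apply: le_trans (ler_norm _) _; rewrite normrM ler_wpM2l//.
  apply: le_trans (young_abs _ _ _ ltr01) _; rewrite mul1r lerD//.
  by apply: le_trans b7; rewrite ler_piMl ?dot_ge0// mulr1 invf_le1 ?ltr0n// ler1n.
have bs := dot_sqrD S (avg k (avg k phix) s) (avg k (avg k psi) s).
rewrite !lerD//.
- by rewrite ler_pM2l.
- by rewrite ler_wpM2l// !mulr_ge0 ?invr_ge0// ltW.
- by rewrite ler_pM2l.
- rewrite ler_pM2l//; apply: le_trans bs _; rewrite lerD// ler_pM2l//.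
- by rewrite ler_pM2l.
- by apply: q1; rewrite ?dot_ge0 ?ler_norm.
- by apply: q1; rewrite ?dot_ge0 ?ler_norm.
Qed.

(** Weak lower semicontinuity of the norm: the double averages converge weakly to [x t], and are
    paired with [x t] itself. *)
Lemma weak_limit_sq x (t K : R) : good x -> 0 < t -> 0 <= K ->
  (exists2 e : R, 0 < e & forall k, 0 < k < e -> sq S (avg k (avg k x) t) <= K) ->
  sq S (x t) <= K.
Proof.
move=> gx t0 K0 [e e0 he].
have hK k : 0 < k < e -> nrm S (avg k (avg k x) t) <= Num.sqrt K.
  by move=> /he hh; exact: ler_wsqrtr.
suff : nrm S (x t) <= Num.sqrt K.
  by move=> /sq_le_of_nrm; rewrite sqr_sqrtr.
apply: nrm_le_of_dot; first exact: sqrtr_ge0.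
apply/ler_addgt0Pr => y y0.
have [r' r'0 hr'] := avg2_near HR (x t) gx t0 y0.
pose k := Num.min (r' / 2) (e / 2).
have k0 : 0 < k by rewrite lt_min !divr_gt0.
have kr : k < r' by rewrite /k gt_min; apply/orP; left; lra.
have ke : k < e by rewrite /k gt_min; apply/orP; right; lra.
have := hr' k; rewrite k0 kr => /(_ isT); rewrite ler_norml => /andP[h1 _].
have := le_trans (ler_norm _) (cauchy_schwarz S (avg k (avg k x) t) (x t)).
have := hK k; rewrite k0 ke => /(_ isT) h2.
have := ler_wpM2r (nrm_ge0 S (x t)) h2; lra.
Qed.

(** For phi_tx the bound concerns every weak derivative [y] of [phit t]: [phit t] is known to be in
    H^1_0 only for almost every t, and the abstract weak solution carries no curve of its
    derivatives. *)
Lemma weak_decay : exists C l : R, [/\ 0 <= C, 0 < l & forall t : R, 0 < t ->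
  let b := C * expR (- l * t) in
  [/\ sq S (phit t) <= b, sq S (phitt t) <= b, sq S (phix t + psi t) <= b,
      sq S (psix t) <= b & [/\ sq S (th t) <= b,
      sq S (Num.sqrt r *: p t + (d / Num.sqrt r) *: th t) <= b &
      forall y, hder (phit t) y -> sq S y <= b]]].
Proof.
case: (HW) => gphi gphix gphit gphitt gpsi gpsix gth gp h1 h2 h3 h4 _ h6 h7 h8 h9.
have [C [l [C0 l0 hC]]] := strong_decay J xi1 xi2 rho1_gt0 rho2_gt0
  kappa_gt0 alpha_gt0 h_gt0 r_gt0 mu_gt0 crd_gt0.
have [K K0 hK] := reg_energy_bounded.
have cd0 : 0 < c - d ^+ 2 / r by rewrite subr_gt0 ltr_pdivrMr// -subr_gt0.
(* Twice the energy is a sum of seven weighted squares; [B] exceeds 2 divided by each weight, the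
   last weight being 1. *)
pose B := 2 / rho1 + 2 / (rho1 * rho2 / kappa) + 2 / rho2 + 2 / kappa + 2 / alpha
  + (2 / (c - d ^+ 2 / r) + 2).
have p1 : 0 < 2 / rho1 by rewrite divr_gt0.
have p2 : 0 < 2 / (rho1 * rho2 / kappa) by rewrite !divr_gt0// mulr_gt0.
have p3 : 0 < 2 / rho2 by rewrite divr_gt0.
have p4 : 0 < 2 / kappa by rewrite divr_gt0.
have p5 : 0 < 2 / alpha by rewrite divr_gt0.
have p6 : 0 < 2 / (c - d ^+ 2 / r) by rewrite divr_gt0.
have [B1 B2 B3 B4 [B5 B6 B7]] := summands_le (ltW p1) (ltW p2) (ltW p3) (ltW p4) (ltW p5)
  (ltW p6) (ler0n R 2).
have B0 : 0 < B by apply: lt_le_trans B1.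
exists (B * (C * K) * expR l), l; split => //.
  by rewrite !mulr_ge0 ?expR_ge0// ltW.
move=> t t0 b.
have b0 : 0 <= b by rewrite !mulr_ge0 ?expR_ge0// ltW.
have hE k : 0 < k < 1 / 4 -> B * En (reg k t) <= b.
  move=> /andP[k0 k1]; rewrite /b; apply: (expR_decay_limit _ l0 t0).
    by rewrite !mulr_ge0// ltW.
  move=> s s0 st s1; rewrite -mulrA ler_pM2l//.
  apply: le_trans (hC _ s t (strong_regularized HW k0) s0 (ltW st)) _.
  rewrite mulrAC ler_wpM2r ?expR_ge0// ler_pM2l//.
  by apply: hK; rewrite ?k0 ?s0//= ltW.
have hN (k a : R) (x : H) : 0 < k < 1 / 4 -> 0 < a -> 2 / a <= B ->
    a * sq S x <= 2 * En (reg k t) -> sq S x <= b.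
  move=> hk a0 aB ax; apply: le_trans (hE k hk).
  have : 0 <= En (reg k t) by exact: nrj_ge0.
  move=> /ler_wpM2r /(_ _ _ aB); apply: le_trans.
  by rewrite mulrAC ler_pdivlMr// mulrC.
have cmp (k : R) : 0 < k < 1 / 4 ->
  [/\ sq S (avg k (dq k phi) t) <= b, sq S (dq k (dq k phi) t) <= b,
      sq S (avg k (dq k phix) t) <= b,
      sq S (avg k (avg k phix) t + avg k (avg k psi) t) <= b &
   [/\ sq S (avg k (avg k psix) t) <= b, sq S (avg k (avg k th) t) <= b &
    sq S (Num.sqrt r *: avg k (avg k p) t + (d / Num.sqrt r) *: avg k (avg k th) t) <= b]].
  move=> hk.
  pose u := reg k t.
  have q1 : 0 <= rho1 * sq S (avg k (dq k phi) t) by rewrite mulr_ge0 ?sq_ge0 ?ltW.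
  have q2 : 0 <= rho1 * rho2 / kappa * sq S (dq k (dq k phi) t).
    by rewrite mulr_ge0 ?sq_ge0// mulr_ge0 ?invr_ge0 ?mulr_ge0// ltW.
  have q3 : 0 <= rho2 * sq S (avg k (dq k phix) t) by rewrite mulr_ge0 ?sq_ge0 ?ltW.
  have q4 : 0 <= kappa * sq S (avg k (avg k phix) t + avg k (avg k psi) t).
    by rewrite mulr_ge0 ?sq_ge0 ?ltW.
  have q5 : 0 <= alpha * sq S (avg k (avg k psix) t) by rewrite mulr_ge0 ?sq_ge0 ?ltW.
  have q6 : 0 <= (c - d ^+ 2 / r) * sq S (avg k (avg k th) t).
    by rewrite mulr_ge0 ?sq_ge0 ?ltW.
  have q7 := sq_ge0 S (Num.sqrt r *: avg k (avg k p) t + (d / Num.sqrt r) *: avg k (avg k th) t).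
  have eE : 2 * En u = rho1 * sq S (avg k (dq k phi) t)
     + rho1 * rho2 / kappa * sq S (dq k (dq k phi) t)
     + rho2 * sq S (avg k (dq k phix) t)
     + kappa * sq S (avg k (avg k phix) t + avg k (avg k psi) t)
     + alpha * sq S (avg k (avg k psix) t)
     + ((c - d ^+ 2 / r) * sq S (avg k (avg k th) t)
     + sq S (Num.sqrt r *: avg k (avg k p) t + (d / Num.sqrt r) *: avg k (avg k th) t)).
    by rewrite /nrj thermalE// mulrA divff ?pnatr_eq0// mul1r.
  have [w1 w2 w3 w4 [w5 w6 w7]] := summands_le q1 q2 q3 q4 q5 q6 q7.
  rewrite -eE in w1 w2 w3 w4 w5 w6 w7.
  split; [exact: (hN k rho1)|apply: (hN k (rho1 * rho2 / kappa)) => //|exact: (hN k rho2)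
    |exact: (hN k kappa)|split; [exact: (hN k alpha)|exact: (hN k (c - d ^+ 2 / r))|]].
    by rewrite divr_gt0// mulr_gt0.
  by apply: (hN k 1) => //; rewrite ?mul1r ?divr1.
have e4 : 0 < (1 / 4 : R) by rewrite divr_gt0.
have sqd (x y : H) : deq x y -> sq S x = sq S y by move=> e; rewrite /sq e dotC e.
split.
- apply: weak_limit_sq => //; exists (1 / 4) => // k hk; case/andP: (hk) => k0 _.
  by rewrite (sqd _ _ (AA_AD HW k0 t0)); have [] := cmp k hk.
- apply: weak_limit_sq => //; exists (1 / 4) => // k hk; case/andP: (hk) => k0 _.
  by rewrite (sqd _ _ (AA_DD HW k0 t0)); have [] := cmp k hk.
- apply: (@weak_limit_sq (fun s => phix s + psi s)) => //; first exact: goodD.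
  exists (1 / 4) => // k hk; case/andP: (hk) => k0 _.
  suff e : deq (avg k (avg k (fun s => phix s + psi s)) t)
     (avg k (avg k phix) t + avg k (avg k psi) t) by rewrite (sqd _ _ e); have [] := cmp k hk.
  have ga x (gx : good x) := good_avg HR k0 gx.
  have e1 u : 0 < u -> deq (avg k (fun s => phix s + psi s) u) (avg k phix u + avg k psi u).
    by move=> u0; exact: avgD.
  apply: deq_trans (eq_avg HR k0 t0 (ga _ (goodD gphix gpsi)) (goodD (ga _ gphix) (ga _ gpsi)) e1) _.
  by apply: avgD => //; exact: ga.
- apply: weak_limit_sq => //; exists (1 / 4) => // k hk.
  by have [_ _ _ _ []] := cmp k hk.
split.
- apply: weak_limit_sq => //; exists (1 / 4) => // k hk.
  by have [_ _ _ _ []] := cmp k hk.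
- pose y s := Num.sqrt r *: p s + (d / Num.sqrt r) *: th s.
  have gy : good y by apply: goodD; exact: goodZ.
  apply: (@weak_limit_sq y) => //.
  exists (1 / 4) => // k hk; case/andP: (hk) => k0 _.
  suff e : deq (avg k (avg k y) t) (Num.sqrt r *: avg k (avg k p) t
     + (d / Num.sqrt r) *: avg k (avg k th) t).
    by rewrite (sqd _ _ e); have [_ _ _ _ []] := cmp k hk.
  have ga x (gx : good x) := good_avg HR k0 gx.
  have e1 u : 0 < u -> deq (avg k y u) (Num.sqrt r *: avg k p u + (d / Num.sqrt r) *: avg k th u).
    by move=> u0; exact: avg_comb.
  apply: deq_trans (eq_avg HR k0 t0 (ga _ gy) (goodD (goodZ _ (ga _ gp)) (goodZ _ (ga _ gth))) e1) _.
  by apply: avg_comb => //; exact: ga.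
move=> y hy; suff /sq_le_of_nrm : nrm S y <= Num.sqrt b by rewrite sqr_sqrtr.
apply: (@dense_bound _ _ _ J); first exact: sqrtr_ge0.
move=> om om0; apply/ler_addgt0Pr => e e0.
(* In this form the pairing no longer involves [y] and is a limit of pairings of the averaged phi_tx
   with [J om]; such [J om] are dense. *)
have -> : S y (J om) = - S (phit t) om by rewrite hy// opprK.
have [r' r'0 hr'] := avg2_near HR om gphit t0 e0.
pose k := Num.min (r' / 2) (1 / 8).
have k0 : 0 < k by rewrite lt_min !divr_gt0.
have kr : k < r' by rewrite /k gt_min; apply/orP; left; lra.
have ke : k < 1 / 4 by rewrite /k gt_min; apply/orP; right; lra.
have := hr' k; rewrite k0 kr => /(_ isT); rewrite (AA_AD HW k0 t0) ler_norml => /andP[_ u1].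
have [_ hvx] : hvan (avg k (dq k phi) t) (avg k (dq k phix) t).
  by apply: hvan_avg => //; try exact: good_dq; move=> s s0; apply: hvan_dq.
have := hvx om.
have := le_trans (ler_norm _) (cauchy_schwarz S (avg k (dq k phix) t) (J om)).
have : nrm S (avg k (dq k phix) t) <= Num.sqrt b.
  by have := cmp k; rewrite k0 ke => /(_ isT) [_ _ w _ _]; rewrite /nrm ler_wsqrtr.
move=> /(ler_wpM2r (nrm_ge0 S (J om))); lra.
Qed.

End Limit.
End WeakSolutions.

(** * The space of square-integrable functions on an interval *)

Section SquareIntegrable.
Context {R : realType} (a b : R).
Implicit Types (f g u v : R -> R).

Local Notation D := (`]a, b[%classic : set R).
Local Notation leb := (@lebesgue_measure R).

(** On ]0, L[ this is [L2 L] by conversion. The interval is arbitrary because the same space is used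
    in x and, on intervals ]a, b[ with a > 0, in t. *)
Definition sqint : set (R -> R) := [set u : R -> R |
  measurable_fun D u /\ leb.-integrable D (EFin \o (fun x : R => u x ^+ 2))].

Lemma measurable_D : measurable (D : set (g_sigma_algebraType (R.-ocitv.-measurable))).
Proof. exact: measurable_itv. Qed.
Local Hint Resolve measurable_D : core.

Lemma lebesgue_D_lty : (leb D < +oo)%E.
Proof. by rewrite lebesgue_measure_itv/=; case: ifP => _; rewrite ltry. Qed.

Definition intg f := leb.-integrable D (EFin \o f).

Lemma eq_intg f g : (forall x, D x -> f x = g x) -> intg f -> intg g.
Proof.
by move=> fg; apply: eq_integrable => // x; rewrite inE => Dx /=; rewrite fg.
Qed.

Lemma intgD f g : intg f -> intg g -> intg (fun x => f x + g x).
Proof. by move=> hf hg; have := integrableD measurable_D hf hg; apply: eq_integrable. Qed.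

Lemma intgZ (k : R) f : intg f -> intg (fun x => k * f x).
Proof. by move=> hf; have := integrableZl measurable_D k hf; apply: eq_integrable. Qed.

Lemma le_intg f g : measurable_fun D f -> (forall x, D x -> `|f x| <= g x) -> intg g -> intg f.
Proof.
move=> mf fg; apply: le_integrable => //; first exact/measurable_EFinP.
by move=> x Dx /=; rewrite lee_fin; apply: le_trans (fg x Dx) _; exact: ler_norm.
Qed.

Lemma sqint_mul u v : sqint u -> sqint v -> leb.-integrable D (EFin \o (fun x => u x * v x)).
Proof.
move=> [mu iu] [mv iv].
apply: (@le_intg _ (fun x => u x ^+ 2 + v x ^+ 2)); last exact: intgD.
  exact: measurable_funM.
move=> x _; rewrite ler_norml.
have h1 := sqr_ge0 (u x - v x); have h2 := sqr_ge0 (u x + v x).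
have h3 := sqr_ge0 (u x); have h4 := sqr_ge0 (v x).
by apply/andP; split; lra.
Qed.

Lemma sqint_bounded u (M : R) : measurable_fun D u -> (forall x, D x -> `|u x| <= M) -> sqint u.
Proof.
move=> mu uM; split => //.
apply: measurable_bounded_integrable => //; first exact: lebesgue_D_lty.
  by apply: measurable_funX.
exists (M ^+ 2); split; first exact: num_real.
move=> y My x Dx; apply: le_trans (ltW My); rewrite normrX.
have h := uM x Dx; rewrite ler_pXn2r ?nnegrE//.
by apply: le_trans h; exact: normr_ge0.
Qed.

Lemma sqint_cst (k : R) : sqint (fun=> k).
Proof. by apply: (@sqint_bounded _ `|k|) => // x _. Qed.

Lemma sqintZ (k : R) u : sqint u -> sqint (fun x => k * u x).
Proof.
move=> [mu iu]; split; first exact: measurable_funM.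
by apply: eq_intg (intgZ (k ^+ 2) iu) => x _; rewrite exprMn.
Qed.

Lemma sqintD u v : sqint u -> sqint v -> sqint (fun x => u x + v x).
Proof.
move=> hu hv; have [mu iu] := hu; have [mv iv] := hv; split; first exact: measurable_funD.
apply: eq_intg (intgD (intgD iu iv) (intgZ 2 (sqint_mul hu hv))) => x _; ring.
Qed.

Lemma sqint_integrable u : sqint u -> leb.-integrable D (EFin \o u).
Proof.
by move=> hu; apply: eq_intg (sqint_mul hu (sqint_cst 1)) => x _; rewrite mulr1.
Qed.

Definition sqint_pred : {pred R -> R} := fun u => `[< sqint u >].

Lemma sqint_predP u : reflect (sqint u) (u \in sqint_pred).
Proof. exact: asboolP. Qed.

Lemma sqint_submod_closed : submod_closed sqint_pred.
Proof.
split; first by apply/sqint_predP; exact: sqint_cst.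
move=> k u v /sqint_predP hu /sqint_predP hv; apply/sqint_predP.
exact: sqintD (sqintZ k hu) hv.
Qed.

HB.instance Definition _ := GRing.isSubmodClosed.Build R (R -> R) sqint_pred sqint_submod_closed.

Record l2fun := L2fun { l2val :> R -> R; _ : l2val \in sqint_pred }.
HB.instance Definition _ := [isSub for l2val].
HB.instance Definition _ := [Choice of l2fun by <:].
HB.instance Definition _ := [SubChoice_isSubLmodule of l2fun by <:].

Lemma l2P (f : l2fun) : sqint f.
Proof. by apply/sqint_predP; case: f. Qed.

(** The value is 0 when [u] is not square integrable. *)
Definition mkl2 u : l2fun := insubd 0 u.

Lemma mkl2K u : sqint u -> mkl2 u = u :> (R -> R).
Proof. by move=> /sqint_predP hu; rewrite /mkl2 insubdK. Qed.

Lemma l2DE (f g : l2fun) x : (f + g) x = f x + g x. Proof. by []. Qed.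
Lemma l2ZE (k : R) (f : l2fun) x : (k *: f) x = k * f x. Proof. by []. Qed.
Lemma l2BE (f g : l2fun) x : (f - g) x = f x - g x. Proof. by []. Qed.

Definition l2dot_fun (f g : l2fun) : R := \int[leb]_(x in D) (f x * g x).

Lemma l2dot_subproof :
  (forall f g : l2fun, l2dot_fun f g = l2dot_fun g f) /\
  (forall f g h : l2fun, l2dot_fun (f + g) h = l2dot_fun f h + l2dot_fun g h) /\
  (forall (k : R) (f g : l2fun), l2dot_fun (k *: f) g = k * l2dot_fun f g) /\
  (forall f : l2fun, 0 <= l2dot_fun f f).
Proof.
split; first by move=> f g; apply: eq_Rintegral => x _; rewrite mulrC.
split.
  move=> f g h; rewrite /l2dot_fun -RintegralD//; last 2 first.
  - exact: sqint_mul (l2P f) (l2P h).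
  - exact: sqint_mul (l2P g) (l2P h).
  by apply: eq_Rintegral => x _; rewrite l2DE mulrDl.
split.
  move=> k f g; rewrite /l2dot_fun -RintegralZl//; last exact: sqint_mul (l2P f) (l2P g).
  by apply: eq_Rintegral => x _; rewrite l2ZE mulrA.
by move=> f; apply: Rintegral_ge0 => x _; rewrite -expr2 sqr_ge0.
Qed.

Definition l2dot : inner_product l2fun :=
  InnerProduct l2dot_subproof.1 l2dot_subproof.2.1 l2dot_subproof.2.2.1 l2dot_subproof.2.2.2.

Lemma l2dotE (f g : l2fun) : l2dot f g = \int[leb]_(x in D) (f x * g x).
Proof. by []. Qed.

Lemma l2_ae_eq (f g h : l2fun) : {ae leb, forall x, D x -> f x = g x} -> l2dot f h = l2dot g h.
Proof.
move=> fg; congr fine; apply: ae_eq_integral => //.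
- by apply: measurable_int (sqint_mul (l2P f) (l2P h)).
- by apply: measurable_int (sqint_mul (l2P g) (l2P h)).
by apply: (@filterS _ _ (ae_filter_ringOfSetsType leb) _ _ _ fg) => x e Dx /=; rewrite e.
Qed.

End SquareIntegrable.

(** * Completeness of L^2 *)

Section Completeness.
Context {R : realType} (a b : R).

Local Notation D := (`]a, b[%classic : set R).
Local Notation leb := (@lebesgue_measure R).
Local Notation S := (l2dot a b).
Local Notation H := (l2fun a b).
Local Hint Resolve measurable_D : core.


Lemma integral_sq (f : H) : (\int[leb]_(x in D) (f x ^+ 2)%:E = (S f f)%:E)%E.
Proof.
rewrite l2dotE /Rintegral fineK; last exact: integrable_fin_num (sqint_mul (l2P f) (l2P f)).
by apply: eq_integral => x _; rewrite expr2.
Qed.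

Lemma l2_abs (f : H) : sqint a b (fun x => `|f x|).
Proof.
have [mf if2] := l2P f; split; first exact: measurableT_comp.
by apply: eq_intg if2 => x _; rewrite real_normK ?num_real.
Qed.

Lemma nrm_abs (f : H) : nrm S (mkl2 a b (fun x => `|f x|)) = nrm S f.
Proof.
rewrite /nrm !l2dotE mkl2K; last exact: l2_abs.
by congr Num.sqrt; apply: eq_Rintegral => x _; rewrite -!expr2 real_normK ?num_real.
Qed.

(* Riesz-Fischer: a sequence with summable increments converges almost
   everywhere, and Fatou's lemma bounds the distance to the limit. *)
Lemma l2_complete_fast (u : nat -> H) :
  (forall n, nrm S (u n.+1 - u n) <= 2^-1 ^+ n) ->
  exists f, forall n, nrm S (f - u n) <= 2 * 2^-1 ^+ n.
Proof.
move=> hu.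
have geo n m : \sum_(n <= k < n + m) 2^-1 ^+ k <= 2 * 2^-1 ^+ n :> R.
  have -> : \sum_(n <= k < n + m) 2^-1 ^+ k = 2 * (2^-1 ^+ n - 2^-1 ^+ (n + m)) :> R.
    elim: m => [|m IH]; first by rewrite addn0 big_geq// subrr mulr0.
    rewrite addnS big_nat_recr ?leq_addr//= IH exprS; by field.
  by rewrite ler_pM2l// gerBl exprn_ge0// invr_ge0.
have dist n m : nrm S (u (n + m)%N - u n) <= 2 * 2^-1 ^+ n.
  apply: le_trans (geo n m); elim: m => [|m IH].
    by rewrite addn0 subrr big_geq// /nrm dot0l sqrtr0.
  rewrite addnS big_nat_recr ?leq_addr//=.
  have -> : u (n + m).+1 - u n = (u (n + m)%N - u n) + (u (n + m).+1 - u (n + m)%N).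
    by rewrite [RHS]addrC addrA subrK.
  by apply: le_trans (nrmD _ _ _) _; exact: lerD.
pose g (n : nat) : H := \sum_(0 <= k < n) mkl2 a b (fun x => `|(u k.+1 - u k) x|).
have gE n x : g n x = \sum_(0 <= k < n) `|(u k.+1 - u k) x|.
  elim: n => [|n IH]; first by rewrite /g !big_geq.
  rewrite big_nat_recr//= -IH.
  transitivity (g n x + mkl2 a b (fun x => `|(u n.+1 - u n) x|) x).
    by rewrite /g big_nat_recr.
  rewrite mkl2K//; exact: l2_abs.
have gn n : nrm S (g n) <= 2.
  apply: (@le_trans _ _ (\sum_(0 <= k < n) 2^-1 ^+ k)).
    elim: n => [|n IH]; first by rewrite /g !big_geq// /nrm dot0l sqrtr0.
    rewrite /g !big_nat_recr//= -/(g n); apply: le_trans (nrmD _ _ _) _.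
    by apply: lerD => //; apply: le_trans (hu n); rewrite -(nrm_abs (u n.+1 - u n)).
  by have := geo 0%N n; rewrite add0n expr0 mulr1.
have g_nd x : nondecreasing_seq (fun n => g n x).
  by apply/nondecreasing_seqP => n; rewrite !gE big_nat_recr//= lerDl.
have g_ge0 n x : 0 <= g n x by rewrite gE sumr_ge0.
(* The partial sums [g n] of the absolute increments are bounded in L^2, so by monotone convergence
   the limit of their squares is integrable, hence finite almost everywhere; there the series of
   increments converges absolutely. *)
pose G x := limn (fun n => (g n x ^+ 2)%:E).
have G_nd x : nondecreasing_seq (fun n => (g n x ^+ 2)%:E).
  by move=> n m nm; rewrite lee_fin ler_pXn2r ?nnegrE ?g_ge0// g_nd.
have G_cvg x : cvgn (fun n => (g n x ^+ 2)%:E) by exact: ereal_nondecreasing_is_cvgn.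
have G_lim x : (fun n => (g n x ^+ 2)%:E) @ \oo --> G x.
  by have /cvg_ex[l hl] := G_cvg x; rewrite /G (cvg_lim _ hl).
have mg2 n : measurable_fun D (fun x => (g n x ^+ 2)%:E).
  by apply/measurable_EFinP; apply: measurable_funX; exact: (l2P (g n)).1.
have IG : (\int[leb]_(x in D) G x <= 4%:E)%E.
  rewrite monotone_convergence//; last by move=> n x _; rewrite lee_fin sqr_ge0.
  apply: lime_le.
    apply: ereal_nondecreasing_is_cvgn => n m nm; apply: ge0_le_integral => //;
      do ?[by move=> x _; rewrite lee_fin sqr_ge0]; try exact: mg2.
    by move=> x _; exact: G_nd.
  apply: nearW => n; rewrite integral_sq lee_fin nrmE.
  by rewrite (_ : 4 = 2 ^+ 2 :> R) ?ler_pXn2r ?nnegrE ?nrm_ge0//; ring.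
have mG : measurable_fun D G by exact: emeasurable_fun_cvg mg2 (fun x _ => G_lim x).
have G_ge0 x : (0 <= G x)%E.
  by apply: lime_ge => //; apply: nearW => n; rewrite lee_fin sqr_ge0.
have iG : leb.-integrable D G.
  apply/integrableP; split => //.
  have -> : (\int[leb]_(x in D) `|G x| = \int[leb]_(x in D) G x)%E.
    by apply: eq_integral => x _; rewrite gee0_abs.
  by apply: le_lt_trans IG _; exact: ltry.
have aefin := integrable_ae (@measurable_D R a b) iG.
have cvu x : G x \is a fin_num -> cvgn (fun n => u n x).
  move=> Gx; pose dlt n := (u n.+1 - u n) x.
  have ngE : [normed series dlt] = (fun n => g n x) by apply/funext => n; rewrite gE.
  have : cvgn [normed series dlt].
    rewrite ngE; apply: nondecreasing_is_cvgn; first exact: g_nd.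
    exists (fine (G x) + 1) => _ [n _ <-].
    have h1 : ((g n x ^+ 2)%:E <= G x)%E.
      have -> : G x = ereal_sup (range (fun n => (g n x ^+ 2)%:E)).
        by apply/cvg_lim => //; exact: ereal_nondecreasing_cvgn.
      by apply: ereal_sup_ubound; exists n.
    rewrite -(fineK Gx) lee_fin in h1.
    have := sqr_ge0 (g n x - 1); have := g_ge0 n x; lra.
  move/normed_cvg => cs.
  have -> : (fun n => u n x) = (fun n => series dlt n + u 0%N x).
    have sE n : series dlt n = \sum_(0 <= k < n) dlt k by [].
    apply/funext => n; elim: n => [|n IH]; first by rewrite sE big_geq// add0r.
    rewrite sE big_nat_recr//= -sE addrAC -IH.
    by rewrite [dlt n]/(u n.+1 x - u n x) addrC subrK.
  by apply: is_cvgD => //; exact: is_cvg_cst.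
case: aefin => N [mN N0 hN].
have DN x : D x -> ~ N x -> G x \is a fin_num.
  by move=> Dx Nx; apply: contrapT => nG; apply: Nx; apply: hN => /= h; apply: nG; exact: h.
(* Cutting off on the null set [N] makes the sequence converge at every point of the interval, so
   that the limit is measurable. *)
pose w n x := u n x * \1_(~` N) x.
have cw x : D x -> cvgn (fun n => w n x).
  move=> Dx; rewrite /w indicE; have [Nx|Nx] := pselect (N x).
    have -> : (x \in ~` N) = false by apply/negbTE/negP; rewrite inE => /(_ Nx).
    by under eq_fun do rewrite mulr0; exact: is_cvg_cst.
  have -> : (x \in ~` N) by rewrite inE.
  under eq_fun do rewrite mulr1.
  by apply: cvu; exact: DN.
have mw n : measurable_fun D (w n).
  by apply: measurable_funM; [exact: (l2P (u n)).1|apply: measurable_indic; exact: measurableC].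
pose f x := limn (fun n => w n x).
have mf : measurable_fun D f by apply: (measurable_fun_cvg mw) => x Dx; exact: cw.
have wE n : {ae leb, forall x, D x -> w n x = u n x}.
  exists N; split => // x /= h; apply: contrapT => Nx; apply: h => Dx.
  by rewrite /w indicE mem_set//= mulr1.
have key n : (\int[leb]_(x in D) ((f x - u n x) ^+ 2)%:E <= ((2 * 2^-1 ^+ n) ^+ 2)%:E)%E.
  pose e m x := ((w m x - u n x) ^+ 2)%:E.
  have me m : measurable_fun D (e m).
    apply/measurable_EFinP; apply: measurable_funX; apply: measurable_funB => //.
    exact: (l2P (u n)).1.
  have -> : (\int[leb]_(x in D) ((f x - u n x) ^+ 2)%:E = \int[leb]_(x in D) limn_einf (e^~ x))%E.
    apply: eq_integral => x; rewrite inE => Dx; apply/esym.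
    apply: (cvg_limn_einf_sup _).1.
    apply/cvg_EFin; first by apply: nearW.
    have h1 : (fun m => w m x - u n x) @ \oo --> f x - u n x.
      by apply: cvgB; [exact: cw|exact: cvg_cst].
    have := cvgM h1 h1.
    rewrite (_ : fine \o e^~ x = (fun m => w m x - u n x) \* (fun m => w m x - u n x)).
      by rewrite expr2; exact.
    by apply/funext => m /=; rewrite expr2.
  apply: le_trans (fatou leb (@measurable_D R a b) me _) _.
    by move=> m x _; rewrite lee_fin sqr_ge0.
  rewrite limn_einf_lim; apply: lime_le; first exact: is_cvg_einfs.
  (* The infimum over the indices beyond k is at most the term of index n + k, to which [dist n k]
     applies. *)
  apply: nearW => k; apply: (@le_trans _ _ (\int[leb]_(x in D) e (n + k)%N x)%E).
    by apply: ereal_inf_lbound; exists (n + k)%N => //=; exact: leq_addl.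
  have -> : (\int[leb]_(x in D) e (n + k)%N x =
     \int[leb]_(x in D) ((u (n + k)%N - u n) x ^+ 2)%:E)%E.
    apply: ge0_ae_eq_integral => //; try exact: me.
    - apply/measurable_EFinP; apply: measurable_funX; exact: (l2P (u (n + k)%N - u n)).1.
    - by move=> x _; rewrite lee_fin sqr_ge0.
    - by move=> x _; rewrite lee_fin sqr_ge0.
    apply: (@filterS _ _ (ae_filter_ringOfSetsType leb) _ _ _ (wE (n + k)%N)) => x hx Dx.
    by rewrite /e hx// l2BE.
  by rewrite integral_sq lee_fin nrmE ler_pXn2r ?nnegrE ?nrm_ge0// mulr_ge0// exprn_ge0// invr_ge0.
have sfu n : sqint a b (fun x => f x - u n x).
  split; first by apply: measurable_funB => //; exact: (l2P (u n)).1.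
  apply/integrableP; split.
    apply/measurable_EFinP; apply: measurable_funX; apply: measurable_funB => //.
    exact: (l2P (u n)).1.
  apply: le_lt_trans _ (le_lt_trans (key n) (ltry _)).
  rewrite le_eqVlt; apply/orP; left; apply/eqP; apply: eq_integral => x _.
  by rewrite /= ger0_norm ?sqr_ge0.
have sf : sqint a b f.
  rewrite (_ : f = fun x => (f x - u 0%N x) + u 0%N x).
    by apply: sqintD => //; exact: l2P.
  by apply/funext => x; rewrite subrK.
exists (mkl2 a b f) => n.
rewrite -(@ler_pXn2r _ 2) ?nnegrE ?nrm_ge0 ?mulr_ge0 ?exprn_ge0 ?invr_ge0//.
rewrite -nrmE -lee_fin -integral_sq; apply: le_trans (key n).
by rewrite le_eqVlt; apply/orP; left; apply/eqP; apply: eq_integral => x _; rewrite l2BE mkl2K.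
Qed.

End Completeness.

(** * Riesz representation and density *)

Definition fast_complete (R : realType) (H : lmodType R) (S : inner_product H) :=
  forall u : nat -> H, (forall n, nrm S (u n.+1 - u n) <= 2^-1 ^+ n) ->
    exists f, forall n, nrm S (f - u n) <= 2 * 2^-1 ^+ n.

Section Variational.
Context {R : realType} {H : lmodType R} (S : inner_product H) (HS : fast_complete S).

(* The minimizer over T of S x x - 2 l x. *)
Lemma variational (T : set H) (l : H -> R) :
  T 0 -> (forall x y, T x -> T y -> T (x + y)) -> (forall a x, T x -> T (a *: x)) ->
  (forall x y, l (x + y) = l x + l y) -> (forall a x, l (a *: x) = a * l x) ->
  (exists M, forall x, `|l x| <= M * nrm S x) ->
  exists f, (forall e, 0 < e -> exists2 w, T w & nrm S (f - w) < e) /\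
    forall w, T w -> S f w = l w.
Proof.
move=> T0 TD TZ lD lZ [M hM].
pose q x := S x x - 2 * l x.
have q_lb x : - M ^+ 2 <= q x.
  have := hM x; rewrite ler_norml => /andP[_ h1]; rewrite /q nrmE.
  have := sqr_ge0 (nrm S x - M); lra.
pose Q := [set q x | x in T].
have iQ : has_inf Q.
  by split; [exists (q 0), 0|exists (- M ^+ 2) => _ [x _ <-]].
pose m := inf Q.
have qm x : T x -> m <= q x by move=> Tx; apply: ge_inf; [exact: iQ.2|exists x].
(* By the parallelogram identity, closeness of the values of [q] to the infimum becomes closeness of
   the vectors; this tolerance makes consecutive minimizers at most 2^-n apart. *)
have e0 n : 0 < (2^-1 ^+ n) ^+ 2 / 4 :> R by rewrite divr_gt0// !exprn_gt0// invr_gt0.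
have /choice[u hu] n : exists x, T x /\ q x < m + (2^-1 ^+ n) ^+ 2 / 4.
  by have [_ [x Tx <-] h] := inf_adherent (e0 n) iQ; exists x.
have par x y : T x -> T y -> S (x - y) (x - y) <= 2 * (q x - m) + 2 * (q y - m).
  move=> Tx Ty; have := qm _ (TZ 2^-1 _ (TD _ _ Tx Ty)).
  rewrite /q !dotE lZ lD (dotC S y x); lra.
have [|f hf] := HS (u := u).
  move=> n; rewrite -(@ler_pXn2r _ 2) ?nnegrE ?nrm_ge0 ?exprn_ge0 ?invr_ge0//.
  rewrite -nrmE; apply: le_trans (par _ _ (hu n.+1).1 (hu n).1) _.
  have h1 := (hu n).2; have := (hu n.+1).2.
  have -> : (2^-1 ^+ n.+1) ^+ 2 = (2^-1 ^+ n) ^+ 2 / 4 :> R.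
    by rewrite [2^-1 ^+ n.+1]exprS exprMn; field.
  have := sqr_ge0 (2^-1 ^+ n : R); lra.
have app e : 0 < e -> exists n, 2 * 2^-1 ^+ n < e :> R.
  move=> e0'; have h1 : 0 < e / 2 by rewrite divr_gt0.
  have := @cvg_expr R 2^-1; rewrite gtr0_norm ?invr_gt0// invf_lt1// ltr1n => /(_ isT).
  move/cvgrPdist_lt => /(_ _ h1) [n _ /(_ n (leqnn n))].
  rewrite sub0r normrN ger0_norm ?exprn_ge0 ?invr_ge0// => h2; exists n; lra.
exists f; split=> [e e0'|w Tw].
  have [n hn] := app e e0'; exists (u n); first exact: (hu n).1.
  exact: le_lt_trans (hf n) hn.
have lip x y : `|l x - l y| <= M * nrm S (x - y).
  by rewrite -mulN1r -lZ -lD scaleN1r.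
have sq3 x y : S y y = S x x + 2 * S x (y - x) + S (y - x) (y - x).
  by rewrite !dotE (dotC S y x); ring.
(* [f] is only a limit of elements of [T], so f + t w is compared with u n + t w, which belongs to
   [T]. *)
have qf (t : R) : m <= q (f + t *: w).
  apply/ler_addgt0Pr => e e0'.
  pose K := 2 * nrm S (f + t *: w) + 1 + 2 * `|M|.
  have K0 : 0 < K.
    by have := nrm_ge0 S (f + t *: w); have := normr_ge0 M; rewrite /K; lra.
  have e1 : 0 < Num.min 1 (e / K) by rewrite lt_min ltr01 divr_gt0.
  have [n hn] := app _ e1; have := le_lt_trans (hf n) hn.
  rewrite lt_min ltr_pdivlMr// => /andP[d1 d2].
  have := qm _ (TD _ _ (hu n).1 (TZ t _ Tw)).
  set x := f + t *: w in K K0 e1 hn d2 *; set y := u n + t *: w => qy.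
  have xy : y - x = - (f - u n).
    by rewrite /x /y opprB opprD addrACA subrr addr0.
  have ny : nrm S (y - x) = nrm S (f - u n) by rewrite xy nrmN.
  have h1 := lip y x; rewrite ny in h1.
  have h2 := le_trans (ler_norm _) (cauchy_schwarz S x (y - x)).
  rewrite ny in h2.
  have h3 : S y y = S x x + 2 * S x (y - x) + S (y - x) (y - x).
    exact: sq3.
  have h4 : S (y - x) (y - x) <= nrm S (f - u n).
    rewrite nrmE ny expr2; apply: ler_piMl; [exact: nrm_ge0|exact: ltW].
  have h5 := ler_wpM2r (nrm_ge0 S (f - u n)) (ler_norm M).
  move: h1 qy; rewrite ler_norml /q => /andP[h1 _] qy; move: d2; rewrite /K; lra.
have fm : q f <= m.
  apply/ler_addgt0Pr => e e0'.
  pose K := 2 * (nrm S f + 1) + 1 + 2 * `|M| + 1.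
  have K0 : 0 < K.
    by have := nrm_ge0 S f; have := normr_ge0 M; rewrite /K; lra.
  have e1 : 0 < Num.min 1 (e / K) by rewrite lt_min ltr01 divr_gt0.
  have [n hn] := app _ e1.
  move: (hn); rewrite lt_min ltr_pdivlMr// => /andP[_ d3].
  have p0 : 0 <= 2^-1 ^+ n :> R by rewrite exprn_ge0// invr_ge0.
  have p1 : 2^-1 ^+ n <= 1 :> R by rewrite exprn_ile1// ?invr_ge0// invf_le1// ler1n.
  have := le_lt_trans (hf n) hn.
  rewrite lt_min ltr_pdivlMr// => /andP[d1 d2].
  have h1 := lip (u n) f; rewrite nrmBC in h1.
  have h2 := le_trans (ler_norm _) (cauchy_schwarz S f (f - u n)).
  have h3 : S f f <= S (u n) (u n) + 2 * S f (f - u n).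
    have := dot_ge0 S (f - u n); rewrite !dotE (dotC S (u n) f); lra.
  have h4 := (hu n).2.
  have h5 := ler_wpM2r (nrm_ge0 S (f - u n)) (ler_norm M).
  have h6 : (2^-1 ^+ n) ^+ 2 <= 2^-1 ^+ n :> R by rewrite expr2 ler_piMl.
  have h7 := mulr_ge0 (normr_ge0 M) p0; have h8 := mulr_ge0 (nrm_ge0 S f) p0.
  have h9 := ler_wpM2l (nrm_ge0 S f) (hf n); have h10 := ler_wpM2l (normr_ge0 M) (hf n).
  move: h1; rewrite ler_norml /q => /andP[_ h1]; move: d3 h4; rewrite /K /q; lra.
apply/eqP; rewrite -subr_eq0; apply/eqP; set d := S f w - l w.
have quad (t : R) : 0 <= 2 * t * d + t ^+ 2 * S w w.
  have := qf t; move: fm; rewrite /q !dotE lD lZ (dotC S w f) /d; lra.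
(* At this t the nonnegative quadratic would be negative unless d = 0; adding 1 to the denominator
   covers null vectors [w]. *)
have := quad (- d / (S w w + 1)); have w0 := dot_ge0 S w.
have w1 : 0 < S w w + 1 by lra.
rewrite (_ : 2 * _ * d + _ = - (d ^+ 2 * (S w w + 2) / (S w w + 1) ^+ 2)); last first.
  by field; rewrite gt_eqF.
rewrite oppr_ge0 => h.
have : 0 <= d ^+ 2 * ((S w w + 2) / (S w w + 1) ^+ 2).
  by rewrite mulr_ge0 ?sqr_ge0// divr_ge0 ?sqr_ge0//; lra.
rewrite mulrA => h'; have : d ^+ 2 * (S w w + 2) / (S w w + 1) ^+ 2 == 0 by rewrite eq_le h h'.
rewrite mulf_eq0 invr_eq0 mulf_eq0 !sqrf_eq0 => /orP[/orP[/eqP//|/eqP]|/eqP]; lra.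
Qed.

Lemma riesz : riesz_complete S.
Proof.
move=> l lD lZ lM.
have [f [_ hf]] := variational (T := setT) I (fun _ _ _ _ => I) (fun _ _ _ => I) lD lZ lM.
by exists f => x; rewrite hf.
Qed.

(** [variational] with the functional [S x] gives the projection f of x onto the closure of [T]; x -
    f is orthogonal to [T], hence null. *)
Lemma dense_of_orthogonal (T : set H) :
  T 0 -> (forall x y, T x -> T y -> T (x + y)) -> (forall a x, T x -> T (a *: x)) ->
  (forall y, (forall w, T w -> S y w = 0) -> S y y = 0) ->
  forall x e, 0 < e -> exists2 w, T w & nrm S (x - w) < e.
Proof.
move=> T0 TD TZ Tperp x e e0.
have [|||f [hf fT]] := @variational T (fun w => S x w) T0 TD TZ.
- by move=> y z; rewrite dotDr.
- by move=> a y; rewrite dotZr.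
- by exists (nrm S x) => y; exact: cauchy_schwarz.
have fx : S (x - f) (x - f) = 0 by apply: Tperp => w Tw; rewrite dotBl fT// subrr.
have [w Tw hw] := hf e e0; exists w => //.
have -> : x - w = (x - f) + (f - w) by rewrite addrA subrK.
apply: le_lt_trans (nrmD _ _ _) _.
by rewrite {1}/nrm fx sqrtr0 add0r.
Qed.

End Variational.

Lemma dense_null (R : realType) (H : lmodType R) (S : inner_product H) (T : set H) x :
  (forall e, 0 < e -> exists2 w, T w & nrm S (x - w) < e) ->
  (forall w, T w -> S x w = 0) -> S x x = 0.
Proof.
move=> hT h; apply: contrapT => /eqP x0.
have n0 : 0 < nrm S x by rewrite /nrm sqrtr_gt0 lt_neqAle eq_sym x0 dot_ge0.
have [w Tw] := hT _ n0; rewrite -ltr_sqr ?nnegrE ?nrm_ge0// -!nrmE !dotE (dotC S w x) !(h w)//.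
have := dot_ge0 S w; lra.
Qed.

(** * Smooth functions *)

Section Smooth.
Context {R : realType}.
Implicit Types (f g : R -> R).

(** Differentiability of order n with the first derivative peeled off first, whereas [smooth] adds
    derivatives last; this suits induction on sums and products. *)
Fixpoint ck n f : Prop :=
  if n is m.+1 then (forall x, derivable f x 1) /\ ck m (f^`())%classic else True.

Lemma smoothP f : smooth f <-> forall n, ck n f.
Proof.
split=> [sf n|hf n x].
  elim: n f sf => //= n IH f sf; split; first exact: (sf 0%N).
  by apply: IH => k x; have := sf k.+1 x; rewrite /derive1n iterSr.
elim: n f hf => [|n IH] f hf; first exact: (hf 1%N).1.
by rewrite /derive1n iterSr; apply: IH => k; exact: (hf k.+1).2.
Qed.

Lemma smooth_deriv f : smooth f -> smooth (f^`())%classic.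
Proof. by move=> /smoothP hf; apply/smoothP => n; exact: (hf n.+1).2. Qed.

Lemma smooth_is_derive f (x : R) : smooth f -> is_derive x 1 f ((f^`())%classic x).
Proof. by move=> sf; rewrite derive1E; apply/derivableP/(sf 0%N). Qed.

Lemma smooth_continuous f : smooth f -> continuous f.
Proof. by move=> sf x; apply/differentiable_continuous/derivable1_diffP/(sf 0%N). Qed.

Lemma derive1_ext f g : (forall x : R, is_derive x 1 f (g x)) -> (f^`())%classic = g.
Proof. by move=> h; apply/funext => x; rewrite derive1E; have [_ ->] := h x. Qed.

Lemma smooth_antideriv f g : (forall x : R, is_derive x 1 f (g x)) -> smooth g -> smooth f.
Proof.
move=> fg /smoothP sg; apply/smoothP => -[//|n]; split; first by move=> x; have [] := fg x.
by rewrite (derive1_ext fg).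
Qed.

Lemma ckW n f : ck n.+1 f -> ck n f.
Proof. by elim: n f => //= n IH f [h1 [h2 h3]]; split => //; apply: IH; split. Qed.

Lemma ck_is_derive n f (x : R) : ck n.+1 f -> is_derive x 1 f ((f^`())%classic x).
Proof. by move=> [h _]; rewrite derive1E; apply/derivableP/h. Qed.

Lemma ckD n f g : ck n f -> ck n g -> ck n (fun x => f x + g x).
Proof.
elim: n f g => //= n IH f g hf hg.
have h (x : R) : is_derive x 1 (fun x => f x + g x) ((f^`())%classic x + (g^`())%classic x).
  by apply: is_deriveD; [exact: ck_is_derive hf|exact: ck_is_derive hg].
split; first by move=> x; have [] := h x.
by rewrite (derive1_ext h); apply: IH; [exact: hf.2|exact: hg.2].
Qed.

Lemma ckM n f g : ck n f -> ck n g -> ck n (fun x => f x * g x).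
Proof.
elim: n f g => // n IH f g hf hg.
have h (x : R) : is_derive x 1 (fun x => f x * g x)
    (f x * (g^`())%classic x + g x * (f^`())%classic x).
  by apply: is_deriveM; [exact: ck_is_derive hf|exact: ck_is_derive hg].
split; first by move=> x; have [] := h x.
rewrite (derive1_ext h); apply: ckD; apply: IH; by [exact: ckW|exact: hf.2|exact: hg.2].
Qed.

Lemma ck_cst n (k : R) : ck n (fun=> k).
Proof.
elim: n k => //= n IH k.
have h (x : R) : is_derive x 1 (fun=> k) ((fun=> 0) x) by exact: is_derive_cst.
by split; [move=> x; have [] := h x|rewrite (derive1_ext h); exact: IH].
Qed.

Lemma ck_affine n f (k l : R) : ck n f -> ck n (fun x => f (k * x + l)).
Proof.
elim: n f => // n IH f hf.
have h (x : R) : is_derive x 1 (fun x => f (k * x + l)) (k * (f^`())%classic (k * x + l)).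
  rewrite mulrC; apply: (is_derive1_comp (g := fun x => k * x + l)).
    exact: ck_is_derive hf.
  have h1 : is_derive x 1 (k \*: id + cst l) (k *: 1 + 0) by exact: is_deriveD.
  by apply: is_derive_eq; rewrite addr0 /GRing.scale/= mulr1.
split; first by move=> x; have [] := h x.
rewrite (derive1_ext h); apply: ckM; first exact: ck_cst.
exact: IH hf.2.
Qed.

Lemma smoothD f g : smooth f -> smooth g -> smooth (fun x => f x + g x).
Proof. by move=> /smoothP hf /smoothP hg; apply/smoothP => n; exact: ckD. Qed.

Lemma smoothM f g : smooth f -> smooth g -> smooth (fun x => f x * g x).
Proof. by move=> /smoothP hf /smoothP hg; apply/smoothP => n; exact: ckM. Qed.

Lemma smooth_cst (k : R) : smooth (fun=> k).
Proof. by apply/smoothP => n; exact: ck_cst. Qed.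

Lemma smooth_affine (k l : R) f : smooth f -> smooth (fun x => f (k * x + l)).
Proof. by move=> /smoothP hf; apply/smoothP => n; exact: ck_affine. Qed.

Lemma smoothZ (k : R) f : smooth f -> smooth (fun x => k * f x).
Proof. by move=> sf; apply: (@smoothM (fun=> k)); [exact: smooth_cst|exact: sf]. Qed.

(** The family x^-n exp(-1/x), extended by 0, whose linear span is closed under differentiation; n =
    0 is the classical smooth function flat at 0. *)
Definition flat n (x : R) := if 0 < x then x^-1 ^+ n * expR (- x^-1) else 0.

Lemma expR_ge_pow (y : R) n : 0 <= y -> y ^+ n <= n`!%:R * expR y.
Proof.
move=> y0; case: n => [|n].
  by rewrite expr0 mul1r; apply: le_trans (expR_ge1Dx y); rewrite lerDl.
have := expR_ge1Dxn n y0 => h.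
have f0 : 0 < n.+1`!%:R :> R by rewrite ltr0n fact_gt0.
rewrite mulrC -ler_pdivrMr//; apply: le_trans h; by rewrite lerDr.
Qed.

Lemma flat_ge0 n x : 0 <= flat n x.
Proof.
rewrite /flat; case: ifP => // x0; rewrite mulr_ge0 ?expR_ge0// exprn_ge0// invr_ge0.
exact: ltW.
Qed.

(** The exponential dominates the power n + 2 of 1/x. The two surplus powers give a quadratic bound,
    hence derivative 0 at the origin. *)
Lemma flat_le n x : flat n x <= n.+2`!%:R * x ^+ 2.
Proof.
rewrite /flat; case: ifP => x0; last by rewrite mulr_ge0 ?sqr_ge0.
have := @expR_ge_pow x^-1 n.+2; rewrite invr_ge0 ltW// => /(_ isT).
rewrite expRN ler_pdivrMr ?expR_gt0// => h.
have x2 : 0 < x ^+ 2 by rewrite exprn_gt0.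
have := ler_wpM2r (ltW x2) h.
have -> : x^-1 ^+ n.+2 * x ^+ 2 = x^-1 ^+ n.
  by rewrite -addn2 exprD -mulrA -exprMn mulVf ?gt_eqF// expr1n mulr1.
by rewrite mulrAC.
Qed.

Lemma is_derive_flat n (x : R) :
  is_derive x 1 (flat n) (- n%:R * flat n.+1 x + flat n.+2 x).
Proof.
have [x0|x0|<-] := ltgtP 0 x.
- apply: (@near_eq_is_derive _ R R (fun y : R => y^-1 ^+ n * expR (- y^-1))).
    near=> y; rewrite /flat; have -> // : 0 < y by near: y; exact: lt_nbhsr.
  rewrite /flat x0.
  have hi : is_derive x 1 (fun y : R => y^-1) (- x ^- 2 *: 1).
    apply: (@is_deriveV _ id); first by rewrite gt_eqF.
  have hp : is_derive x 1 (fun y : R => y^-1 ^+ n) ((n%:R * x^-1 ^+ n.-1) *: (- x ^- 2 *: 1)).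
    have -> : (fun y : R => y^-1 ^+ n) = (fun y : R => y^-1) ^+ n.
      by apply/funext => y; rewrite exprfctE.
    exact: is_deriveX.
  have he : is_derive x 1 (fun y : R => expR (- y^-1)) (expR (- x^-1) * - (- x ^- 2 *: 1)).
    by apply: (is_derive1_comp (g := fun y => - y^-1)); exact: is_deriveN.
  apply: is_derive_eq (is_deriveM hp he) _.
  rewrite -exprVn /GRing.scale/=; case: n {hp} => [|n]; rewrite /= ?exprS; ring.
- apply: (@near_eq_is_derive _ R R (cst 0)).
    near=> y; rewrite /flat; have /ltW : y < 0 by near: y; exact: lt_nbhsl.
    by rewrite leNgt => /negbTE ->.
  by rewrite /flat ltNge (ltW x0)/= mulr0 addr0; exact: is_derive_cst.
- apply/is_deriveP => e e0; rewrite {2 3 4}/flat ltxx mulr0 addr0.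
  have f0 : 0 < n.+2`!%:R :> R by rewrite ltr0n fact_gt0.
  exists (e / n.+2`!%:R) => [|s]; first by rewrite divr_gt0.
  rewrite !subr0 mul0r subr0 ltr_pdivlMr// => hs.
  rewrite ger0_norm ?flat_ge0//; apply: le_trans (flat_le n s) _.
  rewrite -(real_normK (num_real s)) expr2 mulrA (mulrC _ `|s|) (mulrC e).
  by rewrite ler_wpM2l// mulrC ltW.
Unshelve. all: by end_near. Qed.

Lemma smooth_flat n : smooth (flat n).
Proof.
apply/smoothP => k; elim: k n => // k IH n; split.
  by move=> x; have [] := is_derive_flat n x.
rewrite (derive1_ext (is_derive_flat n)); apply: ckD => //.
by apply: ckM => //; exact: ck_cst.
Qed.

Lemma flat0_le1 x : flat 0 x <= 1.
Proof.
rewrite /flat; case: ifP => // x0; rewrite expr0 mul1r -[leRHS]expR0 ler_expR oppr_le0.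
by rewrite invr_ge0 ltW.
Qed.

Lemma flat0_ge (x e : R) : 0 < e -> e^-1 <= x -> 1 - e <= flat 0 x.
Proof.
move=> e0 ex; have x0 : 0 < x by apply: lt_le_trans ex; rewrite invr_gt0.
rewrite /flat x0 expr0 mul1r; apply: le_trans (expR_ge1Dx _).
by rewrite lerD2l lerN2 invf_ple.
Qed.

(** A smooth approximation from below of the indicator of ]a, b[, better as k grows. *)
Definition bump (a b k x : R) := flat 0 (k * (x - a)) * flat 0 (k * (b - x)).

Lemma smooth_bump a b k : smooth (bump a b k).
Proof.
apply: smoothM.
  suff : smooth (fun x => flat 0 (k * x + - k * a)).
    by congr smooth; apply/funext => x; congr flat; ring.
  by apply: smooth_affine; exact: smooth_flat.
suff : smooth (fun x => flat 0 (- k * x + k * b)).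
  by congr smooth; apply/funext => x; congr flat; ring.
by apply: smooth_affine; exact: smooth_flat.
Qed.

Lemma bump_ge0 a b k x : 0 <= bump a b k x.
Proof. by rewrite mulr_ge0 ?flat_ge0. Qed.

Lemma bump_le1 a b k x : bump a b k x <= 1.
Proof.
rewrite -[leRHS]mulr1; apply: ler_pM; by rewrite ?flat_ge0 ?flat0_le1.
Qed.

Lemma bump_out a b k x : 0 < k -> ~~ (a < x < b) -> bump a b k x = 0.
Proof.
move=> k0; rewrite negb_and -!leNgt => /orP[h|h]; rewrite /bump.
  by rewrite {1}/flat pmulr_rgt0// subr_gt0 ltNge h mul0r.
by rewrite {2}/flat pmulr_rgt0// subr_gt0 ltNge h mulr0.
Qed.

(** The scale e^-2 sends a distance e from the endpoints to 1/e, where [flat 0] is at least 1 -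
    e. *)
Lemma bump_ge a b (e x : R) : 0 < e <= 1 -> a + e <= x <= b - e -> 1 - 2 * e <= bump a b (e ^- 2) x.
Proof.
move=> /andP[e0 e1] /andP[h1 h2].
have aux y : e <= y -> 1 - e <= flat 0 (e ^- 2 * y).
  move=> ey; apply: flat0_ge => //; rewrite ler_pdivlMl ?exprn_gt0//.
  by rewrite expr2 mulfK ?gt_eqF.
have f1 := aux (x - a); have f2 := aux (b - x).
have {}f1 : 1 - e <= flat 0 (e ^- 2 * (x - a)) by apply: f1; lra.
have {}f2 : 1 - e <= flat 0 (e ^- 2 * (b - x)) by apply: f2; lra.
rewrite /bump; apply: le_trans (_ : (1 - e) * (1 - e) <= _).
  by have := sqr_ge0 e; lra.
by apply: ler_pM => //; rewrite subr_ge0.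
Qed.

Lemma test_bump (O : set R) a b k : 0 < k -> `[a, b]%classic `<=` O -> test_fun O (bump a b k).
Proof.
move=> k0 abO; split; first exact: smooth_bump.
exists `[a, b]%classic; split => //; first exact: segment_compact.
move=> x h; apply: bump_out => //; apply/negP => /andP[h1 h2]; apply: h.
by rewrite /= in_itv/= !ltW.
Qed.

End Smooth.

(** * The primitive as an operator on square-integrable functions *)

Section Indefinite.
Context {R : realType} (a b : R).

Local Notation D := (`]a, b[%classic : set R).
Local Notation leb := (@lebesgue_measure R).
Local Notation S := (l2dot a b).
Local Notation H := (l2fun a b).
Local Hint Resolve measurable_D : core.

Definition l2one : H := mkl2 a b (fun=> 1).
(** Pairing with [ind s] integrates up to s; primitives are defined by this pairing, so their
    properties follow from those of the scalar product. *)
Definition ind (s : R) : H := mkl2 a b \1_(`]-oo, s[).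

Lemma l2oneE x : l2one x = 1.
Proof. by rewrite mkl2K//; exact: sqint_cst. Qed.

Lemma sqint_indic (A : set R) : measurable A -> sqint a b \1_A.
Proof.
move=> mA; apply: (@sqint_bounded _ _ _ _ 1); first exact: measurable_indic.
by move=> x _; rewrite indicE; case: (x \in A); rewrite ?normr1 ?normr0.
Qed.

Lemma indE (s x : R) : ind s x = (x < s)%R%:R.
Proof.
by rewrite mkl2K ?indicE ?mem_setE ?in_itv//; exact: sqint_indic.
Qed.

Lemma dot_integral (f g : H) : (\int[leb]_(x in D) (f x * g x)%:E = (S f g)%:E)%E.
Proof.
by rewrite l2dotE /Rintegral fineK//; exact: integrable_fin_num (sqint_mul (l2P f) (l2P g)).
Qed.

Lemma l2_le (f g h : H) : (forall x, D x -> f x * g x <= h x) -> S f g <= S h l2one.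
Proof.
move=> fgh; apply: le_Rintegral => //.
- exact: sqint_mul (l2P f) (l2P g).
- exact: sqint_mul (l2P h) (l2P l2one).
by move=> x Dx; rewrite l2oneE mulr1 fgh.
Qed.

Lemma l2_eq (f g f' g' : H) : (forall x, D x -> f x * g x = f' x * g' x) -> S f g = S f' g'.
Proof. by move=> e; apply: eq_Rintegral => x; rewrite inE => Dx; rewrite e. Qed.

Lemma dot_ind_itv s t : a <= s -> s <= t -> t <= b -> S (ind s) (ind t) = s - a.
Proof.
move=> as_ st tb; rewrite l2dotE.
transitivity (\int[leb]_(x in D) \1_(`]a, s[) x : R).
  apply: eq_Rintegral => x; rewrite inE /= in_itv/= => /andP[ax xb].
  rewrite !indE indicE mem_setE in_itv/= ax/= -natrM mulnb.
  by have [xs|//] := ltP x s; rewrite (lt_le_trans xs st).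
rewrite /Rintegral integral_indic//=.
rewrite setIidl; last by apply: subset_itvl; rewrite bnd_simp (le_trans st).
rewrite lebesgue_measure_itv/= lte_fin.
have [_|sa] := ltP a s; first by rewrite -EFinD.
by apply/esym/eqP; rewrite subr_eq0 eq_le as_ sa.
Qed.

Lemma indD_sq s t : a <= s -> s <= t -> t <= b -> S (ind t - ind s) (ind t - ind s) = t - s.
Proof.
move=> as_ st tb; have at_ := le_trans as_ st; have sb := le_trans st tb.
rewrite dotBl !dotBr (dotC S (ind t) (ind s)) !dot_ind_itv//; ring.
Qed.

Lemma ind_b : a <= b -> forall f : H, S f (ind b) = S f l2one.
Proof.
move=> ab f; apply: l2_eq => x; rewrite /= in_itv/= => /andP[_ xb].
by rewrite indE xb l2oneE.
Qed.

Lemma l2one_sq : a <= b -> S l2one l2one = b - a.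
Proof.
move=> ab; rewrite -ind_b// dotC -ind_b//; exact: dot_ind_itv.
Qed.

Lemma l2_bound (f : H) M : a <= b -> (forall x, D x -> f x ^+ 2 <= M) -> S f f <= M * (b - a).
Proof.
move=> ab fM; rewrite -l2one_sq// -dotZl; apply: l2_le => x Dx.
by rewrite l2ZE l2oneE mulr1 -expr2 fM.
Qed.

Lemma ind_sq x : a <= x <= b -> S (ind x) (ind x) = x - a.
Proof. by move=> /andP[ax xb]; exact: dot_ind_itv. Qed.

Definition prim_fun (f : H) (x : R) : R := S f (ind x).

(** The squared distance between [ind x] and [ind y] is |x - y|, so Cauchy-Schwarz gives Hölder
    continuity of exponent 1/2, and thereby the measurability of primitives. *)
Lemma prim_lip (f : H) x y : a <= x <= b -> a <= y <= b ->
  (prim_fun f x - prim_fun f y) ^+ 2 <= S f f * `|x - y|.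
Proof.
wlog xy : x y / x <= y => [h hx hy|/andP[ax xb] /andP[ay yb]].
  have [xy|/ltW yx] := leP x y; first exact: h.
  by rewrite -sqrrN opprB distrC; exact: h.
rewrite -dotBr -sqrrN -dotNr opprB; apply: le_trans (cauchy_schwarz_sq _ _ _) _.
by rewrite indD_sq// distrC ger0_norm ?subr_ge0.
Qed.

Lemma prim_continuous (f : H) : {in D, continuous (prim_fun f)}.
Proof.
move=> x; rewrite inE /= in_itv/= => /andP[ax xb].
apply/cvgrPdist_lt => e e0.
have h1 : 0 < S f f + 1 by have := dot_ge0 S f; lra.
near=> y.
have hy : a <= y <= b.
  apply/andP; split; apply: ltW; near: y; [exact: lt_nbhsr|exact: lt_nbhsl].
rewrite -ltr_sqr ?nnegrE ?(ltW e0)// real_normK ?num_real//.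
apply: le_lt_trans (prim_lip f _ hy) _; first by rewrite !ltW.
apply: (@le_lt_trans _ _ ((S f f + 1) * `|x - y|)); first by rewrite ler_wpM2r// lerDl.
rewrite mulrC -ltr_pdivlMr//; near: y.
by apply: (@cvgr_dist_lt _ _ _ (nbhs x) _ id); rewrite ?divr_gt0 ?exprn_gt0//; exact: cvg_id.
Unshelve. all: by end_near. Qed.

Lemma prim_bound (f : H) x : D x -> prim_fun f x ^+ 2 <= S f f * (b - a).
Proof.
rewrite /= in_itv/= => /andP[ax xb].
apply: le_trans (cauchy_schwarz_sq _ _ _) _; rewrite ind_sq; last by rewrite !ltW.
by rewrite ler_wpM2l ?dot_ge0// lerD2r ltW.
Qed.

Lemma sqint_prim (f : H) : sqint a b (prim_fun f).
Proof.
apply: (@sqint_bounded _ _ _ _ (Num.sqrt (S f f * (b - a)))).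
  apply: open_continuous_measurable_fun; first exact: interval_open.
  exact: prim_continuous.
move=> x Dx; rewrite -sqrtr_sqr ler_wsqrtr//; exact: prim_bound.
Qed.

Definition prim (f : H) : H := mkl2 a b (prim_fun f).

Lemma primE (f : H) x : prim f x = S f (ind x).
Proof. by rewrite mkl2K//; exact: sqint_prim. Qed.

Lemma primD f g : prim (f + g) = prim f + prim g.
Proof. by apply/val_inj/funext => x; rewrite [LHS]primE dotDl -!primE. Qed.

Lemma primZ (k : R) f : prim (k *: f) = k *: prim f.
Proof. by apply/val_inj/funext => x; rewrite [LHS]primE dotZl -!primE. Qed.

Lemma prim_bounded : a <= b -> exists M, forall f, S (prim f) (prim f) <= M * S f f.
Proof.
move=> ab; exists ((b - a) ^+ 2) => f.
apply: le_trans (l2_bound (M := S f f * (b - a)) ab _) _; last by rewrite expr2; lra.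
by move=> x Dx; rewrite primE; exact: prim_bound.
Qed.

End Indefinite.

(** * Integration by parts, test functions and density *)

Section Antiderivation.
Context {R : realType} (a b : R) (ab : a < b).

Local Notation D := (`]a, b[%classic : set R).
Local Notation leb := (@lebesgue_measure R).
Local Notation S := (l2dot a b).
Local Notation H := (l2fun a b).
Local Notation J := (@prim R a b).
Local Notation one := (l2one a b).
Local Notation ind := (@ind R a b).
Local Hint Resolve measurable_D : core.

Lemma restrict_integrable (f : R -> R) : leb.-integrable D (EFin \o f) ->
  leb.-integrable setT (EFin \o (f \_ D)).
Proof.
by move=> hf; rewrite -restrict_EFin; apply/integrable_restrict => //=; rewrite setTI.
Qed.

Lemma l2_integrable (f : H) : leb.-integrable setT (EFin \o (f \_ D)).
Proof. exact/restrict_integrable/sqint_integrable/l2P. Qed.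

Lemma dot_mkcond (f g : H) : (\int[leb]_x ((f \_ D) x * g x)%:E = (S f g)%:E)%E.
Proof.
rewrite -dot_integral [RHS]integral_mkcond; apply: eq_integral => x _.
by rewrite !patchE; case: (x \in D); rewrite ?mul0r.
Qed.

Lemma dot_coind (f : H) (t : R) :
  (\int[leb]_x ((f \_ D) x * (t < x)%R%:R)%:E = (S f (one - ind t))%:E)%E.
Proof.
have mt : measurable [set x : R | t < x] by rewrite -set_itvoy; exact: measurable_itv.
pose g := mkl2 a b \1_[set x : R | t < x].
have gE x : g x = (t < x)%R%:R.
  rewrite mkl2K; last exact: sqint_indic.
  by rewrite indicE mem_setE.
have -> : S f (one - ind t) = S f g.
  rewrite !(dotC S f); apply: l2_ae_eq; exists [set t]; split => //.
    exact: lebesgue_measure_set1.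
  move=> x /= h; apply: contrapT => xt; apply: h => _.
  transitivity (one x - ind t x) => //.
  by rewrite l2oneE indE gE; case: (ltgtP x t) => // xt'; rewrite ?subrr ?subr0.
by rewrite -dot_mkcond; apply: eq_integral => x _; rewrite gE.
Qed.

Lemma dot_ind_mkcond (f : H) (x : R) :
  (\int[leb]_t ((f \_ D) t * (t < x)%R%:R)%:E = (S f (ind x))%:E)%E.
Proof. by rewrite -dot_mkcond; apply: eq_integral => t _; rewrite indE. Qed.

(** Fubini's theorem on the triangle t < x, where the integrand is dominated by |g(x)| |f(t)|, a
    product of integrable functions. *)
Lemma prim_fubini (f g : H) : S (J f) g = S f (S g one *: one - J g).
Proof.
pose F (z : R * R) := ((g \_ D) z.1 * ((f \_ D) z.2 * (z.2 < z.1)%R%:R))%:E.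
have mf : measurable_fun setT (f \_ D).
  by apply/(measurable_restrictT _ _).1 => //; exact: (l2P f).1.
have mg : measurable_fun setT (g \_ D).
  by apply/(measurable_restrictT _ _).1 => //; exact: (l2P g).1.
have mlt : measurable_fun setT (fun z : R * R => (z.2 < z.1)%R%:R : R).
  pose A := [set z : R * R | (z.2 < z.1)%R].
  have mA : measurable A.
    rewrite -[A]setTI; have := @measurable_fun_ltr _ _ R setT snd fst.
    move=> /(_ measurable_snd measurable_fst measurableT [set true]) h.
    rewrite (_ : A = (fun z : R * R => (z.2 < z.1)%R) @^-1` [set true])//; exact: h.
  rewrite (_ : (fun z => _) = \1_A); first exact: measurable_indic.
  by apply/funext => z; rewrite indicE mem_setE.
have mF : measurable_fun setT F.
  apply/measurable_EFinP; apply: measurable_funM; first exact: (measurableT_comp mg).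
  by apply: measurable_funM => //; exact: (measurableT_comp mf).
have iF : (leb \x leb)%E.-integrable setT F.
  apply/integrable12ltyP => //.
  pose c := (\int[leb]_t `|(f \_ D) t|%:E)%E.
  have cfin : (c < +oo)%E by have /integrableP[_] := l2_integrable f.
  have c0 : (0 <= c)%E by apply: integral_ge0 => t _; rewrite lee_fin.
  have mfn : measurable_fun setT (fun t => `|(f \_ D) t|) by exact: measurableT_comp.
  have mgn : measurable_fun setT (fun t => `|(g \_ D) t|) by exact: measurableT_comp.
  apply: (@le_lt_trans _ _ (\int[leb]_x (`|(g \_ D) x|%:E * c))%E).
    apply: ge0_le_integral => //.
    - by move=> x _; apply: integral_ge0 => t _; exact: abse_ge0.
    - have mFa : measurable_fun setT (abse \o F) by exact: measurableT_comp.
      by apply: (@measurable_fun_fubini_tonelli_F _ _ _ _ _ leb _ mFa) => x; exact: abse_ge0.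
    - by apply: emeasurable_funM => //; exact/measurable_EFinP.
    move=> x _; rewrite /c -ge0_integralZl//; last by apply/measurable_EFinP.
    apply: ge0_le_integral => //.
    - apply: measurableT_comp => //.
      exact: (measurableT_comp mF (pair1_measurable x)).
    - by apply: emeasurable_funM => //; exact/measurable_EFinP.
    move=> t _; rewrite /F /= lee_fin !normrM ler_wpM2l// ler_piMr//.
    by case: (_ < _)%R; rewrite ?normr1 ?normr0.
  rewrite ge0_integralZr//; last by apply/measurable_EFinP.
  by apply: lte_mul_pinfty => //; [exact: integral_ge0|
    have /integrableP[_] := l2_integrable g; rewrite ge0_fin_numE//; exact: integral_ge0].
have := Fubini iF.
have -> : (\int[leb]_x \int[leb]_t F (x, t) = (S (J f) g)%:E)%E.
  rewrite dotC -dot_mkcond; apply: eq_integral => x _; rewrite primE EFinM -dot_ind_mkcond.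
  rewrite -integralZl//; last first.
    apply: le_integrable (l2_integrable f) => //.
      apply/measurable_EFinP; apply: measurable_funM => //.
      exact: (measurableT_comp mlt (pair1_measurable x)).
    move=> t _; rewrite /= lee_fin normrM ler_piMr//.
    by case: (_ < _)%R; rewrite ?normr1 ?normr0.
have -> : (\int[leb]_t \int[leb]_x F (x, t) = (S f (S g one *: one - J g))%:E)%E.
  rewrite -dot_mkcond; apply: eq_integral => t _.
  have -> : (S g one *: one - J g) t = S g (one - ind t).
    by rewrite l2BE l2ZE l2oneE primE mulr1 dotBr.
  rewrite EFinM -dot_coind -integralZl//; last first.
    apply: le_integrable (l2_integrable g) => //.
      apply/measurable_EFinP; apply: measurable_funM => //.
      exact: (measurableT_comp mlt (pair2_measurable t)).
    move=> x _; rewrite /= lee_fin normrM ler_piMr//.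
    by case: (_ < _)%R; rewrite ?normr1 ?normr0.
  by apply: eq_integral => x _; rewrite /F/= -!EFinM; congr EFin; ring.
exact: EFin_inj.
Qed.

Lemma prim_skew (f g : H) : S (J f) g + S f (J g) = S f one * S g one.
Proof. by rewrite prim_fubini dotBr dotZr subrK mulrC. Qed.

(** [q] is 1/d times the indicator of ]a, a + d[: its primitive rises from 0 to 1 on this layer and
    equals 1 beyond, so the squared error is at most d. *)
Lemma prim_layer e : 0 < e -> exists q, S one q = 1 /\ S (J q - one) (J q - one) <= e.
Proof.
move=> e0; pose d := Num.min e (b - a).
have d0 : 0 < d by rewrite lt_min e0 subr_gt0.
have db : d <= b - a by rewrite ge_min lexx orbT.
have ad : a <= a + d <= b by apply/andP; split; lra.
exists (d^-1 *: ind (a + d)); split.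
  rewrite dotZr dotC -ind_b ?(ltW ab)// dot_ind_itv//; [|lra..].
  by rewrite addrAC subrr add0r mulVf ?gt_eqF.
apply: (@le_trans _ _ (S (ind (a + d)) one)); last first.
  rewrite -ind_b ?(ltW ab)// dot_ind_itv//; [|lra..].
  by rewrite addrAC subrr add0r ge_min lexx.
apply: l2_le => x; rewrite /= in_itv/= => /andP[ax xb].
pose y := J (d^-1 *: ind (a + d)) x - one x; suff : y * y <= ind (a + d) x by [].
have {y}-> : y = d^-1 * S (ind (a + d)) (ind x) - 1.
  by rewrite -dotZl -primE -(l2oneE a b x).
rewrite indE.
have [xd|dx] := ltP x (a + d).
  rewrite dotC dot_ind_itv//; [|lra..].
  have h0 : 0 <= d^-1 * (x - a) by rewrite mulr_ge0 ?invr_ge0 ?subr_ge0 ?(ltW d0) ?(ltW ax).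
  have h1 : d^-1 * (x - a) <= 1 by rewrite ler_pdivrMl// mulr1; lra.
  by rewrite /=; move: h0 h1; set y := _ * _ => h0 h1; nra.
rewrite dot_ind_itv//; [|lra..].
by rewrite addrAC subrr add0r mulVf ?gt_eqF// subrr mulr0.
Qed.

Lemma dot_ind_itvoo (f : H) x : x <= b -> S f (ind x) = \int[leb]_(t in `]a, x[) f t.
Proof.
move=> xb; apply: EFin_inj; rewrite -dot_ind_mkcond /Rintegral fineK; last first.
  apply: integrable_fin_num => //.
  apply: integrableS (sqint_integrable (l2P f)) => //.
  by apply: subset_itvl; rewrite bnd_simp.
rewrite [RHS]integral_mkcond; apply: eq_integral => t _.
rewrite !patchE !mem_setE !in_itv/=; have [ta|ta] := ltP a t; rewrite ?mul0r//=.
have [tx|tx] := ltP t x; first by rewrite (lt_le_trans tx xb) mulr1.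
by rewrite mulr0.
Qed.

(** By Lebesgue's differentiation theorem a function with zero primitive vanishes almost
    everywhere. *)
Lemma ind_total (f : H) : (forall x, D x -> S f (ind x) = 0) -> S f f = 0.
Proof.
move=> h; suff : {ae leb, forall x, D x -> f x = (0 : H) x}.
  by move/l2_ae_eq => ->; rewrite dot0l.
have fT := l2_integrable f.
have fi y : leb.-integrable `]-oo, y] (EFin \o (f \_ D)) by exact: integrableS fT.
have := FTC1Ny fi (integrable_locally (@measurable_D R a b) (sqint_integrable (l2P f))).
apply: (@filterS _ _ (ae_filter_ringOfSetsType leb)) => x [_ hx] Dx; move: (Dx) hx.
rewrite /= in_itv/= => /andP[ax xb].
rewrite patchE mem_set// => <-.
rewrite derive1E (@near_eq_derive _ R R _ (cst 0)) ?derive_cst//.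
near=> y; have yD : D y.
  by rewrite /= in_itv/=; apply/andP; split; near: y; [exact: lt_nbhsr|exact: lt_nbhsl].
apply: EFin_inj; rewrite /cst -(h y yD) -dot_ind_mkcond -Rintegral_itv_bndo_bndc; last first.
  exact: integrableS fT.
rewrite /Rintegral fineK; last by apply: integrable_fin_num => //; exact: integrableS fT.
rewrite integral_mkcond; apply: eq_integral => t _.
by rewrite patchE mem_setE in_itv/=; have [ty|ty] := ltP t y; rewrite ?mulr1 ?mulr0.
Unshelve. all: by end_near. Qed.

Lemma smooth_l2 (w : R -> R) : smooth w -> sqint a b w.
Proof.
move=> /smooth_continuous cw.
have [M hM] : exists M, forall x, x \in `[a, b] -> `|w x| <= M.
  have cn : {within `[a, b], continuous (fun x => `|w x|)}.
    by apply: continuous_subspaceT => x; apply: continuous_comp; [exact: cw|exact: norm_continuous].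
  by have [c _ hc] := EVT_max (ltW ab) cn; exists `|w c|.
apply: (@sqint_bounded _ _ _ _ M).
  by apply: measurable_funTS; exact: continuous_measurable_fun.
by move=> x Dx; apply: hM; move: Dx; rewrite /= !in_itv/= => /andP[/ltW -> /ltW ->].
Qed.

Definition l2w (w : R -> R) : H := mkl2 a b w.

Lemma l2wE w x : smooth w -> l2w w x = w x.
Proof. by move=> sw; rewrite mkl2K//; exact: smooth_l2. Qed.

Lemma dot_deriv_ind w x : smooth w -> a <= x <= b -> S (l2w (w^`())%classic) (ind x) = w x - w a.
Proof.
move=> sw /andP[ax xb]; have sw' := smooth_deriv sw.
rewrite dot_ind_itvoo//.
rewrite (_ : \int[leb]_(t in _) _ = \int[leb]_(t in `]a, x[) (w^`())%classic t); last first.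
  by apply: eq_Rintegral => t _; rewrite l2wE.
move: ax; rewrite le_eqVlt => /predU1P[<-|ax].
  by rewrite subrr set_itvoo0// Rintegral_set0.
have ci : {within `[a, x], continuous (w^`())%classic}.
  by apply: continuous_subspaceT; exact: smooth_continuous.
have ii : leb.-integrable `[a, x] (EFin \o (w^`())%classic).
  by apply: continuous_compact_integrable => //; exact: segment_compact.
rewrite Rintegral_itv_bndo_bndc; last by apply: integrableS ii => //; exact: subset_itvW.
rewrite Rintegral_itv_obnd_cbnd; last by apply: integrableS ii => //; exact: subset_itv_oc_cc.
apply: EFin_inj; rewrite /Rintegral fineK; last exact: integrable_fin_num ii.
rewrite (continuous_FTC2 (F := w) ax ci) ?EFinB//.
split; first by move=> t _; exact: (sw 0%N).
- apply: cvg_at_right_filter; exact: (smooth_continuous sw).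
- apply: cvg_at_left_filter; exact: (smooth_continuous sw).
Qed.

Lemma prim_deriv w x : smooth w -> w a = 0 -> D x -> J (l2w (w^`())%classic) x = w x.
Proof.
move=> sw wa; rewrite /= in_itv/= => /andP[ax xb].
by rewrite primE dot_deriv_ind ?wa ?subr0// !ltW.
Qed.


Lemma test_ind x e : D x -> 0 < e ->
  exists2 w, test_fun D w & S (ind x - l2w w) (ind x - l2w w) <= e.
Proof.
rewrite /= in_itv/= => /andP[ax xb] e0.
(* The bump on [a + d, x - d] misses [ind x] by at most 1 on two strips of width 2d and by at most
   2d between them. The total 4d + 4d^2 (b - a) is at most d (4 + 4 (b - a)), since d is at most
   1. *)
pose d := Num.min (Num.min 1 ((x - a) / 4)) (e / (4 + 4 * (b - a))).
have c0 : 0 < 4 + 4 * (b - a) by lra.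
have d0 : 0 < d by rewrite !lt_min ltr01 !divr_gt0// subr_gt0.
have d1 : d <= 1 by rewrite !ge_min lexx.
have dx : d <= (x - a) / 4 by rewrite !ge_min lexx orbT.
have de : d <= e / (4 + 4 * (b - a)) by rewrite !ge_min lexx !orbT.
have tw : test_fun D (bump (a + d) (x - d) (d ^- 2)).
  apply: test_bump; first by rewrite invr_gt0 exprn_gt0.
  by move=> y; rewrite /= !in_itv/= => /andP[h1 h2]; apply/andP; split; lra.
exists (bump (a + d) (x - d) (d ^- 2)) => //.
pose M := (4 * d ^+ 2) *: one + (ind (a + 2 * d) + (ind x - ind (x - 2 * d))).
apply: (@le_trans _ _ (S M one)); last first.
  rewrite /M !dotE l2one_sq ?(ltW ab)// -!ind_b ?(ltW ab)// !dot_ind_itv//; [|lra..].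
  have : d * (4 + 4 * (b - a)) <= e by rewrite -ler_pdivlMr.
  have : d ^+ 2 * (b - a) <= d * (b - a).
    by rewrite ler_wpM2r ?subr_ge0 ?(ltW ab)// expr2 ler_piMl// ltW.
  lra.
apply: l2_le => y; rewrite /= in_itv/= => /andP[ay yb].
pose B := bump (a + d) (x - d) (d ^- 2) y.
suff : (ind x y - l2w (bump (a + d) (x - d) (d ^- 2)) y) *
    (ind x y - l2w (bump (a + d) (x - d) (d ^- 2)) y) <=
    4 * d ^+ 2 * one y + (ind (a + 2 * d) y + (ind x y - ind (x - 2 * d) y)) by [].
rewrite !indE l2oneE l2wE -/B; last exact: smooth_bump.
have B0 : 0 <= B by exact: bump_ge0.
have B1 : B <= 1 by exact: bump_le1.
have dd := sqr_ge0 d.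
have [xy|yx] := leP x y.
  have -> : (y < x - 2 * d) = false by apply/negbTE; rewrite -leNgt; lra.
  have -> : B = 0.
    apply: bump_out; first by rewrite invr_gt0 exprn_gt0.
    by rewrite negb_and -!leNgt; apply/orP; right; lra.
  by case: (y < _)%R; rewrite /=; lra.
have sq : (1 - B) * (1 - B) <= 1.
  by rewrite -[leRHS]mulr1; apply: ler_pM; lra.
have [h1|h1] := ltP y (a + 2 * d); first by case: (_ < _)%R; rewrite /=; lra.
have [h2|h2] := ltP y (x - 2 * d); last by rewrite /=; lra.
have := @bump_ge _ (a + d) (x - d) d y; rewrite d0 d1 => /(_ isT) h3.
have {}h3 : 1 - 2 * d <= B by apply: h3; apply/andP; split; lra.
rewrite /= (_ : 4 * d ^+ 2 * 1 + _ = (2 * d) * (2 * d)); last by rewrite expr2; ring.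
by apply: ler_pM; lra.
Qed.

Definition test_elt : set H := [set y | exists2 w, test_fun D w & y = l2w w].
Definition dtest_elt : set H := [set y | exists2 w, test_fun D w & y = l2w (w^`())%classic].

Lemma test_funD (O : set R) u v : test_fun O u -> test_fun O v -> test_fun O (fun x => u x + v x).
Proof.
move=> [su [K [cK KO Ku]]] [sv [K' [cK' KO' Kv]]]; split; first exact: smoothD.
exists (K `|` K'); split; [exact: compactU|by move=> x [/KO|/KO']|].
by move=> x h; rewrite Ku ?Kv ?addr0// => hx; apply: h; [right|left].
Qed.

Lemma test_funZ (O : set R) (k : R) u : test_fun O u -> test_fun O (fun x => k * u x).
Proof.
move=> [su [K [cK KO Ku]]]; split; first exact: smoothZ.
by exists K; split => // x h; rewrite Ku ?mulr0.
Qed.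

Lemma test_fun0 (O : set R) : test_fun O (fun=> 0 : R).
Proof. by split; [exact: smooth_cst|exists set0; split => //; exact: compact0]. Qed.

Lemma test_deriv (O : set R) w : test_fun O w -> test_fun O (w^`())%classic.
Proof.
move=> [sw [K [cK KO Kw]]]; split; first exact: smooth_deriv.
exists K; split => // x h.
have oK : open (~` K).
  by apply: closed_openC; apply: compact_closed cK; exact: Rhausdorff.
rewrite derive1E (@near_eq_derive _ R R _ (cst 0)) ?derive_cst//.
by have := open_nbhs_nbhs (conj oK h); apply: filterS => y; exact: Kw.
Qed.

Lemma test_end w x : test_fun D w -> ~ D x -> w x = 0.
Proof. by move=> [_ [K [_ KD Kw]]] Dx; apply: Kw => /KD. Qed.

Lemma l2wD u v : smooth u -> smooth v -> l2w u + l2w v = l2w (fun x => u x + v x).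
Proof.
move=> su sv; apply/val_inj/funext => x.
transitivity (l2w u x + l2w v x) => //.
by rewrite [RHS](l2wE x (smoothD su sv)) !l2wE.
Qed.

Lemma l2wZ (k : R) u : smooth u -> k *: l2w u = l2w (fun x => k * u x).
Proof.
move=> su; apply/val_inj/funext => x.
transitivity (k * l2w u x) => //.
by rewrite [RHS](l2wE x (@smoothZ R k u su)) !l2wE.
Qed.

Lemma derive1_D u v : smooth u -> smooth v ->
  ((fun x => u x + v x)^`())%classic = (fun x : R => (u^`())%classic x + (v^`())%classic x).
Proof.
by move=> su sv; apply: derive1_ext => x; apply: is_deriveD; exact: smooth_is_derive.
Qed.

Lemma derive1_Z (k : R) u : smooth u ->
  ((fun x => k * u x)^`())%classic = (fun x : R => k * (u^`())%classic x).
Proof.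
by move=> su; apply: derive1_ext => x; apply: is_deriveZ; exact: smooth_is_derive.
Qed.

Lemma test_elt_submod : [/\ test_elt 0, (forall x y, test_elt x -> test_elt y -> test_elt (x + y)) &
  (forall k x, test_elt x -> test_elt (k *: x))].
Proof.
split.
- exists (fun=> 0); first exact: test_fun0.
  by apply/val_inj/funext => x; rewrite /= l2wE//; exact: smooth_cst.
- move=> _ _ [u tu ->] [v tv ->]; exists (fun x => u x + v x); first exact: test_funD.
  by rewrite l2wD//; [exact: tu.1|exact: tv.1].
- move=> k _ [u tu ->]; exists (fun x => k * u x); first exact: test_funZ.
  by rewrite l2wZ//; exact: tu.1.
Qed.

Lemma dtest_elt_submod : [/\ dtest_elt 0, (forall x y, dtest_elt x -> dtest_elt y -> dtest_elt (x + y)) &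
  (forall k x, dtest_elt x -> dtest_elt (k *: x))].
Proof.
split.
- exists (fun=> 0); first exact: test_fun0.
  have -> : ((fun=> 0)^`())%classic = (fun=> 0) :> (R -> R).
    by apply: derive1_ext => x; exact: is_derive_cst.
  by apply/val_inj/funext => x; rewrite /= l2wE//; exact: smooth_cst.
- move=> _ _ [u tu ->] [v tv ->]; exists (fun x => u x + v x); first exact: test_funD.
  rewrite l2wD; [|exact: smooth_deriv tu.1|exact: smooth_deriv tv.1].
  by rewrite derive1_D//; [exact: tu.1|exact: tv.1].
- move=> k _ [u tu ->]; exists (fun x => k * u x); first exact: test_funZ.
  rewrite l2wZ; last exact: smooth_deriv tu.1.
  by rewrite derive1_Z//; exact: tu.1.
Qed.

(** A vector orthogonal to all test functions is orthogonal to every [ind z], so its primitive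
    vanishes and it is null. *)
Lemma test_dense x e : 0 < e -> exists2 w, test_elt w & nrm S (x - w) < e.
Proof.
have [h0 hD hZ] := test_elt_submod.
apply: (dense_of_orthogonal (l2_complete_fast (a := a) (b := b)) h0 hD hZ) => y hy.
apply: ind_total => z Dz; apply/eqP; rewrite -normr_le0; apply/ler_addgt0Pr => d d0; rewrite add0r.
have c0 : 0 < nrm S y + 1 by have := nrm_ge0 S y; lra.
have [w tw hw] := test_ind Dz (e := (d / (nrm S y + 1)) ^+ 2) (exprn_gt0 _ (divr_gt0 d0 c0)).
have -> : S y (ind z) = S y (ind z - l2w w).
  by rewrite dotBr (hy (l2w w)) ?subr0//; exists w.
apply: le_trans (cauchy_schwarz _ _ _) _.
move: hw; rewrite nrmE ler_sqr ?nnegrE ?nrm_ge0 ?divr_ge0 ?(ltW d0) ?(ltW c0)// => hw.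
apply: le_trans (ler_wpM2l (nrm_ge0 S y) hw) _.
by rewrite mulrA ler_pdivrMr// mulrC ler_wpM2l ?(ltW d0)// lerDl.
Qed.

(** The primitive from the left vanishes before the support of [w], and after it because [w] has
    mean zero. *)
Lemma test_primitive w : test_fun D w -> S (l2w w) one = 0 ->
  exists2 v, test_fun D v & (v^`())%classic = w.
Proof.
move=> tw w0; have [sw [K [cK KD Kw]]] := tw.
have [m [M [am mM Mb KmM]]] : exists m M, [/\ a < m, m <= M, M < b & K `<=` `[m, M]].
  have [->|/set0P[k Kk]] := eqVneq K set0.
    by exists ((a + b) / 2), ((a + b) / 2); split; [exact: (midf_lt ab).1|exact: lexx|exact: (midf_lt ab).2|exact: sub0set].
  have K0 : K !=set0 by exists k.
  have cid : {within K, continuous (@idfun R)}.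
    by apply: continuous_subspaceT => x; exact: cvg_id.
  have [m mK hm] := compact_EVT_min K0 cK cid; have [M MK hM] := compact_EVT_max K0 cK cid.
  rewrite !inE in mK MK.
  have := KD _ mK; rewrite /= in_itv/= => /andP[am _].
  have := KD _ MK; rewrite /= in_itv/= => /andP[_ Mb].
  exists m, M; split => //; first by apply: hm; rewrite inE.
  by move=> x Kx; rewrite /= in_itv/= hm ?hM ?inE.
have wD : w = w \_ D.
  apply/funext => x; rewrite patchE; case: ifPn => // /negP h.
  by apply: (test_end tw) => Dx; apply: h; rewrite inE.
have iw : leb.-integrable setT (EFin \o w).
  by rewrite wD; apply: restrict_integrable; exact: sqint_integrable (smooth_l2 sw).
pose v x := \int[leb]_(t in `]-oo, x]) w t.
have vw (x : R) : is_derive x 1 v (w x).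
  have [||||h1 h2] := @continuous_FTC1 R w -oo%O x (x + 1).
  - by rewrite ltrDl.
  - exact: integrableS iw.
  - by rewrite ltNyr.
  - exact: smooth_continuous.
  by apply: DeriveDef; [exact: h1|rewrite -derive1E; exact: h2].
have sv : smooth v by exact: smooth_antideriv vw sw.
exists v; last exact: derive1_ext.
split => //; exists `[m, M]%classic; split; first exact: segment_compact.
  by move=> x; rewrite /= !in_itv/= => /andP[h1 h2]; apply/andP; split; lra.
move=> x; rewrite /= in_itv/= => /negP; rewrite negb_and -!ltNge => /orP[xm|Mx].
  transitivity (\int[leb]_(t in `]-oo, x]) (0 : R)); last by rewrite Rintegral_cst// mul0r.
  apply: eq_Rintegral => t; rewrite inE /= in_itv/= => tx; apply: Kw => /KmM; rewrite /= in_itv/= => /andP[mt _].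
  by have := le_lt_trans mt (le_lt_trans tx xm); rewrite ltxx.
apply: EFin_inj; rewrite -w0 -dot_mkcond /v /Rintegral fineK; last first.
  by apply: integrable_fin_num => //; exact: integrableS iw.
rewrite integral_mkcond; apply: eq_integral => t _; rewrite l2oneE mulr1 patchE mem_setE in_itv/=.
have -> : (l2w w \_ D) t = w t.
  by rewrite [in RHS]wD !patchE; case: ifP => // _; rewrite l2wE.
have [//|xt] := leP t x; congr EFin; apply/esym/Kw => /KmM; rewrite /= in_itv/= => /andP[_ tM].
by have := lt_le_trans (lt_trans Mx xt) tM; rewrite ltxx.
Qed.

Lemma dot_dtest_one w : test_fun D w -> S (l2w (w^`())%classic) one = 0.
Proof.
move=> tw; rewrite -ind_b ?(ltW ab)// dot_deriv_ind ?(ltW ab) ?lexx//; last exact: tw.1.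
by rewrite !(test_end tw) ?subr0// /= in_itv/= ltxx ?andbF.
Qed.

(** The du Bois-Reymond lemma: with a fixed [eta] of nonzero mean, every test function is a multiple
    of [eta] plus the derivative of a test function, and pairing with [y] is determined by its value
    on [eta]. *)
Lemma dtest_orthogonal (y : H) : (forall w, dtest_elt w -> S y w = 0) ->
  exists k, S (y - k *: one) (y - k *: one) = 0.
Proof.
move=> hy.
have [eta teta heta] : exists2 w, test_fun D w & S (l2w w) one != 0.
  have one0 : 0 < nrm S one by rewrite /nrm sqrtr_gt0 l2one_sq ?subr_gt0// ltW.
  have [_ [w tw ->] hw] := test_dense one one0; exists w => //; apply/eqP => h.
  move: hw; rewrite -ltr_sqr ?nnegrE ?nrm_ge0// -!nrmE !dotE (dotC S one) h.
  have := dot_ge0 S (l2w w); lra.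
pose k := S y (l2w eta) / S (l2w eta) one; exists k.
apply: (dense_null (T := test_elt)); first by move=> e e0; exact: test_dense.
move=> _ [u tu ->].
pose c := S (l2w u) one / S (l2w eta) one.
have [||v tv hv] := @test_primitive (fun x => u x + (- c) * eta x).
- by apply: test_funD => //; exact: test_funZ.
- rewrite -l2wD; [|exact: tu.1|by apply: smoothZ; exact: teta.1].
  by rewrite -l2wZ ?dotE ?mulNr ?divfK ?subrr//; exact: teta.1.
have h : S y (l2w (v^`())%classic) = 0 by apply: hy; exists v.
move: h; rewrite hv -l2wD; [|exact: tu.1|by apply: smoothZ; exact: teta.1].
rewrite -l2wZ ?dotE; last exact: teta.1.
move=> h; by rewrite -[RHS]h (dotC S one) /k /c; field.
Qed.

(** Derivatives of test functions together with constants are dense. For x of mean zero, removing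
    the constant from an approximation only brings it closer, constants being orthogonal to the
    rest. *)
Lemma mean_zero_dense x e : S x one = 0 -> 0 < e -> exists2 w, dtest_elt w & nrm S (x - w) < e.
Proof.
move=> x0 e0; have [h0 hD hZ] := dtest_elt_submod.
pose T := [set y | exists2 w, dtest_elt w & exists k, y = w + k *: one].
have [||||_ [w dw [k ->]] hw] := dense_of_orthogonal (l2_complete_fast (a := a) (b := b)) (T := T) _ _ _ _ x e0.
- by exists 0 => //; exists 0; rewrite scale0r addr0.
- move=> _ _ [u du [k ->]] [v dv [l ->]]; exists (u + v); first exact: hD.
  by exists (k + l); rewrite scalerDl addrACA.
- move=> l _ [u du [k ->]]; exists (l *: u); first exact: hZ.
  by exists (l * k); rewrite scalerDr scalerA.
- move=> y hy.
  have [w dw|k hk] := dtest_orthogonal (y := y).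
    by apply: hy; exists w => //; exists 0; rewrite scale0r addr0.
  have y1 : S y one = 0 by apply: hy; exists 0 => //; exists 1; rewrite scale1r add0r.
  have := dot_null y hk.
  by rewrite dotBl dotZl (dotC S one) y1 mulr0 subr0.
exists w => //; apply: le_lt_trans hw.
rewrite -ler_sqr ?nnegrE ?nrm_ge0// -!nrmE.
have w0 : S w one = 0 by case: dw => v tv ->; exact: dot_dtest_one.
rewrite opprD addrA !dotE (dotC S one x) (dotC S one w) x0 w0.
have := mulr_ge0 (sqr_ge0 k) (dot_ge0 S one); lra.
Qed.

Lemma prim_dense x e : 0 < e -> exists w, S w one = 0 /\ S (x - J w) (x - J w) < e.
Proof.
move=> e0; have se0 : 0 < Num.sqrt e by rewrite sqrtr_gt0.
have [_ [w tw ->] hw] := test_dense x se0.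
exists (l2w (w^`())%classic); split; first exact: dot_dtest_one.
have -> : S (x - J (l2w (w^`())%classic)) (x - J (l2w (w^`())%classic)) = S (x - l2w w) (x - l2w w).
  apply: l2_eq => y Dy; suff -> : (x - J (l2w (w^`())%classic)) y = (x - l2w w) y by [].
  transitivity (x y - J (l2w (w^`())%classic) y) => //.
  rewrite (prim_deriv tw.1 _ Dy) -?(l2wE y tw.1)//.
  by rewrite (test_end tw)// /= in_itv/= ltxx.
by rewrite nrmE -(sqr_sqrtr (ltW e0)) ltr_sqr ?nnegrE ?nrm_ge0 ?sqrtr_ge0.
Qed.

Lemma l2one_gt0 : 0 < S one one.
Proof. by rewrite l2one_sq ?subr_gt0// ltW. Qed.

Definition l2ad : antiderivative S :=
  Antiderivative (@primD R a b) (@primZ R a b) prim_skew l2one_gt0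
    (prim_bounded (ltW ab)) prim_layer prim_dense.

End Antiderivation.

Lemma dense_orthogonal (R : realType) (H : lmodType R) (S : inner_product H) (T : set H) x z :
  (forall e, 0 < e -> exists2 w, T w & nrm S (x - w) < e) ->
  (forall w, T w -> S z w = 0) -> S z x = 0.
Proof.
move=> hT h; apply/eqP; rewrite -normr_le0; apply/ler_addgt0Pr => e e0; rewrite add0r.
have c0 : 0 < nrm S z + 1 by have := nrm_ge0 S z; lra.
have [w Tw hw] := hT _ (divr_gt0 e0 c0).
have -> : S z x = S z (x - w) by rewrite dotBr (h w)// subr0.
apply: le_trans (cauchy_schwarz _ _ _) _.
apply: le_trans (ler_wpM2l (nrm_ge0 S z) (ltW hw)) _.
by rewrite mulrA ler_pdivrMr// mulrC ler_wpM2l ?(ltW e0)// lerDl.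
Qed.

(** * Sobolev spaces through the primitive operator *)

Section TestCalculus.
Context {R : realType} (a b : R) (ab : a < b).
Implicit Types (w : R -> R).

Local Notation D := (`]a, b[%classic : set R).
Local Notation S := (l2dot a b).
Local Notation J := (l2ad ab).
Local Notation mk := (mkl2 a b).

Lemma test_left w : test_fun D w -> w a = 0.
Proof. by move=> tw; rewrite (test_end tw)//= in_itv/= ltxx. Qed.

(** For test vectors w' this is integration by parts, as J w' = w; the derivatives w' are dense in
    the vectors of mean zero. *)
Lemma hder_char (u v : l2fun a b) :
  (forall w, test_fun D w -> S u (mk (w^`())%classic) = - S v (mk w)) -> hder J u v.
Proof.
move=> h w w0; apply/eqP; rewrite -subr_eq0 opprK; apply/eqP.
have sk : S v (J w) = - S (J v) w.
  by have := ad_skew J v w; rewrite w0 mulr0 => /eqP; rewrite addrC addr_eq0 => /eqP.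
rewrite sk -dotNl -dotDl.
apply: (dense_orthogonal (T := @dtest_elt R a b)); first by move=> e e0; exact: mean_zero_dense.
move=> _ [x tx ->]; rewrite dotDl dotNl h//.
have x0 := dot_dtest_one ab tx.
have := ad_skew J v (l2w a b (x^`())%classic); rewrite x0 mulr0 => /eqP.
rewrite addr_eq0 => /eqP ->; rewrite opprK addrC; apply/eqP; rewrite subr_eq0; apply/eqP.
apply: l2_eq => y Dy; congr (_ * _).
by rewrite [LHS](prim_deriv ab tx.1 (test_left tx) Dy) mkl2K//; exact: smooth_l2 tx.1.
Qed.

Lemma test_hvan w : test_fun D w -> hvan J (mk w) (mk (w^`())%classic).
Proof.
move=> tw; have w0 := dot_dtest_one ab tw; split; first exact: w0.
move=> y; have := ad_skew J (mk (w^`())%classic) y; rewrite w0 mul0r => /eqP.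
rewrite addr_eq0 => /eqP <-; apply: l2_eq => x Dx; congr (_ * _).
by rewrite [RHS](prim_deriv ab tw.1 (test_left tw) Dx) mkl2K//; exact: smooth_l2 tw.1.
Qed.

End TestCalculus.

Section WeakDerivatives.
Context {R : realType} (L : R) (hL : 0 < L).
Implicit Types (u v w : R -> R).

Local Notation D := (`]0, L[%classic : set R).
Local Notation S := (l2dot 0 L).
Local Notation J := (l2ad hL).
Local Notation one := (l2one 0 L).
Local Notation mk := (mkl2 0 L).

Lemma ipE u v : L2 L u -> L2 L v -> ip L u v = S (mk u) (mk v).
Proof. by move=> hu hv; rewrite l2dotE !mkl2K. Qed.

Lemma test_L2 w : smooth w -> L2 L w.
Proof. exact: smooth_l2. Qed.

Lemma test_weak w : test_fun D w -> weak_deriv L w (w^`())%classic.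
Proof.
move=> tw x tx; have lw := test_L2 tw.1; have lw' := test_L2 (smooth_deriv tw.1).
have lx := test_L2 tx.1; have lx' := test_L2 (smooth_deriv tx.1).
rewrite !ipE// (hvan_by_parts (test_hvan hL tx) (hvan_hder (test_hvan hL tw)))//.
Qed.

Lemma weak_hder u v : L2 L u -> L2 L v -> weak_deriv L u v -> hder J (mk u) (mk v).
Proof.
move=> hu hv h; apply: hder_char => w tw.
have := h w tw; rewrite !ipE//; first exact: test_L2 tw.1.
exact/test_L2/smooth_deriv/tw.1.
Qed.

Lemma ddxP u : H1 L u -> L2 L (ddx L u) /\ weak_deriv L u (ddx L u).
Proof. by move=> [_ [v hv]]; rewrite /ddx; case: xgetP => [y -> //|/(_ v)]. Qed.

Lemma ddx_L2 u : L2 L (ddx L u).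
Proof.
rewrite /ddx; case: xgetP => [y -> [] //|_]; exact: (sqint_cst 0 L 0).
Qed.

Lemma L2normE u : L2 L u -> L2norm L u = nrm S (mk u).
Proof. by move=> hu; rewrite /L2norm ipE. Qed.

Lemma mkB u v : L2 L u -> L2 L v -> mk (u \- v) = mk u - mk v.
Proof.
move=> hu hv; apply/val_inj/funext => x.
transitivity (mk u x - mk v x) => //.
rewrite (_ : \val (mk (u \- v)) = u \- v) ?mkl2K//; apply: mkl2K.
have := sqintD hu (sqintZ (-1) hv); congr (sqint _ _ _).
by apply/funext => y; rewrite mulN1r.
Qed.

Lemma L2B u v : L2 L u -> L2 L v -> L2 L (u \- v).
Proof.
move=> hu hv; have := sqintD hu (sqintZ (-1) hv); congr (sqint _ _ _).
by apply/funext => y; rewrite mulN1r.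
Qed.

(** Both conditions of [hvan] hold for test functions and are continuous in the pair formed by a
    function and its derivative, each in L^2. *)
Lemma H10_hvan u : H10 L u -> hvan J (mk u) (mk (ddx L u)).
Proof.
move=> [hu hw]; set u1 := mk (ddx L u).
suff app e : 0 < e -> exists w w1 : l2fun 0 L, [/\ hvan J w w1, nrm S (mk u - w) < e & nrm S (u1 - w1) < e].
  have small z x : (forall e, 0 < e -> exists y y1 : l2fun 0 L, [/\ nrm S y < e, nrm S y1 < e &
      S (mk u) z + S u1 x = S y z + S y1 x]) -> S (mk u) z + S u1 x = 0.
    move=> h; apply/eqP; rewrite -normr_le0; apply/ler_addgt0Pr => e e0; rewrite add0r.
    have c0 : 0 < nrm S z + nrm S x + 1.
      by have := nrm_ge0 S z; have := nrm_ge0 S x; lra.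
    have [y [y1 [h1 h2 ->]]] := h _ (divr_gt0 e0 c0).
    apply: le_trans (ler_normD _ _) _.
    have h3 := le_trans (cauchy_schwarz S y z) (ler_wpM2r (nrm_ge0 S z) (ltW h1)).
    have h4 := le_trans (cauchy_schwarz S y1 x) (ler_wpM2r (nrm_ge0 S x) (ltW h2)).
    apply: le_trans (lerD h3 h4) _; rewrite -mulrDr mulrAC ler_pdivrMr// ler_wpM2l ?(ltW e0)//.
    by rewrite lerDl.
  split.
    have := small 0 one; rewrite dot0r add0r; apply => e e0.
    have [w [w1 [[w10 _] h1 h2]]] := app e e0; exists (mk u - w), (u1 - w1); split => //.
    by rewrite dot0r add0r dotBl w10 subr0.
  move=> z; apply/eqP; rewrite -subr_eq0 opprK; apply/eqP; apply: small => e e0.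
  have [w [w1 [[_ hw1] h1 h2]]] := app e e0; exists (mk u - w), (u1 - w1); split => //.
  by rewrite !dotBl hw1; ring.
move=> e0; have [w tw] := hw e e0; rewrite /H1norm => h.
exists (mk w), (mk (w^`())%classic); split; first exact: test_hvan.
  rewrite -mkB; [|exact: hu.1|exact: test_L2 tw.1].
  rewrite -L2normE; last by apply: L2B; [exact: hu.1|exact: test_L2 tw.1].
  apply: le_lt_trans h.
  by rewrite -[leLHS]ger0_norm ?sqrtr_ge0// -sqrtr_sqr ler_wsqrtr// lerDl sqr_ge0.
have lw := test_L2 tw.1; have lw' := test_L2 (smooth_deriv tw.1).
have huw := L2B hu.1 lw.
have [ld hd] := ddxP hu.
have H1uw : H1 L (u \- w).
  split => //; exists (ddx L u \- (w^`())%classic); split; first exact: L2B.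
  move=> x tx; have lx := test_L2 tx.1; have lx' := test_L2 (smooth_deriv tx.1).
  rewrite ipE// [in RHS]ipE//; last exact: L2B.
  rewrite !mkB//; last exact: hu.1.
  rewrite !dotBl -!ipE//; last exact: hu.1.
  rewrite (hd x tx) opprB addrC; congr (_ + _).
  by rewrite (test_weak tw tx) opprK.
have [ld2 hd2] := ddxP H1uw.
set v := ddx L (u \- w) in h ld2 hd2.
(* The derivative of u - w is chosen independently of that of u; uniqueness of weak derivatives
   makes it agree with the difference up to a null vector. *)
have nv : S (u1 - mk (w^`())%classic - mk v) (u1 - mk (w^`())%classic - mk v) = 0.
  apply: (dense_null (T := @test_elt R 0 L)); first by move=> d d0; exact: test_dense.
  move=> _ [x tx ->].
  have lx := test_L2 tx.1; have lx' := test_L2 (smooth_deriv tx.1).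
  have := hd2 x tx; rewrite ipE// mkB//; last exact: hu.1.
  rewrite !dotBl -!ipE//; last exact: hu.1.
  rewrite (hd x tx) (test_weak tw tx) => h3.
  by apply/eqP; rewrite -oppr_eq0 !opprD h3 opprK addNr.
have -> : u1 - mk (w^`())%classic = (u1 - mk (w^`())%classic - mk v) + mk v by rewrite subrK.
apply: le_lt_trans (nrmD _ _ _) _; rewrite {1}/nrm nv sqrtr0 add0r.
apply: le_lt_trans h; rewrite -L2normE//.
by rewrite -[leLHS]ger0_norm ?sqrtr_ge0// -sqrtr_sqr ler_wsqrtr// lerDr sqr_ge0.
Qed.

End WeakDerivatives.

(** * Distributions in time *)

Section ScalarTime.
Context {R : realType}.
Implicit Types (f g : R -> R).

Local Notation leb := (@lebesgue_measure R).

Lemma cont_bounded f (a b : R) : (forall x, a <= x <= b -> {for x, continuous f}) ->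
  exists M, forall x, a <= x <= b -> `|f x| <= M.
Proof.
move=> cf; have [ba|ab] := ltP b a.
  by exists 0 => x /andP[ax xb]; have := le_trans ax xb; rewrite leNgt ba.
have cn : {within `[a, b], continuous (fun x => `|f x|)}.
  apply: continuous_in_subspaceT => x; rewrite inE /= in_itv/= => xab.
  by apply: continuous_comp; [exact: cf|exact: norm_continuous].
by have [c _ hc] := EVT_max ab cn; exists `|f c| => x xab; apply: hc; rewrite in_itv.
Qed.

Lemma cont_sqint f (a b : R) : (forall x, a <= x <= b -> {for x, continuous f}) -> sqint a b f.
Proof.
move=> cf; have [M hM] := cont_bounded cf.
apply: (@sqint_bounded _ _ _ _ M).
  apply: open_continuous_measurable_fun; first exact: interval_open.
  by move=> x; rewrite inE /= in_itv/= => /andP[ax xb]; apply: cf; rewrite !ltW.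
by move=> x; rewrite /= in_itv/= => /andP[ax xb]; apply: hM; rewrite !ltW.
Qed.

Lemma cont_null (a b : R) (f : l2fun a b) : (forall x, a < x < b -> {for x, continuous f}) ->
  l2dot a b f f = 0 -> forall x, a < x < b -> f x = 0.
Proof.
move=> cf f0 x /andP[ax xb]; apply: contrapT => /eqP fx.
have c0 : 0 < `|f x| / 2 by rewrite divr_gt0// normr_gt0.
have fxc : {for x, continuous f} by apply: cf; rewrite ax.
move/cvgrPdist_lt: fxc => /(_ _ c0) [r /= r0 hr].
pose s := Num.min r (b - x) / 2.
have m0 : 0 < Num.min r (b - x) by rewrite lt_min r0 subr_gt0.
have s0 : 0 < s by rewrite divr_gt0.
have sr : s < r.
  by rewrite /s ltr_pdivrMr// (le_lt_trans (_ : _ <= r))// ?ge_min ?lexx// ltr_pMr// ltr1n.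
have sb : s < b - x.
  by rewrite /s ltr_pdivrMr// (le_lt_trans (_ : _ <= b - x))// ?ge_min ?lexx ?orbT// ltr_pMr ?subr_gt0// ltr1n.
have : (`|f x| / 2) ^+ 2 * s <= l2dot a b f f.
  have e : l2dot a b (ind a b (x + s) - ind a b x) (l2one a b) = s.
    have ab : a <= b by rewrite ltW// (lt_trans ax).
    rewrite dotBl -!ind_b// !dot_ind_itv//; lra.
  rewrite -{1}e -dotZl.
  pose g := (`|f x| / 2) *: (ind a b (x + s) - ind a b x).
  apply: (@le_trans _ _ (l2dot a b g g)).
    rewrite le_eqVlt; apply/orP; left; apply/eqP; rewrite /g !dotZl dotZr expr2 -mulrA.
    by rewrite indD_sq ?e//; lra.
  apply: le_Rintegral; [exact: measurable_D|exact: sqint_mul (l2P _) (l2P _)..|].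
  move=> y; rewrite /= in_itv/= => /andP[ay yb].
  suff : (`|f x| / 2 * (ind a b (x + s) y - ind a b x y)) *
    (`|f x| / 2 * (ind a b (x + s) y - ind a b x y)) <= f y * f y by [].
  rewrite !indE -!expr2.
  have [yx|xy] := ltP y x.
    have -> : (y < x + s) = true by lra.
    by rewrite subrr mulr0 expr0n sqr_ge0.
  have [ys|sy] := ltP y (x + s); last by rewrite subrr mulr0 expr0n sqr_ge0.
  rewrite subr0 mulr1 -(real_normK (num_real (f y))) ler_sqr ?nnegrE ?(ltW c0)//.
  have : ball x r y by rewrite /ball/= distrC ger0_norm ?subr_ge0//; lra.
  move=> /hr h; have := ler_normD (f x - f y) (f y); rewrite subrK; lra.
rewrite f0 leNgt => /negP; apply.
by rewrite mulr_gt0// exprn_gt0.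
Qed.

Lemma hder_const (a b : R) (ab : a < b) (f g : l2fun a b) : hder (l2ad ab) f g ->
  exists k, l2dot a b (f - (prim g + k *: l2one a b)) (f - (prim g + k *: l2one a b)) = 0.
Proof.
move=> h; pose z := f - prim g; exists (mean (l2ad ab) z).
have -> : f - (prim g + mean (l2ad ab) z *: l2one a b) = center (l2ad ab) z.
  by rewrite /center -lock opprD addrA.
rewrite center_center dotC; set w := center (l2ad ab) z.
have w0 : l2dot a b w (l2one a b) = 0 := center_dot_one (l2ad ab) z.
have := h w w0; have := ad_skew (l2ad ab) g w; rewrite w0 mulr0 => /eqP.
rewrite addr_eq0 => /eqP e1 e2; rewrite /z dotBl e2.
by rewrite -[prim g]/(l2ad ab g) e1 subrr.
Qed.

(** On ]t/2, 2t[ the function [f] minus a primitive of [g] is constant up to a null function, and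
    continuity removes the exceptional set. *)
Lemma weak_is_derive f g :
  (forall t, 0 < t -> {for t, continuous f}) -> (forall t, 0 < t -> {for t, continuous g}) ->
  (forall a b (c : R -> R), 0 < a -> a < b -> test_fun `]a, b[%classic c ->
    l2dot a b (mkl2 a b f) (mkl2 a b (c^`())%classic) = - l2dot a b (mkl2 a b g) (mkl2 a b c)) ->
  forall t : R, 0 < t -> is_derive t 1 f (g t).
Proof.
move=> cf cg fg t t0; pose a := t / 2; pose b := 2 * t.
have a0 : 0 < a by rewrite divr_gt0.
have ab : a < b by rewrite /a /b; lra.
have cf' x : a <= x <= b -> {for x, continuous f} by move=> /andP[ax _]; apply: cf; lra.
have cg' x : a <= x <= b -> {for x, continuous g} by move=> /andP[ax _]; apply: cg; lra.
have sf := cont_sqint cf'; have sg := cont_sqint cg'.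
have [k hk] := hder_const (@hder_char R a b ab _ _ (fun c => fg a b c a0 ab)).
pose F x := \int[leb]_(u in `]a, x]) g u.
have ig : leb.-integrable `[a, b] (EFin \o g).
  apply: continuous_compact_integrable; first exact: segment_compact.
  by apply: continuous_in_subspaceT => x; rewrite inE /= in_itv/=; exact: cg'.
have FE x : a < x < b -> prim (mkl2 a b g) x = F x.
  move=> /andP[ax xb]; rewrite primE dot_ind_itvoo ?(ltW xb)// mkl2K//.
  rewrite Rintegral_itv_bndo_bndc//; apply: integrableS ig => //.
  by move=> y /=; rewrite !in_itv/=; lra.
have dF x : a < x < b -> is_derive x 1 F (g x).
  move=> /andP[ax xb].
  have [||||h1 h2] := @continuous_FTC1 R g (BRight a) x b.
  - exact: xb.
  - by apply: integrableS ig => // y /=; rewrite !in_itv/=; lra.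
  - exact: ax.
  - by apply: cg'; rewrite !ltW.
  by apply: DeriveDef; [exact: h1|rewrite -derive1E; exact: h2].
have fE x : a < x < b -> f x = F x + k.
  move=> xab; pose e := mkl2 a b f - (prim (mkl2 a b g) + k *: l2one a b).
  have eE y : e y = f y - (prim_fun (mkl2 a b g) y + k).
    transitivity (mkl2 a b f y - (prim (mkl2 a b g) y + k * l2one a b y)) => //.
    by rewrite mkl2K// primE l2oneE mulr1.
  have := cont_null (f := e) _ hk xab; rewrite eE => h.
  rewrite -(FE x xab) primE; apply/eqP; rewrite -subr_eq0; apply/eqP; apply: h => y yab.
  rewrite (_ : l2val e = (fun y => f y - (prim_fun (mkl2 a b g) y + k))); last exact/funext.
  apply: cvgB; first by apply: cf; move: yab => /andP[ay _]; exact: lt_trans ay.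
  apply: cvgD; last exact: cvg_cst.
  by apply: prim_continuous; rewrite inE.
have tab : a < t < b by rewrite /a /b; lra.
apply: (@near_eq_is_derive _ R R (fun x => F x + k)).
  near=> x; apply/esym/fE; apply/andP; split; near: x; [apply: lt_nbhsr|apply: lt_nbhsl]; lra.
rewrite -[g t]addr0; apply: is_deriveD; exact: dF.
Unshelve. all: by end_near. Qed.

End ScalarTime.

(** * Null sets and measurable representatives in time *)

Section AlmostEverywhere.
Import HBNNSimple.
Context {R : realType}.
Local Notation leb := (@lebesgue_measure R).

(* No measurability is required: simple functions below f are cut off on N.  This
   matters because t |-> ip L (psit t) w is only almost everywhere equal to a Borel
   function. *)
Lemma ge0_le_integral_off_null (f g : R -> \bar R) (N : set R) :
  measurable N -> leb N = 0%E -> (forall x, 0 <= f x)%E -> (forall x, 0 <= g x)%E ->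
  (forall x, ~ N x -> f x = g x) -> (\int[leb]_x f x <= \int[leb]_x g x)%E.
Proof.
move=> mN N0 f0 g0 fg; rewrite [leLHS]ge0_integralTE//; apply: ge_ereal_sup => _ [h hf <-].
have mC : measurable (~` N) by exact: measurableC.
pose h' := proj_nnsfun h mC.
have h'E x : h' x = h x * \1_(~` N) x by rewrite /h' /= mindicE indicE.
apply: (@le_trans _ _ (sintegral leb h')).
  rewrite -!integralT_nnsfun le_eqVlt; apply/orP; left; apply/eqP.
  apply: ge0_ae_eq_integral => //.
  - by apply/measurable_EFinP.
  - by apply/measurable_EFinP.
  - by move=> x _; rewrite lee_fin fun_ge0.
  - by move=> x _; rewrite lee_fin fun_ge0.
  exists N; split => // x /= hx; apply: contrapT => Nx; apply: hx => _.
  by rewrite /= mindicE mem_set ?mulr1.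
rewrite [leRHS]ge0_integralTE//; apply: ereal_sup_ubound; exists h' => // x.
rewrite h'E indicE; have [Nx|Nx] := pselect (N x).
  by rewrite memNset ?mulr0// => /(_ Nx).
by rewrite mem_set// mulr1 -fg.
Qed.

Lemma Rintegral_off_null (D N : set R) (f g : R -> R) : measurable N -> leb N = 0%E ->
  (forall x, D x -> ~ N x -> f x = g x) ->
  \int[leb]_(x in D) f x = \int[leb]_(x in D) g x.
Proof.
move=> mN N0 fg; rewrite Rintegral_mkcond [RHS]Rintegral_mkcond; set f' := f \_ D; set g' := g \_ D.
have fg' x : ~ N x -> f' x = g' x.
  by move=> Nx; rewrite /f' /g' !patchE; case: ifPn => //; rewrite inE => Dx; exact: fg.
rewrite /Rintegral !(integralE leb setT (EFin \o _)); congr (fine (_ - _)%E);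
  apply/eqP; rewrite eq_le; apply/andP; split; apply: (ge0_le_integral_off_null mN N0) => //;
  by move=> x Nx; rewrite ?funeposE ?funenegE /= fg'.
Qed.

Lemma ae_exists (P : R -> Prop) (a b : R) : {ae leb, forall t, P t} -> a < b -> exists2 t, a < t < b & P t.
Proof.
move=> [N [mN N0 hN]] ab; apply: contrapT => h.
have : (leb `]a, b[ <= leb N)%E.
  apply: le_measure; rewrite ?inE//.
  move=> t; rewrite /= in_itv/= => tab; apply: hN => Pt; apply: h; by exists t.
by rewrite N0 lebesgue_measure_itv/= lte_fin ab -EFinD lee_fin leNgt subr_gt0 ab.
Qed.

End AlmostEverywhere.

Section TimeIntegrals.
Context {R : realType}.
Implicit Types (f g F c : R -> R).

Lemma test_fun_sub (O O' : set R) c : O `<=` O' -> test_fun O c -> test_fun O' c.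
Proof.
by move=> OO' [sc [K [cK KO Kc]]]; split => //; exists K; split => // x /KO /OO'.
Qed.

Lemma pairing_l2dot (a b : R) F c : 0 < a -> (forall t, ~ `]a, b[%classic t -> c t = 0) ->
  sqint a b F -> sqint a b c -> pairing F c = l2dot a b (mkl2 a b F) (mkl2 a b c).
Proof.
move=> a0 c0 sF sc; rewrite l2dotE /pairing Rintegral_mkcond [RHS]Rintegral_mkcond; apply: eq_Rintegral => t _.
rewrite !patchE !mkl2K//; case: ifPn => h1; case: ifPn => h2 //.
  rewrite c0 ?mulr0// => h; move: h2; by rewrite mem_set.
exfalso; move: h2 h1; rewrite inE /= in_itv/= => /andP[at_ _]; rewrite mem_set//= in_itv/= andbT.
exact: lt_trans at_.
Qed.

End TimeIntegrals.

Section MeasurableVersion.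
Context {R : realType} (L : R) (hL : 0 < L).

Local Notation leb := (@lebesgue_measure R).
Local Notation S := (l2dot 0 L).
Local Notation mk := (mkl2 0 L).

Lemma mkl2_val (a b : R) (g : l2fun a b) : mkl2 a b g = g.
Proof. by rewrite /mkl2 valKd. Qed.

Lemma l2_sumE (a b : R) n (F : 'I_n -> l2fun a b) x : (\sum_(i < n) F i) x = \sum_(i < n) F i x.
Proof.
elim: n F => [|n IH] F; first by rewrite !big_ord0.
by rewrite !big_ord_recr /= -IH.
Qed.

(** The values of [v] on a null set of times are arbitrary. [V] replaces them by 0, which makes it
    bounded at every time with measurable pairings, as limits of pairings of simple functions. *)
Lemma measurable_version (v : R -> R -> R) : Linfty (L2star L) (@L2norm R L) v ->
  exists (V : R -> l2fun 0 L) (N : set R) M,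
    [/\ measurable N, leb N = 0%E, forall t, nrm S (V t) <= M,
        forall y, measurable_fun setT (fun t => S (V t) y) &
        forall t, 0 < t -> ~ N t -> L2 L (v t) /\ V t = mk (v t)].
Proof.
move=> [h1 [s [hs h2]] [M h3]].
have Fae := @ae_filter_ringOfSetsType _ _ _ leb.
have [N [mN N0 hN]] : {ae leb, forall t, 0 < t -> [/\ L2star L (v t),
    (fun n => L2norm L (v t \- s n t)) @ \oo --> (0 : R) & L2norm L (v t) <= M]}.
  apply: (@filterS3 _ _ Fae _ _ _ _ _ h1 h2 h3) => t k1 k2 k3 t0; split; [exact: k1|exact: k2|exact: k3].
have gd t : 0 < t -> ~ N t -> [/\ L2star L (v t),
    (fun n => L2norm L (v t \- s n t)) @ \oo --> (0 : R) & L2norm L (v t) <= M].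
  by move=> t0 Nt; apply: contrapT => h; apply: Nt; apply: hN => /= h'; apply: h; exact: h'.
pose G := `]0, +oo[%classic `\` N.
have mG : measurable (G : set (g_sigma_algebraType (R.-ocitv.-measurable))).
  by apply: measurableD => //; exact: measurable_itv.
have GP t : G t -> 0 < t /\ ~ N t by rewrite /G /= in_itv/= andbT.
pose V t := if t \in G then mk (v t) else 0.
exists V, N, `|M|; split => //.
- move=> t; rewrite /V; case: ifPn => [|_]; last by rewrite /nrm dot0l sqrtr0.
  rewrite inE => /GP [t0 Nt]; have [[lv _] _ hM] := gd t t0 Nt.
  by rewrite -L2normE//; apply: le_trans hM _; exact: ler_norm.
- move=> y.
  have sm n : exists b : R -> R, measurable_fun setT b /\ forall t, L2 L (s n t) /\ b t = S (mk (s n t)) y.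
    have [k [A [f [hA hf]]]] := hs n.
    exists (fun t => \sum_(i < k) \1_(A i) t * S (mk (f i)) y); split.
      apply: measurable_sum => i; apply: measurable_funM; last exact: measurable_cst.
      by apply: measurable_indic; have [] := hA i.
    move=> t.
    have sE : s n t = l2val (\sum_(i < k) (\1_(A i) t : R) *: mk (f i)).
      apply/funext => x; rewrite hf l2_sumE; apply: eq_bigr => i _.
      by rewrite l2ZE mkl2K//; exact: (hA i).2.1.
    rewrite sE; split; first exact: l2P.
    rewrite mkl2_val; clear; elim/big_rec2: _ => [|i a g _ ->]; first by rewrite dot0l.
    by rewrite dotDl dotZl.
  have /choice[b hb] := sm.
  have mw n : measurable_fun setT (fun t : R => \1_G t * b n t : R).
    by apply: measurable_funM; [exact: measurable_indic|exact: (hb n).1].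
  apply: (measurable_fun_cvg mw) => t _; rewrite /V indicE; case: ifPn => tG; last first.
    by rewrite dot0l; under eq_fun do rewrite mul0r; exact: cvg_cst.
  move: tG; rewrite inE => /GP [t0 Nt]; have [[lv _] ht _] := gd t t0 Nt.
  under eq_fun do rewrite mul1r ((hb _).2 t).2.
  apply/cvgrPdist_lt => e e0.
  have c0 : 0 < nrm S y + 1 by have := nrm_ge0 S y; lra.
  move/cvgrPdist_lt : ht => /(_ _ (divr_gt0 e0 c0)); apply: filterS => n.
  have ls := ((hb n).2 t).1.
  rewrite sub0r normrN ger0_norm ?sqrtr_ge0// L2normE ?mkB//; last exact: L2B.
  rewrite ltr_pdivlMr// => hn; rewrite -dotBl; apply: le_lt_trans (cauchy_schwarz _ _ _) _.
  by apply: le_lt_trans hn; rewrite ler_wpM2l ?nrm_ge0// lerDl.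
- move=> t t0 Nt; have [[lv _] _ _] := gd t t0 Nt; split => //.
  by rewrite /V ifT// inE /G /= in_itv/= t0.
Qed.

End MeasurableVersion.

Lemma ae_le (R : realType) (f : R -> R) C : cont_pos f ->
  {ae @lebesgue_measure R, forall t, 0 < t -> `|f t| <= C} -> forall t, 0 < t -> `|f t| <= C.
Proof.
move=> cf hC t t0; apply/ler_addgt0Pr => e e0.
have /cvgrPdist_lt/(_ e e0) [r /= r0 hr] := cf t t0.
have tr : t < t + r by rewrite ltrDl.
have [s /andP[ts str] hs] := ae_exists hC tr.
have h1 : `|f t - f s| < e.
  by apply: hr; rewrite /ball/= distrC ger0_norm ?subr_ge0 ?(ltW ts)//; lra.
have h2 := ler_normD (f t - f s) (f s); rewrite subrK in h2.
have h3 := hs (lt_trans t0 ts); lra.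
Qed.

(** * From almost every time to every time *)

Section DenseBounds.
Context {R : realType} {H : lmodType R} (S : inner_product H) (T : set H).
Hypothesis T_dense : forall x e, 0 < e -> exists2 w, T w & nrm S (x - w) < e.

Lemma dense_wcont (x : R -> H) M : (forall t, 0 < t -> nrm S (x t) <= M) ->
  (forall w, T w -> forall t, 0 < t -> {for t, continuous (fun s : R => S (x s) w : R)}) -> wcont S x.
Proof.
move=> hM hT y t t0; apply/cvgrPdist_lt => e e0.
have M0 : 0 <= M := le_trans (nrm_ge0 S (x t)) (hM t t0).
have c0 : 0 < 3 * (M + 1) by lra.
have [w Tw hw] := T_dense y (divr_gt0 e0 c0).
move: hw; rewrite ltr_pdivlMr// => hw.
have small s : 0 < s -> `|S (x s) (y - w)| <= M * nrm S (y - w).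
  move=> s0; apply: le_trans (cauchy_schwarz _ _ _) _.
  by rewrite ler_wpM2r ?nrm_ge0// hM.
have /cvgrPdist_lt/(_ (e / 3)) := hT w Tw t t0; rewrite divr_gt0// => /(_ isT) h.
near=> s; have s0 : 0 < s by near: s; exact: lt_nbhsr.
have h1 : `|S (x t) w - S (x s) w| < e / 3 by near: s.
have h2 := small t t0; have h3 := small s s0.
have -> : S (x t) y - S (x s) y = S (x t) (y - w) - S (x s) (y - w) + (S (x t) w - S (x s) w).
  by rewrite !dotBr; ring.
have h4 := ler_normD (S (x t) (y - w) - S (x s) (y - w)) (S (x t) w - S (x s) w).
have h5 := ler_normB (S (x t) (y - w)) (S (x s) (y - w)).
have := nrm_ge0 S (y - w); lra.
Unshelve. all: by end_near. Qed.

Lemma ae_bound (x : R -> H) M : 0 <= M ->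
  {ae @lebesgue_measure R, forall t, 0 < t -> nrm S (x t) <= M} ->
  (forall w, T w -> forall t, 0 < t -> {for t, continuous (fun s : R => S (x s) w : R)}) ->
  forall t, 0 < t -> nrm S (x t) <= M.
Proof.
move=> M0 hM hT t t0; apply: (nrm_le_dense T_dense) => // w Tw; apply: le_trans (ler_norm _) _.
apply: (ae_le (hT w Tw)) => //.
apply: (@filterS _ _ (@ae_filter_ringOfSetsType _ _ _ _) _ _ _ hM) => s hs s0.
apply: le_trans (cauchy_schwarz _ _ _) _.
by rewrite ler_wpM2r ?nrm_ge0// hs.
Qed.

End DenseBounds.

(** * Curves continuous in L^2 *)

Section Curves.
Context {R : realType} (L : R) (hL : 0 < L).
Implicit Types (u v : R -> R -> R).

Local Notation S := (l2dot 0 L).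
Local Notation mk := (mkl2 0 L).

Lemma contL2_dist u t0 e : contL2 L u -> 0 <= t0 -> 0 < e ->
  exists2 r, 0 < r & forall t, 0 <= t -> `|t - t0| < r -> nrm S (mk (u t) - mk (u t0)) < e.
Proof.
move=> [lu cu] t00 e0; have /cvgrPdist_lt/(_ e e0) := cu t0 t00.
rewrite near_withinE => -[r /= r0 hr]; exists r => // t t1 tr.
have := hr t; rewrite /ball/= distrC => /(_ tr t1).
rewrite sub0r normrN ger0_norm ?sqrtr_ge0// L2normE ?mkB//; try exact: lu.
by apply: L2B; exact: lu.
Qed.

Lemma contL2_wcont u : contL2 L u -> wcont S (fun t => mk (u t)).
Proof.
move=> cu w t t0; apply/cvgrPdist_lt => e e0.
have c0 : 0 < nrm S w + 1 by have := nrm_ge0 S w; lra.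
have [r r0 hr] := contL2_dist cu (ltW t0) (divr_gt0 e0 c0).
near=> s.
have s0 : 0 < s by near: s; exact: lt_nbhsr.
have sr : `|s - t| < r.
  by rewrite distrC; near: s; apply: (@cvgr_dist_lt _ _ _ (nbhs t) _ id) => //; exact: cvg_id.
have := hr s (ltW s0) sr; rewrite ltr_pdivlMr// => h.
rewrite distrC -dotBl; apply: le_lt_trans (cauchy_schwarz _ _ _) _.
by apply: le_lt_trans h; rewrite ler_wpM2l ?nrm_ge0// lerDl.
Unshelve. all: by end_near. Qed.

Lemma contL2_bounded u : contL2 L u -> bounded_upto S (fun t => mk (u t)).
Proof.
move=> cu T; have [T0|T0] := ltP T 0.
  by exists 0 => t /andP[t0 tT]; have := lt_le_trans t0 tT; lra.
have cn : {within `[0, T], continuous (fun t => nrm S (mk (u t)))}.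
  apply/subspace_continuousP => t; rewrite /= in_itv/= => /andP[t0 tT].
  apply/cvgrPdist_lt => e e0; have [r r0 hr] := contL2_dist cu t0 e0.
  rewrite near_withinE; near=> s; move=> /=; rewrite in_itv/= => /andP[s0 sT].
  have sr : `|s - t| < r.
    by rewrite distrC; near: s; apply: (@cvgr_dist_lt _ _ _ (nbhs t) _ id) => //; exact: cvg_id.
  have h := hr s s0 sr.
  have h1 := nrmD S (mk (u s) - mk (u t)) (mk (u t)); rewrite subrK in h1.
  have h2 := nrmD S (mk (u t) - mk (u s)) (mk (u s)); rewrite subrK nrmBC in h2.
  suff : `|nrm S (mk (u t)) - nrm S (mk (u s))| < e by [].
  by rewrite ltr_norml; apply/andP; split; lra.
have [c _ hc] := EVT_max T0 cn; exists (nrm S (mk (u c))) => t /andP[t0 tT].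
by apply: hc; rewrite in_itv/= (ltW t0).
Unshelve. all: by end_near. Qed.

Lemma contL2_good u : contL2 L u -> good S (fun t => mk (u t)).
Proof. by move=> cu; split; [exact: contL2_wcont|exact: contL2_bounded]. Qed.

Lemma C1L2_wderiv u v : C1L2 L u v -> wderiv S (fun t => mk (u t)) (fun t => mk (v t)).
Proof.
move=> [[lu _] [lv _] duv] w t t0; apply/is_deriveP => e e0.
have c0 : 0 < nrm S w + 1 by have := nrm_ge0 S w; lra.
have /cvgrPdist_lt/(_ _ (divr_gt0 e0 c0)) := duv t (ltW t0).
rewrite near_withinE => -[r /= r0 hr]; exists (Num.min r t); first by rewrite lt_min r0.
move=> s; rewrite lt_min => /andP[sr st].
have [->|st0] := eqVneq s t; first by rewrite !subrr mulr0 subr0 normr0 mulr0.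
have s0 : 0 <= s by move: st; rewrite ltr_norml => /andP[]; lra.
have := hr s; rewrite /ball/= distrC => /(_ sr st0 s0).
have lus := lu s s0; have lut := lu t (ltW t0); have lvt := lv t (ltW t0).
have -> : (fun x => (u s x - u t x) / (s - t) - v t x) =
    l2val ((s - t)^-1 *: (mk (u s) - mk (u t)) - mk (v t)).
  apply/funext => x.
  transitivity ((s - t)^-1 * (mk (u s) x - mk (u t) x) - mk (v t) x) => //.
  by rewrite !mkl2K// (mulrC _^-1).
rewrite sub0r normrN ger0_norm ?sqrtr_ge0// L2normE; last exact: l2P.
rewrite mkl2_val ltr_pdivlMr// => h.
have -> : S (mk (u s)) w - S (mk (u t)) w - S (mk (v t)) w * (s - t) =
    (s - t) * S ((s - t)^-1 *: (mk (u s) - mk (u t)) - mk (v t)) w.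
  by rewrite !dotE; field; rewrite subr_eq0.
rewrite normrM mulrC ler_wpM2r//; apply: ltW; apply: le_lt_trans (cauchy_schwarz _ _ _) _.
by apply: le_lt_trans h; rewrite ler_wpM2l ?nrm_ge0// lerDl.
Qed.

End Curves.

Section Embedding.
Context {R : realType} (a b : R).
Implicit Types (u v : R -> R).

Lemma mkl2D u v : sqint a b u -> sqint a b v ->
  mkl2 a b (fun x => u x + v x) = mkl2 a b u + mkl2 a b v.
Proof.
move=> su sv; rewrite -[RHS]mkl2_val; congr mkl2; apply/funext => x.
by transitivity (mkl2 a b u x + mkl2 a b v x) => //; rewrite !mkl2K.
Qed.

Lemma mkl2Z (k : R) u : sqint a b u -> mkl2 a b (fun x => k * u x) = k *: mkl2 a b u.
Proof.
move=> su; rewrite -[RHS]mkl2_val; congr mkl2; apply/funext => x.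
by transitivity (k * mkl2 a b u x) => //; rewrite mkl2K.
Qed.

Lemma mkl2N u : sqint a b u -> mkl2 a b (fun x => - u x) = - mkl2 a b u.
Proof.
move=> su; rewrite -[RHS]mkl2_val; congr mkl2; apply/funext => x.
by transitivity (- mkl2 a b u x) => //; rewrite mkl2K.
Qed.

End Embedding.

Section TimeFunctional.
Context {R : realType} {H : lmodType R} (S : inner_product H) (a b : R) (ab : a < b).
Variables (X : R -> H) (M : R) (c : l2fun a b).
Hypothesis X_sqint : forall y, sqint a b (fun t => S (X t) y).
Hypothesis X_bound : forall t, a < t < b -> nrm S (X t) <= M.

Definition time_fun y : R := l2dot a b (mkl2 a b (fun t => S (X t) y)) c.

Lemma time_funD y z : time_fun (y + z) = time_fun y + time_fun z.
Proof.
rewrite /time_fun -dotDl; apply: l2_eq => t _; congr (_ * _).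
transitivity (mkl2 a b (fun t => S (X t) y) t + mkl2 a b (fun t => S (X t) z) t) => //.
by rewrite !mkl2K// dotDr.
Qed.

Lemma time_funZ k y : time_fun (k *: y) = k * time_fun y.
Proof.
rewrite /time_fun -dotZl; apply: l2_eq => t _; congr (_ * _).
transitivity (k * mkl2 a b (fun t => S (X t) y) t) => //.
by rewrite !mkl2K// dotZr.
Qed.

Lemma time_fun_bound : exists C, forall y, `|time_fun y| <= C * nrm S y.
Proof.
exists (M * Num.sqrt (b - a) * nrm (l2dot a b) c) => y.
apply: le_trans (cauchy_schwarz _ _ _) _; rewrite mulrAC; apply: ler_wpM2r; first exact: nrm_ge0.
have [t tab] : exists t, a < t < b by exists ((a + b) / 2); rewrite !midf_lt.
have M0 : 0 <= M := le_trans (nrm_ge0 S (X t)) (X_bound tab).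
have q0 : 0 <= M * nrm S y by rewrite mulr_ge0 ?nrm_ge0.
rewrite mulrAC -ler_sqr ?nnegrE ?nrm_ge0//; last by rewrite mulr_ge0 ?sqrtr_ge0.
rewrite -nrmE exprMn sqr_sqrtr ?subr_ge0 ?(ltW ab)//.
apply: l2_bound; [exact: ltW|move=> s; rewrite /= in_itv/= => sab; rewrite mkl2K//].
rewrite -(real_normK (num_real _)) ler_sqr ?nnegrE//.
apply: le_trans (cauchy_schwarz _ _ _) _.
by rewrite ler_wpM2r ?nrm_ge0// X_bound.
Qed.

End TimeFunctional.

Section Distributions.
Context {R : realType}.
Implicit Types (F G c : R -> R).

Local Notation leb := (@lebesgue_measure R).

Lemma eq_pairing F G c : (forall t, 0 < t -> F t = G t) -> pairing F c = pairing G c.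
Proof.
move=> FG; apply: eq_Rintegral => t; rewrite inE /= in_itv/= andbT => t0.
by rewrite FG.
Qed.

Lemma cont_pos_sqint F a b : cont_pos F -> 0 < a -> sqint a b F.
Proof. by move=> cF a0; apply: cont_sqint => x /andP[ax _]; apply: cF; exact: lt_le_trans ax. Qed.

Lemma itv_pos (a b : R) : 0 < a -> `]a, b[%classic `<=` `]0, +oo[%classic.
Proof. by move=> a0 t; rewrite /= !in_itv/= andbT => /andP[at_ _]; exact: lt_trans at_. Qed.

(** [F] is a continuous weak derivative of the zero function. *)
Lemma pairing_zero F : cont_pos F ->
  (forall c, test_fun `]0, +oo[%classic c -> pairing F c = 0) -> forall t, 0 < t -> F t = 0.
Proof.
move=> cF h t t0.
have [] := @weak_is_derive R (cst 0) F (fun t _ => cvg_cst _) cF _ t t0; last first.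
  by rewrite derive_cst.
move=> a b c a0 ab tc.
have -> : mkl2 a b (cst 0) = 0 by apply/val_inj/funext => x; rewrite /= mkl2K//; exact: sqint_cst.
rewrite dot0l -pairing_l2dot//; first by rewrite h ?oppr0//; exact: test_fun_sub (itv_pos a0) tc.
- by move=> s; exact: test_end.
- exact: cont_pos_sqint.
- by apply: smooth_l2 => //; exact: tc.1.
Qed.

End Distributions.

(** * Elimination of psi_t *)

Section Elimination.
Context {R : realType} (L : R) (hL : 0 < L) (psi psit : R -> R -> R).
Hypothesis psi_cont : contL2 L psi.
Hypothesis psi_deriv : weak_time_deriv L psi psit.
Hypothesis psit_bounded : Linfty (L2star L) (@L2norm R L) psit.

Local Notation leb := (@lebesgue_measure R).
Local Notation S := (l2dot 0 L).
Local Notation mk := (mkl2 0 L).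

(** Moving the time derivative from psi_t to the test function leaves a distributional equation
    between continuous functions, hence a classical derivative. Here [x] is any square-integrable
    function: the diffusion equations pair psi_t with derivatives w' which need not vanish at the
    ends. *)
Lemma time_deriv_eq (F G : R -> R) k (x : R -> R) : L2 L x -> cont_pos F -> cont_pos G ->
  (forall c, test_fun `]0, +oo[%classic c ->
    - pairing F (c^`())%classic + pairing (fun t => G t + k * ip L (psit t) x) c = 0) ->
  forall t : R, 0 < t -> is_derive t 1 (fun s => F s + k * S (mk (psi s)) (mk x)) (- G t).
Proof.
move=> lx cF cG h.
have [V [N [M [mN N0 VM mV hV]]]] := measurable_version psit_bounded.
have gpsi := contL2_good psi_cont.
have cpsi y : cont_pos (fun t => S (mk (psi t)) y) by move=> t t0; exact: gpsi.1.
have sV a b y : sqint a b (fun t => S (V t) y).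
  apply: (@sqint_bounded _ _ _ _ (M * nrm S y)).
    exact: measurable_funTS (mV y).
  move=> t _; apply: le_trans (cauchy_schwarz _ _ _) _.
  by rewrite ler_wpM2r ?nrm_ge0.
have repl G' k' y c : L2 L y -> pairing (fun t => G' t + k' * ip L (psit t) y) c =
    pairing (fun t => G' t + k' * S (V t) (mk y)) c.
  move=> ly; apply: (Rintegral_off_null mN N0) => t; rewrite /= in_itv/= andbT => t0 Nt.
  by have [l1 ->] := hV t t0 Nt; rewrite ipE.
have psiV a b c y : 0 < a -> a < b -> test_fun `]a, b[%classic c ->
    l2dot a b (mkl2 a b (fun t => S (mk (psi t)) y)) (mkl2 a b (c^`())%classic) =
    - l2dot a b (mkl2 a b (fun t => S (V t) y)) (mkl2 a b c).
  move=> a0 ab tc.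
  (* The definition of psi_t only allows test functions in x. As a functional of [y] the defect [l]
     is bounded, so it is represented by a vector, orthogonal to the test functions and thus to
     every [y]. *)
  pose l y := time_fun S (fun t => mk (psi t)) (mkl2 a b (c^`())%classic) y +
    time_fun S V (mkl2 a b c) y.
  have sp z : sqint a b (fun t => S (mk (psi t)) z) by exact: cont_pos_sqint.
  have [Mp hMp] := gpsi.2 b.
  have pb t : a < t < b -> nrm S (mk (psi t)) <= Mp.
    by move=> /andP[at_ tb]; apply: hMp; rewrite (lt_trans a0 at_) ltW.
  have [C1 hC1] := time_fun_bound ab (mkl2 a b (c^`())%classic) sp pb.
  have [C2 hC2] := time_fun_bound ab (mkl2 a b c) (sV a b) (fun t _ => VM t).
  have [|||z hz] := riesz (@l2_complete_fast R 0 L) (l := l).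
  - by move=> u v; rewrite /l (time_funD _ sp) (time_funD _ (sV a b)) addrACA.
  - by move=> r u; rewrite /l (time_funZ _ sp) (time_funZ _ (sV a b)) -mulrDr.
  - by exists (C1 + C2) => u; rewrite mulrDl; apply: le_trans (ler_normD _ _) (lerD (hC1 u) (hC2 u)).
  suff : S z y = 0 by rewrite -hz => /eqP; rewrite addr_eq0 => /eqP.
  apply: (dense_orthogonal (T := @test_elt R 0 L)); first by move=> e e0; exact: test_dense.
  move=> _ [w tw ->]; rewrite -hz; have lw := smooth_l2 hL tw.1.
  have sc := smooth_l2 ab tc.1; have sc' := smooth_l2 ab (smooth_deriv tc.1).
  rewrite /l /time_fun -!pairing_l2dot//; last 2 first.
  - by move=> t; exact: test_end.
  - by move=> t; apply: test_end; exact: test_deriv.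
  rewrite -(eq_pairing _ (F := fun t => ip L (psi t) w)); last first.
    by move=> t t0; rewrite ipE//; apply: psi_cont.1; exact: ltW.
  rewrite psi_deriv//; last exact: test_fun_sub (itv_pos a0) tc.
  apply/eqP; rewrite addrC subr_eq0; apply/eqP/esym.
  apply: (Rintegral_off_null mN N0) => t; rewrite /= in_itv/= andbT => t0 Nt.
  by have [l1 ->] := hV t t0 Nt; rewrite ipE.
have cf : cont_pos (fun s => F s + k * S (mk (psi s)) (mk x)).
  move=> t t0; apply: cvgD; first exact: cF.
  by apply: cvgM; [exact: cvg_cst|exact: cpsi].
have cG' : cont_pos (fun s => - G s) by move=> t t0; apply: cvgN; exact: cG.
apply: (weak_is_derive cf cG') => a b c a0 ab tc.
have tc0 := test_fun_sub (itv_pos a0) tc.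
have sc := smooth_l2 ab tc.1; have sc' := smooth_l2 ab (smooth_deriv tc.1).
have sF := @cont_pos_sqint R F a b cF a0; have sG := @cont_pos_sqint R G a b cG a0.
have sp : sqint a b (fun t => S (mk (psi t)) (mk x)) by exact: cont_pos_sqint.
have alg (A B C : R) : - A + (B + k * C) = 0 -> A + k * - C = - - B by move=> e; lra.
have := h c tc0; rewrite repl// !(pairing_l2dot (a := a) (b := b))//; last 3 first.
- by move=> t; exact: test_end.
- by apply: sqintD => //; exact: sqintZ.
- by move=> t; apply: test_end; exact: test_deriv.
rewrite (mkl2D sG (sqintZ k (sV a b (mk x)))) (mkl2D sF (sqintZ k sp)).
rewrite (mkl2Z k (sV a b (mk x))) (mkl2Z k sp) (mkl2N sG) !dotDl !dotZl dotNl psiV//.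
exact: alg.
Qed.

End Elimination.

(** * Test functions for the transposed diffusion equations *)

Section DiffusionTest.
Context {R : realType}.
Local Notation leb := (@lebesgue_measure R).

Lemma smooth_primitive (f : R -> R) c : smooth f -> (forall x, x <= c -> f x = 0) ->
  exists v : R -> R, [/\ smooth v, (v^`())%classic = f & forall x, x <= c -> v x = 0].
Proof.
move=> sf f0; pose v x := \int[leb]_(t in `]-oo, x]) f t.
have fi u : leb.-integrable `]-oo, u] (EFin \o f).
  have iu : leb.-integrable `[c, u] (EFin \o f).
    apply: continuous_compact_integrable; first exact: segment_compact.
    by apply: continuous_subspaceT; exact: (smooth_continuous sf).
  have -> : f = f \_ `[c, +oo[.
    apply/funext => x; rewrite patchE mem_setE in_itv/= andbT.
    by case: leP => // xc; rewrite f0// ltW.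
  rewrite -restrict_EFin; apply/integrable_restrict => //.
  apply: integrableS iu => //; first by apply: measurableI.
  by move=> x [] /=; rewrite !in_itv/= andbT => xu cx; rewrite cx.
have vf (x : R) : is_derive x 1 v (f x).
  have [||||h1 h2] := @continuous_FTC1 R f -oo%O x (x + 1).
  - by rewrite ltrDl.
  - exact: fi.
  - by rewrite ltNyr.
  - exact: (smooth_continuous sf).
  by apply: DeriveDef; [exact: h1|rewrite -derive1E; exact: h2].
exists v; split; [exact: smooth_antideriv vf sf|exact: derive1_ext|].
move=> x xc; transitivity (\int[leb]_(t in `]-oo, x]) (0 : R)); last by rewrite Rintegral_cst// mul0r.
by apply: eq_Rintegral => t; rewrite inE /= in_itv/= => tx; rewrite f0// (le_trans tx).
Qed.

Lemma diffusion_test (L : R) (hL : 0 < L) (om : R -> R) : test_fun `]0, L[%classic om ->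
  let J := l2ad hL in let y := J (mkl2 0 L om) in
  exists w : R -> R, [/\ smooth w, w 0 = 0, w L = 0, (w^`(2))%classic = om &
    forall z, l2dot 0 L z (mkl2 0 L w) = l2dot 0 L z (adc J y) /\
      l2dot 0 L z (mkl2 0 L (w^`())%classic) = l2dot 0 L z (center J y)].
Proof.
move=> tom J y.
have om0 x : x <= 0 -> om x = 0.
  by move=> x0; apply: (test_end tom); rewrite /= in_itv/= ltNge x0.
have [v1 [s1 d1 z1]] := smooth_primitive tom.1 om0.
have [v2 [s2 d2 z2]] := smooth_primitive s1 z1.
(* Subtracting the linear function with slope the mean of v1 restores the condition at L without
   changing the second derivative or the value at 0. *)
pose m := mean J y; pose w x := v2 x + (- m) * x.
have dw (x : R) : is_derive x 1 w (v1 x + (- m)).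
  apply: is_deriveD; first by rewrite -d2; exact: smooth_is_derive.
  have := is_deriveZ (- m) (is_derive_id x (1 : R)); rewrite /GRing.scale/= mulr1; exact.
have sid : smooth (fun x : R => x).
  apply: (smooth_antideriv (g := fun=> 1)).
  exact: smooth_cst.
have sw : smooth w by apply: smoothD; [exact: s2|apply: smoothZ; exact: sid].
have w1E : (w^`())%classic = fun x => v1 x + (- m) by exact: derive1_ext.
have w2E : (w^`(2))%classic = om.
  rewrite -[LHS]/((w^`())%classic^`())%classic w1E -d1; apply: derive1_ext => x.
  rewrite -[((v1^`())%classic) x]addr0; apply: is_deriveD; exact: smooth_is_derive.
have yE x : `]0, L[%classic x -> y x = v1 x.
  by move=> Dx; rewrite /y -d1; apply: (prim_deriv hL s1 _ Dx); exact: z1.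
have w0 : w 0 = 0 by rewrite /w z2// mulr0 addr0.
have one_L : l2dot 0 L (l2one 0 L) (l2one 0 L) = L by rewrite l2one_sq ?subr0// ltW.
have wL : w L = 0.
  have := dot_deriv_ind hL s2 (x := L); rewrite (ltW hL) lexx => /(_ isT).
  rewrite ind_b ?(ltW hL)// (z2 0)// subr0 d2 /w => <-.
  rewrite /m /mean -[one J]/(l2one 0 L) one_L.
  have -> : l2dot 0 L y (l2one 0 L) = l2dot 0 L (l2w 0 L v1) (l2one 0 L).
    by apply: l2_eq => x Dx; rewrite yE// l2wE.
  by field; rewrite gt_eqF.
have cE x : `]0, L[%classic x -> center J y x = mkl2 0 L (w^`())%classic x.
  move=> Dx; rewrite mkl2K; last by apply: (smooth_l2 hL); apply: smooth_deriv; exact: sw.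
  rewrite w1E /center -lock.
  transitivity (y x - m * l2one 0 L x) => //.
  by rewrite l2oneE mulr1 yE.
exists w; split => // z; split; apply: l2_eq => x Dx; congr (_ * _); last by rewrite cE.
rewrite mkl2K; last exact: smooth_l2.
rewrite /adc -[l2val _]/(l2val (prim (center J y))) primE.
have -> : l2dot 0 L (center J y) (ind 0 L x) = l2dot 0 L (mkl2 0 L (w^`())%classic) (ind 0 L x).
  by apply: l2_eq => s Ds; rewrite cE.
rewrite dot_deriv_ind// ?w0 ?subr0//.
by move: Dx; rewrite /= in_itv/= => /andP[/ltW -> /ltW ->].
Qed.

End DiffusionTest.

(** * From the concrete system to the abstract one *)

Section Traces.
Context {R : realType} (L : R) (hL : 0 < L).
Implicit Types (u v : R -> R -> R).

Local Notation leb := (@lebesgue_measure R).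
Local Notation S := (l2dot 0 L).
Local Notation J := (l2ad hL).
Local Notation mk := (mkl2 0 L).

Lemma ad_range_dense (x : l2fun 0 L) e : 0 < e ->
  exists2 w, [set z | exists y, z = J y] w & nrm S (x - w) < e.
Proof.
move=> e0; have [y [_ hy]] := ad_dense J x (exprn_gt0 2 e0).
exists (J y); first by exists y.
by rewrite -ltr_sqr ?nnegrE ?nrm_ge0 ?(ltW e0)// -nrmE.
Qed.

Lemma H1norm_ddx (f : R -> R) : nrm S (mk (ddx L f)) <= H1norm L f.
Proof.
rewrite -L2normE; last exact: ddx_L2.
by rewrite -[leLHS]ger0_norm ?sqrtr_ge0// -sqrtr_sqr ler_wsqrtr// lerDr sqr_ge0.
Qed.

Lemma ddx_continuous u : contL2 L u -> (forall t, 0 < t -> H10 L (u t)) -> forall y : l2fun 0 L,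
  cont_pos (fun t => S (mk (ddx L (u t))) (J y)).
Proof.
move=> cu hu y t t0.
have h : {for t, continuous (fun s => - S (mk (u s)) y)}.
  by apply: cvgN; exact: contL2_wcont.
have e s : 0 < s -> - S (mk (u s)) y = S (mk (ddx L (u s))) (J y).
  by move=> s0; have [_ ->] := H10_hvan hL (hu s s0); rewrite opprK.
have h' : (fun s => - S (mk (u s)) y) s @[s --> t] --> S (mk (ddx L (u t))) (J y).
  by rewrite -e//; exact: h.
apply: cvg_trans h'; apply: near_eq_cvg.
by near=> s; rewrite /= e//; near: s; exact: lt_nbhsr.
Unshelve. all: by end_near. Qed.

(** Paired with primitives, the x-derivative becomes a pairing of [u] itself, which is continuous in
    time; primitives are dense, so the essential bound in H^1 first becomes a bound at every time
    and then gives weak continuity. *)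
Lemma ddx_good X u : contL2 L u -> (forall t, 0 < t -> H10 L (u t)) -> Linfty X (H1norm L) u ->
  good S (fun t => mk (ddx L (u t))).
Proof.
move=> cu hu [_ _ [M hM]].
have cT w : [set z | exists y, z = J y] w -> cont_pos (fun t => S (mk (ddx L (u t))) w).
  by move=> [y ->]; exact: ddx_continuous.
have bd : forall t, 0 < t -> nrm S (mk (ddx L (u t))) <= `|M|.
  apply: (ae_bound ad_range_dense) => //.
  apply: (@filterS _ _ (@ae_filter_ringOfSetsType _ _ _ _) _ _ _ hM) => s hs s0.
  by apply: le_trans (H1norm_ddx _) _; apply: le_trans (hs s0) _; exact: ler_norm.
split; last by move=> T; exists `|M| => t /andP[t0 _]; exact: bd.
exact: (dense_wcont ad_range_dense bd cT).
Qed.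

(** Paired with [J y], the increment of u_x is minus the increment of the pairing of u with y. Its
    time derivative is bounded through v_x for almost every time, and by continuity for every
    time. *)
Lemma ddx_lip u v : C1L2 L u v -> (forall t, 0 < t -> H10 L (u t)) ->
  Linfty (H10 L) (H1norm L) v -> exists M, forall s t : R, 0 < s -> s <= t ->
  nrm S (mk (ddx L (u t)) - mk (ddx L (u s))) <= M * (t - s).
Proof.
move=> cuv hu [hv _ [M hM]]; exists `|M| => s t s0 st; have t0 := lt_le_trans s0 st.
have cv := contL2_good (let: And3 _ h _ := cuv in h).
apply: (nrm_le_dense ad_range_dense); first by rewrite mulr_ge0// subr_ge0.
move=> _ [y ->]; apply: le_trans (ler_norm _) _; have [_ h1] := H10_hvan hL (hu s s0); have [_ h2] := H10_hvan hL (hu t t0).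
have -> : S (mk (ddx L (u t)) - mk (ddx L (u s))) (J y) = - (S (mk (u t)) y - S (mk (u s)) y).
  by rewrite dotBl h1 h2 opprB opprK addrC.
rewrite normrN.
have [x /andP[sx xt] ->] := mvt_pos (fun x x0 => C1L2_wderiv cuv y x0) s0 st.
rewrite normrM (ger0_norm (_ : 0 <= t - s)) ?subr_ge0// mulrAC ler_wpM2r ?subr_ge0//.
apply: (@ae_le R (fun t => S (mk (v t)) y)); last exact: lt_le_trans sx.
  by move=> z z0; exact: cv.1.
apply: (@filterS2 _ _ (@ae_filter_ringOfSetsType _ _ _ _) _ _ _ _ hv hM) => z hz Mz z0.
have [_ ->] := H10_hvan hL (hz z0); rewrite normrN.
apply: le_trans (cauchy_schwarz _ _ _) _; rewrite ler_wpM2r ?nrm_ge0//.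
by apply: le_trans (H1norm_ddx _) _; apply: le_trans (Mz z0) _; exact: ler_norm.
Qed.

Lemma prim_dtest (w : R -> R) (z : l2fun 0 L) : test_fun `]0, L[%classic w ->
  S z (J (mk (w^`())%classic)) = S z (mk w).
Proof.
move=> tw; apply: l2_eq => x Dx; congr (_ * _).
by rewrite [LHS](prim_deriv hL tw.1 (test_left tw) Dx) mkl2K//; exact: smooth_l2 tw.1.
Qed.

End Traces.

Section Solution.
Context {R : realType} (rho1 rho2 kappa alpha h c r mu L d xi1 xi2 : R) (hL : 0 < L).
Context (phi phit phitt psi psit theta P : R -> R -> R).
Hypothesis hclass : solution_class L phi phit phitt psi psit theta P.
Hypothesis hsys : system L rho1 rho2 kappa alpha h c r d xi1 xi2 mu
  phi phitt psi psit theta P.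
Hypothesis hbound : boundary_conditions L phi psi.

Local Notation S := (l2dot 0 L).
Local Notation J := (l2ad hL).
Local Notation mk := (mkl2 0 L).

Let Phi t := mk (phi t). Let Phix t := mk (ddx L (phi t)). Let Phit t := mk (phit t).
Let Phitt t := mk (phitt t). Let Psi t := mk (psi t). Let Psix t := mk (ddx L (psi t)).
Let Th t := mk (theta t). Let Pp t := mk (P t).

Let cphi : contL2 L phi. Proof. by have [[[]]] := hclass. Qed.
Let cphit : contL2 L phit. Proof. by have [[[]]] := hclass. Qed.
Let cphitt : contL2 L phitt. Proof. by have [[_ []]] := hclass. Qed.
Let cpsi : contL2 L psi. Proof. by have [_ []] := hclass. Qed.
Let cth : contL2 L theta. Proof. by have [_ _ []] := hclass. Qed.
Let cP : contL2 L P. Proof. by have [_ _ []] := hclass. Qed.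
Let wpsit : weak_time_deriv L psi psit. Proof. by have [_ []] := hclass. Qed.
Let bpsit : Linfty (L2star L) (@L2norm R L) psit. Proof. by have [_ []] := hclass. Qed.
Let hphi t : 0 < t -> H10 L (phi t). Proof. by move=> t0; have [] := hbound t0. Qed.
Let hpsi t : 0 < t -> H10 L (psi t). Proof. by move=> t0; have [] := hbound t0. Qed.

Let gPhix : good S Phix.
Proof. by have [[_ _ b _] _ _] := hclass; exact: (ddx_good hL cphi hphi b). Qed.
Let gPsix : good S Psix.
Proof. by have [_ [_ _ b _] _] := hclass; exact: (ddx_good hL cpsi hpsi b). Qed.
Let gPhitt : good S Phitt := contL2_good cphitt.
Let gPsi : good S Psi := contL2_good cpsi.
Let gTh : good S Th := contL2_good cth.
Let gPp : good S Pp := contL2_good cP.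

Let l2_smooth w : smooth w -> L2 L w. Proof. exact: smooth_l2. Qed.

Let ip_curve (u : R -> R -> R) (w : R -> R) t : contL2 L u -> L2 L w -> 0 < t ->
  ip L (u t) w = S (mk (u t)) (mk w).
Proof. by move=> cu lw t0; rewrite ipE//; apply: cu.1; exact: ltW. Qed.

Let ip_strain w t : L2 L w -> 0 < t -> ip L (ddx L (phi t) \+ psi t) w = S (Phix t + Psi t) (mk w).
Proof.
move=> lw t0; have lp : L2 L (psi t) by apply: cpsi.1; exact: ltW.
by rewrite ipE//; [rewrite mkl2D//|apply: sqintD => //]; exact: ddx_L2.
Qed.

Let weak_eq_phi t : 0 < t -> hder J (kappa *: (Phix t + Psi t)) (rho1 *: Phitt t).
Proof.
move=> t0; apply: hder_char => w tw.
have lw := l2_smooth tw.1; have lw' := l2_smooth (smooth_deriv tw.1).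
have g := goodZ rho1 gPhitt; have g' := goodZ kappa (goodD gPhix gPsi).
pose F s := S (rho1 *: Phitt s) (mk w) + S (kappa *: (Phix s + Psi s)) (mk (w^`())%classic).
suff : F t = 0 by rewrite /F addrC => /eqP; rewrite addr_eq0 => /eqP.
apply: pairing_zero t0.
  by move=> s s0; apply: cvgD; [exact: g.1|exact: g'.1].
move=> a ta; have [e _ _ _] := hsys; rewrite -[RHS](e w a tw ta).
apply: eq_pairing => s s0; rewrite (ip_curve cphitt)// ip_strain//.
by rewrite /F !dotZl.
Qed.

Let weak_eq_psi (t : R) (y : l2fun 0 L) : 0 < t -> dtest_elt y ->
  is_derive t (1 : R) (fun s => mu * S (Psi s) (J y))
    (- (S (rho2 *: Phitt t + alpha *: Psix t + (xi1 *: Th t + xi2 *: Pp t)) y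
        + S (kappa *: (Phix t + Psi t)) (J y))).
Proof.
move=> t0 [w tw ->]; have lw := l2_smooth tw.1; have lw' := l2_smooth (smooth_deriv tw.1).
(* The abstract test vector is the derivative w', and its primitive is the test function w of the
   concrete equation. *)
have pw z : S z (J (l2w 0 L (w^`())%classic)) = S z (mk w) by exact: prim_dtest.
have alg (A B C D E X : R) : A + B + (C + D) + E + X = A + B + E + C + D + X by ring.
pose G s := S (rho2 *: Phitt s + alpha *: Psix s + (xi1 *: Th s + xi2 *: Pp s)) (l2w 0 L (w^`())%classic)
  + S (kappa *: (Phix s + Psi s)) (mk w).
have cG : cont_pos G.
  have g := goodD (goodD (goodZ rho2 gPhitt) (goodZ alpha gPsix)) (goodD (goodZ xi1 gTh) (goodZ xi2 gPp)).
  have g' := goodZ kappa (goodD gPhix gPsi).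
  by move=> s s0; apply: cvgD; [exact: g.1|exact: g'.1].
have c0 : cont_pos (cst 0 : R -> R) by move=> s s0; exact: cvg_cst.
have := time_deriv_eq hL cpsi wpsit bpsit (k := mu) lw c0 cG; rewrite /G => key.
rewrite pw.
rewrite (_ : (fun s => _) = (fun s => cst 0 s + mu * S (mk (psi s)) (mk w))); last first.
  by apply/funext => s; rewrite add0r pw.
apply: key => // a ta.
have -> : pairing (cst 0) (a^`())%classic = 0.
  rewrite /pairing (eq_Rintegral _ (g := fun=> 0)); last by move=> s _; rewrite mul0r.
  by rewrite /Rintegral integral0.
have [_ e _ _] := hsys; rewrite oppr0 add0r -[RHS](e w a tw ta); apply: eq_pairing => s s0.
rewrite !(ip_curve cphitt, ip_curve cth, ip_curve cP)// ip_strain//.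
have -> : ip L (ddx L (psi s)) (w^`())%classic = S (Psix s) (mk (w^`())%classic).
  by rewrite ipE//; exact: ddx_L2.
have -> z : S (rho2 *: Phitt s + alpha *: Psix s + (xi1 *: Th s + xi2 *: Pp s)) z =
    rho2 * S (Phitt s) z + alpha * S (Psix s) z + (xi1 * S (Th s) z + xi2 * S (Pp s) z).
  by rewrite !dotDl !dotZl.
rewrite (dotZl S kappa); exact: alg.
Qed.

Let weak_eq_diffusion a1 a2 k xi (q : R -> R -> R) : contL2 L q ->
  eq_diffusion L a1 a2 k xi theta P q psit -> forall (t : R) (y : l2fun 0 L), 0 < t -> test_elt y ->
  is_derive t (1 : R)
    (fun s => S (a1 *: Th s + a2 *: Pp s) (adc J (J y)) + xi * S (Psi s) (center J (J y)))
    (k * S (mk (q t)) y).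
Proof.
move=> cq hq t y t0 [om tom ->].
have [w [sw w0 wL w2 hw]] := diffusion_test hL tom.
have lw := l2_smooth sw; have lw' := l2_smooth (smooth_deriv sw).
have lom := l2_smooth tom.1.
pose F s := S (a1 *: Th s + a2 *: Pp s) (mk w).
pose G s := - (k * S (mk (q s)) (mk om)).
have cF : cont_pos F by move=> s s0; exact: (goodD (goodZ a1 gTh) (goodZ a2 gPp)).1.
have cG : cont_pos G.
  by move=> s s0; apply: cvgN; apply: cvgM; [exact: cvg_cst|exact: (contL2_good cq).1].
have key := time_deriv_eq hL cpsi wpsit bpsit (k := xi) lw' cF cG.
rewrite (_ : (fun s => _) = (fun s => F s + xi * S (mk (psi s)) (mk (w^`())%classic))); last first.
  by apply/funext => s; rewrite (hw (Psi s)).2 /F (hw (a1 *: Th s + a2 *: Pp s)).1.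
rewrite -[k * _]opprK; apply: key => // a ta.
have -> : pairing F (a^`())%classic =
    pairing (fun s => ip L (fun x => a1 * theta s x + a2 * P s x) w) (a^`())%classic.
  apply: eq_pairing => s s0; rewrite /F.
  have lth : L2 L (theta s) by apply: cth.1; exact: ltW.
  have lP : L2 L (P s) by apply: cP.1; exact: ltW.
  rewrite ipE//; last by apply: sqintD; exact: sqintZ.
  by rewrite (mkl2D (sqintZ _ lth) (sqintZ _ lP)) (mkl2Z _ lth) (mkl2Z _ lP).
have -> : pairing (fun s => G s + xi * ip L (psit s) (w^`())%classic) a =
    pairing (fun s => - k * ip L (q s) (w^`(2))%classic + xi * ip L (psit s) (w^`())%classic) a.
  by apply: eq_pairing => s s0; rewrite /G w2 (ip_curve cq lom s0) mulNr.
exact: (hq w a sw w0 wL ta).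
Qed.

Lemma solution_weak : weak_solution J rho1 rho2 kappa alpha h c r mu d xi1 xi2
  (@dtest_elt R 0 L) (@test_elt R 0 L) Phi Phix Phit Phitt Psi Psix Th Pp.
Proof.
have [[C1 C2 b1 b2] _ _] := hclass; have [_ _ eth eP] := hsys.
apply: WeakSolution.
- exact: (contL2_good cphi).
- exact: gPhix.
- exact: (contL2_good cphit).
- exact: gPhitt.
- exact: gPsi.
- exact: gPsix.
- exact: gTh.
- exact: gPp.
- by move=> t t0; apply: H10_hvan; exact: hphi.
- by move=> t t0; apply: H10_hvan; exact: hpsi.
- exact: (C1L2_wderiv C1).
- exact: (C1L2_wderiv C2).
- exact: (ddx_lip hL C1 hphi b2).
- exact: weak_eq_phi.
- by move=> t y t0 ty; exact: (weak_eq_psi t0 ty).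
- by move=> t y t0 ty; exact: (weak_eq_diffusion cth eth t0 ty).
- by move=> t y t0 ty; exact: (weak_eq_diffusion cP eP t0 ty).
Qed.

End Solution.

(** * The concrete energy and the final estimate *)

Section Energy.
Context {R : realType} (L : R) (hL : 0 < L).

Local Notation S := (l2dot 0 L).
Local Notation mk := (mkl2 0 L).
Local Notation leb := (@lebesgue_measure R).

Lemma integral_sqE (f : R -> R) : L2 L f ->
  \int[leb]_(x in `]0, L[%classic) f x ^+ 2 = sq S (mk f).
Proof.
by move=> lf; rewrite /sq l2dotE; apply: eq_Rintegral => x _; rewrite mkl2K// expr2.
Qed.

(** [ddx L f] is either some weak derivative of [f] or the default 0; a bound valid for all weak
    derivatives covers both cases. *)
Lemma ddx_sq_le (f : R -> R) b : 0 <= b -> L2 L f ->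
  (forall y, hder (l2ad hL) (mk f) y -> sq S y <= b) ->
  \int[leb]_(x in `]0, L[%classic) ddx L f x ^+ 2 <= b.
Proof.
move=> b0 lf hb; rewrite integral_sqE; last exact: ddx_L2.
rewrite /ddx; case: xgetP => [v -> [lv dv]|_]; first by apply: hb; exact: weak_hder.
have -> : mk (fun=> 0) = 0 by apply/val_inj/funext => x; rewrite /= mkl2K//; exact: sqint_cst.
by rewrite /sq dot0l.
Qed.

End Energy.

Lemma weighted_le (R : realFieldType) (k1 k2 k3 k4 k5 k6 x1 x2 x3 x4 x5 x6 x7 b : R) :
  0 <= k1 -> 0 <= k2 -> 0 <= k3 -> 0 <= k4 -> 0 <= k5 -> 0 <= k6 ->
  x1 <= b -> x2 <= b -> x3 <= b -> x4 <= b -> x5 <= b -> x6 <= b -> x7 <= b ->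
  2^-1 * (k1 * x1 + k2 * x2 + k3 * x3 + k4 * x4 + k5 * x5 + k6 * x6 + x7) <=
  2^-1 * (k1 + k2 + k3 + k4 + k5 + k6 + 1) * b.
Proof.
move=> p1 p2 p3 p4 p5 p6 b1 b2 b3 b4 b5 b6 b7.
have := ler_wpM2l p1 b1; have := ler_wpM2l p2 b2; have := ler_wpM2l p3 b3.
have := ler_wpM2l p4 b4; have := ler_wpM2l p5 b5; have := ler_wpM2l p6 b6.
lra.
Qed.

Theorem theorem3p6 (R : realType)
  (rho1 rho2 kappa alpha h c r mu L d xi1 xi2 : R)
  (hrho1 : 0 < rho1) (hrho2 : 0 < rho2) (hkappa : 0 < kappa)
  (halpha : 0 < alpha) (hh : 0 < h) (hc : 0 < c) (hr : 0 < r) (hmu : 0 < mu)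
  (hL : 0 < L) (hcrd : 0 < c * r - d ^+ 2)
  (phi phit phitt psi psit theta P : R -> R -> R)
  (phi0 phi1 phi2 psi0 psi1 theta0 P0 : R -> R)
  (hclass : solution_class L phi phit phitt psi psit theta P)
  (hsys : system L rho1 rho2 kappa alpha h c r d xi1 xi2 mu
            phi phitt psi psit theta P)
  (hinit : initial_conditions L phi phit phitt psi theta P
             phi0 phi1 phi2 psi0 psi1 theta0 P0)
  (hbound : boundary_conditions L phi psi) :
  exists lambda1 lambda2 : R,
    [/\ 0 < lambda1, 0 < lambda2 &
        forall t : R, 0 <= t ->
          energy L rho1 rho2 kappa alpha c r d phi phit phitt psi theta P t
          <= lambda2 * expR (- lambda1 * t)].
Proof.
have HW := solution_weak hL hclass hsys hbound.
have HR := riesz (@l2_complete_fast R 0 L).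
have dz x e : l2dot 0 L x (one (l2ad hL)) = 0 -> 0 < e ->
    exists2 w, @dtest_elt R 0 L w & nrm (l2dot 0 L) (x - w) < e.
  by move=> x0 e0; exact: (mean_zero_dense hL x0 e0).
have da x e : 0 < e -> exists2 w, @test_elt R 0 L w & nrm (l2dot 0 L) (x - w) < e.
  by move=> e0; exact: (test_dense hL x e0).
have [C [l [C0 l0 hC]]] := weak_decay HR hrho1 hrho2 hkappa halpha hh hr hmu hcrd dz da HW.
pose E := energy L rho1 rho2 kappa alpha c r d phi phit phitt psi theta P.
pose K := 2^-1 * (rho1 + rho1 * rho2 / kappa + rho2 + kappa + alpha + (c - d ^+ 2 / r) + 1).
have cd : 0 < c - d ^+ 2 / r.
  by rewrite subr_gt0 ltr_pdivrMr// -subr_gt0.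
have K0 : 0 <= K.
  have : 0 < rho1 * rho2 / kappa by rewrite divr_gt0// mulr_gt0.
  by rewrite /K; lra.
exists l, (K * C + `|E 0| + 1); split => //.
  by have := mulr_ge0 K0 C0; have := normr_ge0 (E 0); lra.
(* The decay estimate concerns positive times only; at t = 0 the summand [|E 0|] of the second
   constant bounds the energy. *)
move=> t; rewrite le_eqVlt => /predU1P[<-|t0].
  rewrite mulr0 expR0 mulr1 -/(E 0); apply: le_trans (ler_norm _) _.
  by have := mulr_ge0 K0 C0; lra.
have /= [h1 h2 h3 h4 [h5 h6 h7]] := hC t t0.
set b := C * expR (- l * t) in h1 h2 h3 h4 h5 h6 h7.
have b0 : 0 <= b by rewrite mulr_ge0 ?expR_ge0.
suff : E t <= K * b.
  move=> EK; apply: le_trans EK _; rewrite /b mulrA ler_wpM2r ?expR_ge0//.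
  by have := normr_ge0 (E 0); lra.
have [[[cphi cphit _] [_ cphitt _] _ _] [cpsi _ _ _] [cth cP]] := hclass.
have lt0 u : contL2 L u -> L2 L (u t) by move=> cu; apply: cu.1; exact: ltW.
have lphit := lt0 _ cphit; have lphitt := lt0 _ cphitt; have lpsi := lt0 _ cpsi.
have lth := lt0 _ cth; have lP := lt0 _ cP.
have lphix := ddx_L2 L (phi t); have lpsix := ddx_L2 L (psi t).
rewrite /E /energy.
have -> : \int[lebesgue_measure]_(x in `]0, L[%classic) (ddx L (phi t) x + psi t x) ^+ 2 =
    sq (l2dot 0 L) (mkl2 0 L (ddx L (phi t)) + mkl2 0 L (psi t)).
  by rewrite (integral_sqE (sqintD lphix lpsi)) mkl2D.
have -> : \int[lebesgue_measure]_(x in `]0, L[%classic)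
      `|Num.sqrt r * P t x + d / Num.sqrt r * theta t x| ^+ 2 =
    sq (l2dot 0 L) (Num.sqrt r *: mkl2 0 L (P t) + (d / Num.sqrt r) *: mkl2 0 L (theta t)).
  have s1 := sqintZ (Num.sqrt r) lP; have s2 := sqintZ (d / Num.sqrt r) lth.
  rewrite -!mkl2Z// -mkl2D// -(integral_sqE (sqintD s1 s2)).
  by apply: eq_Rintegral => x _; rewrite real_normK ?num_real.
rewrite (integral_sqE lphit) (integral_sqE lphitt) (integral_sqE lpsix) (integral_sqE lth).
have h3' := ddx_sq_le (hL := hL) b0 lphit h7.
have p2 : 0 <= rho1 * rho2 / kappa by rewrite divr_ge0 ?mulr_ge0 ?ltW.
exact: (weighted_le (ltW hrho1) p2 (ltW hrho2) (ltW hkappa) (ltW halpha) (ltW cd)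
  h1 h2 h3' h3 h4 h5 h6).
Qed.
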